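(* The $C^*$-algebra $\mathcal{E}(-1,0)$ is isomorphic to the $C^*$-algebra of all $f\in C(I_{\frac12}\times I_{\frac12}\times S^1\times S^1\to M_4(\mathbb{C}))$ satisfying, for all values of the variables, $$f(0,x_2,e^{i\phi_1},e^{i\phi_2})=f(0,x_2,1,e^{i\phi_2}),$$ $$f(x_1,0,e^{i\phi_1},e^{i\phi_2})=f(x_1,0,e^{i\phi_1},1),$$ $$\nu_1^*(\phi_1,\phi_2)f(\tfrac12,x_2,e^{i\phi_1},e^{i\phi_2})\nu_1(\phi_1,\phi_2)\in M_2(\mathbb{C})\oplus M_2(\mathbb{C}),\quad\forall\phi_1,\phi_2\in[0,2\pi],$$ $$\nu_2^*(\phi_2)f(x_1,\tfrac12,e^{i\phi_1},e^{i\phi_2})\nu_2(\phi_2)\in M_2(\mathbb{C})\oplus M_2(\mathbb{C}),\quad\forall\phi_2\in[0,2\pi].$$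
   Context: $\mathcal{E}(-1,0)$ is the universal (enveloping) $C^*$-algebra generated by $a_1,a_2$ with relations $a_i^*a_i+a_ia_i^*=1$ ($i=1,2$), $a_1^*a_2=-a_2a_1^*$, $a_1a_2+a_2a_1=0$. $I_{\frac12}=[0,1/2]$, $S^1=\{z\in\mathbb{C}:|z|=1\}$; points of $I_{\frac12}\times I_{\frac12}\times S^1\times S^1$ are written $(x_1,x_2,e^{i\phi_1},e^{i\phi_2})$. $C(X\to M_n(\mathbb{C}))$ is the $C^*$-algebra of continuous $M_n(\mathbb C)$-valued functions on $X$ with pointwise operations. With $V(\phi)=\frac{1}{\sqrt2}\begin{pmatrix} e^{i\phi/2} & -e^{i\phi/2}\\ 1&1\end{pmatrix}$, $T(x\otimes y)=y\otimes x$ on $\mathbb{C}^2\otimes\mathbb{C}^2$, $$S=\begin{pmatrix}1&0\\0&0\end{pmatrix}\otimes\begin{pmatrix}1&0\\0&1\end{pmatrix}+\begin{pmatrix}0&0\\0&1\end{pmatrix}\otimes\begin{pmatrix}0&1\\1&0\end{pmatrix},\qquad W(\phi)=(\mathbf{1}_2\otimes V(\phi))\,S\,(\mathbf{1}_2\otimes V^*(\phi)),$$ put $\nu_1(\phi_1,\phi_2)=W(\phi_2)(V(\phi_1)\otimes\mathbf{1}_2)\in U(4)$ and $\nu_2(\phi_2)=T(V(\phi_2)\otimes\mathbf{1}_2)\in U(4)$. The identification $\mathbb{C}^2\otimes\mathbb{C}^2=\mathbb{C}^4$ is such that $A\otimes B=(a_{ij}B)$ (Kronecker product), and $M_2(\mathbb{C})\oplus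 M_2(\mathbb{C})\subset M_4(\mathbb{C})$ denotes block-diagonal matrices with two $2\times2$ blocks. *)

(* Defs.v *)
From HB Require Import structures.
From mathcomp Require Import all_boot all_order all_algebra.
From mathcomp Require Import complex mxtens.
From mathcomp Require Import all_classical all_reals all_analysis.

Set Implicit Arguments.
Unset Strict Implicit.
Unset Printing Implicit Defensive.

Import Order.TTheory GRing.Theory Num.Theory.
Import numFieldNormedType.Exports.

Local Open Scope classical_set_scope.
Local Open Scope ring_scope.
Local Open Scope complex_scope.
Local Open Scope sesquilinear_scope.

(* The complex numbers over [R], packed so that the topology and norm that
   MathComp-Analysis puts on any [numFieldType] are found by inference. *)
Definition Cplx (R : realType) : numClosedFieldType := R[i].

(* Unital C*-algebras.  The norm is a separate field, rather than inherited
   from [completeNormedModType], because the MathComp hierarchy has no join of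
   (noncommutative) rings and normed modules. *)
HB.mixin Record isCStarAlgebra (R : realType) A & GRing.Algebra (Cplx R) A := {
  star : A -> A ;
  cnorm : A -> R ;
  starK : involutive star ;
  starD : {morph star : x y / x + y} ;
  starZ : forall (c : Cplx R) (x : A), star (c *: x) = c^* *: star x ;
  starM : forall x y : A, star (x * y) = star y * star x ;
  cnorm_eq0 : forall x : A, cnorm x = 0 -> x = 0 ;
  cnormZ : forall (c : Cplx R) (x : A), cnorm (c *: x) = complex.Re `|c| * cnorm x ;
  cnormD : forall x y : A, cnorm (x + y) <= cnorm x + cnorm y ;
  cnormM : forall x y : A, cnorm (x * y) <= cnorm x * cnorm y ;
  cnorm_star : forall x : A, cnorm (star x * x) = cnorm x ^+ 2 ;
  cnorm_complete : forall u : nat -> A,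
    (forall e : R, 0 < e -> exists N, forall m n,
       (N <= m)%N -> (N <= n)%N -> cnorm (u m - u n) < e) ->
    exists l : A, forall e : R, 0 < e -> exists N, forall n,
      (N <= n)%N -> cnorm (u n - l) < e
}.

#[short(type="cStarAlgType")]
HB.structure Definition CStarAlgebra (R : realType) :=
  {A of isCStarAlgebra R A & GRing.Algebra (Cplx R) A}.

Section UniversalAlgebra.
Context {R : realType}.

(* Continuity is not required: it is automatic for C*-algebras. *)
Definition star_hom (A B : cStarAlgType R) (h : A -> B) : Prop :=
  [/\ {morph h : x y / x + y},
      (forall (c : Cplx R) x, h (c *: x) = c *: h x),
      {morph h : x y / x * y},
      h 1 = 1 &
      {morph h : x / star x}].

Definition relations_m1_0 (A : cStarAlgType R) (a1 a2 : A) : Prop :=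
  [/\ star a1 * a1 + a1 * star a1 = 1,
      star a2 * a2 + a2 * star a2 = 1,
      star a1 * a2 = - (a2 * star a1) &
      a1 * a2 + a2 * a1 = 0].

(* Universal property; that [a1] and [a2] generate [E] as a C*-algebra follows
   from the uniqueness clause. *)
Definition is_universal_m1_0 (E : cStarAlgType R) (a1 a2 : E) : Prop :=
  relations_m1_0 a1 a2 /\
  forall (B : cStarAlgType R) (b1 b2 : B), relations_m1_0 b1 b2 ->
    exists! h : E -> B, [/\ star_hom h, h a1 = b1 & h a2 = b2].

End UniversalAlgebra.

Section MatrixFunctions.
Context {R : realType}.

Definition l2norm n (v : 'cV[Cplx R]_n) : R :=
  Num.sqrt (\sum_i (complex.Re (v i 0) ^+ 2 + complex.Im (v i 0) ^+ 2)).

Definition opnorm n (A : 'M[Cplx R]_n) : R :=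
  sup [set l2norm (A *m v) | v in [set v | l2norm v <= 1]].

(* The C*-norm of C(X -> M_n); it is meant for continuous functions on a
   compact [X], where both suprema are finite. *)
Definition supnorm (X : Type) n (f : X -> 'M[Cplx R]_n) : R :=
  sup [set opnorm (f p) | p in [set: X]].

(* [E] is isomorphic to the unital C*-algebra [F] of matrix-valued functions
   with pointwise operations and supremum norm. *)
Definition isomorphic_to_functions (X : Type) n (E : cStarAlgType R)
    (F : set (X -> 'M[Cplx R]_n)) : Prop :=
  exists phi : E -> X -> 'M[Cplx R]_n,
    [/\ [/\ forall a b p, phi (a + b) p = phi a p + phi b p,
            forall c a p, phi (c *: a) p = c *: phi a p,
            forall a b p, phi (a * b) p = phi a p *m phi b p,
            forall p, phi 1 p = 1%:M &
            forall a p, phi (star a) p = (phi a p) ^t*],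
        injective phi,
        range phi = F &
        forall a, cnorm a = supnorm (phi a)].

End MatrixFunctions.

Section BoundaryData.
Variable R : realType.

Definition Ihalf : set R := `[0, 1/2].
Definition S1 : set (Cplx R) := [set z | `|z| = 1].

Definition expi (phi : R) : Cplx R := cos phi +i* sin phi.

Lemma Ihalf_0 : 0 \in Ihalf.
Proof. by apply/mem_set; rewrite /Ihalf /= in_itv /= lexx divr_ge0. Qed.

Lemma Ihalf_half : 1/2 \in Ihalf.
Proof. by apply/mem_set; rewrite /Ihalf /= in_itv /= lexx divr_ge0. Qed.

Lemma S1_1 : 1 \in S1.
Proof. by apply/mem_set; rewrite /S1 /= normr1. Qed.

Lemma S1_expi phi : expi phi \in S1.
Proof.
apply/mem_set; rewrite /S1 /expi /=.
by rewrite normc_def /= cos2Dsin2 sqrtr1.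
Qed.

Definition x_zero : Ihalf := exist _ 0 Ihalf_0.
Definition x_half : Ihalf := exist _ (1/2) Ihalf_half.
Definition z_one : S1 := exist _ 1 S1_1.
Definition z_exp (phi : R) : S1 := exist _ (expi phi) (S1_expi phi).

Definition Dom : topologicalType := (Ihalf * Ihalf * S1 * S1)%type.

Definition mx22 (a b c d : Cplx R) : 'M[Cplx R]_2 :=
  \matrix_(i, j) nth 0 (nth [::] [:: [:: a; b]; [:: c; d]] i) j.

Definition Vmx (phi : R) : 'M[Cplx R]_2 :=
  ((Num.sqrt 2)^-1%:C : Cplx R) *: mx22 (expi (phi / 2)) (- expi (phi / 2)) 1 1.

(* [A *t B] is the Kronecker product (a_ij B), of size 2 * 2. *)
Definition kron (A B : 'M[Cplx R]_2) : 'M[Cplx R]_4 := A *t B.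

Definition Smx : 'M[Cplx R]_4 :=
  kron (mx22 1 0 0 0) (mx22 1 0 0 1) + kron (mx22 0 0 0 1) (mx22 0 1 1 0).

Definition Tmx : 'M[Cplx R]_4 :=
  \matrix_(k < 2 * 2, l < 2 * 2)
    (mxtens_unindex k == ((mxtens_unindex l).2, (mxtens_unindex l).1))%:R.

Lemma Tmx_tens (x y : 'cV[Cplx R]_2) : Tmx *m (x *t y) = y *t x.
Proof.
have tE (u v : 'cV[Cplx R]_2) i j l :
    (u *t v) (mxtens_index (i, j)) l = u i 0 * v j 0.
  by rewrite mxE mxtens_indexK; congr (u _ _ * v _ _); rewrite ord1.
apply/matrixP => k l; case: (@mxtens_indexP 2 2 k) => i j.
rewrite tE mxE (bigD1 (mxtens_index (j, i))) //= big1 ?addr0.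
  by rewrite tE mxE !mxtens_indexK /= eqxx mul1r mulrC.
move=> m; case: (@mxtens_indexP 2 2 m) => i' j' /negP ne.
rewrite mxE !mxtens_indexK /=; case: eqP => [[e1 e2]|]; last by rewrite mul0r.
by case: ne; rewrite e1 e2.
Qed.

Definition Wmx (phi : R) : 'M[Cplx R]_4 :=
  kron 1%:M (Vmx phi) *m Smx *m kron 1%:M ((Vmx phi) ^t*).

Definition nu1 (phi1 phi2 : R) : 'M[Cplx R]_4 :=
  Wmx phi2 *m kron (Vmx phi1) 1%:M.

Definition nu2 (phi2 : R) : 'M[Cplx R]_4 := Tmx *m kron (Vmx phi2) 1%:M.

Definition in_M2_plus_M2 (A : 'M[Cplx R]_4) : Prop :=
  exists B1 B2 : 'M[Cplx R]_2, A = block_mx B1 0 0 B2.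

Definition boundary_algebra : set (Dom -> 'M[Cplx R]_4) :=
  [set f | [/\ continuous f,
    forall (x2 : Ihalf) (z1 z2 : S1),
      f (x_zero, x2, z1, z2) = f (x_zero, x2, z_one, z2),
    forall (x1 : Ihalf) (z1 z2 : S1),
      f (x1, x_zero, z1, z2) = f (x1, x_zero, z1, z_one),
    forall (x2 : Ihalf) (phi1 phi2 : R),
      phi1 \in `[0, 2 * pi] -> phi2 \in `[0, 2 * pi] ->
      in_M2_plus_M2 ((nu1 phi1 phi2) ^t*
        *m f (x_half, x2, z_exp phi1, z_exp phi2) *m nu1 phi1 phi2) &
    forall (x1 : Ihalf) (phi1 phi2 : R),
      phi1 \in `[0, 2 * pi] -> phi2 \in `[0, 2 * pi] ->
      in_M2_plus_M2 ((nu2 phi2) ^t*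
        *m f (x1, x_half, z_exp phi1, z_exp phi2) *m nu2 phi2)]].

End BoundaryData.

Arguments boundary_algebra R _ : clear implicits.

(* Main.v *)
(* The algebra of the theorem contains the solutions bgen1 = a(x1, z1) (x) 1 and
   bgen2 = Z (x) a(x2, z2) of the relations, where Z = diag(1, -1) and
   a(x, z) = [[0, sqrt x z], [sqrt (1 - x), 0]]; conjugated by nu1 and nu2, the conditions
   at 1/2 say that f commutes with n(z1) (x) Z and 1 (x) n(z2), n(z) = [[0, z], [1, 0]].
   We show that it is universal for them.
   Let b1, b2 be another solution.  *-polynomials are graded by the parities in b1 and
   b2.  The even ones commute and are polynomials in z_i = b_i^2, z_i^* and the
   self-adjoint d_i = b_i^* b_i - b_i b_i^*, which satisfy d_i^2 = 1 - 4 z_i z_i^*; all the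
   common values that these equations allow occur on the diagonals of the matrices at bgen1,
   bgen2, so an even polynomial has norm at most its norm at bgen1, bgen2.  By
   the C*-identity this extends to homogeneous polynomials, then to all of them up to a
   factor 4, which is removed by taking powers of x^* x.
   Instead of Gelfand theory, characters are replaced by multiplicative localizations
   x |-> lim p (x c^(2^k)) / p c^(2^k) of the norm.
   Finally *-polynomials in bgen1, bgen2 are dense: they take arbitrary admissible values
   at each point, and peak functions (1 - theta^n)^(k^n) glue the local approximations.
   So evaluation at b1, b2 extends to the whole algebra. *)

Require Import Defs.
From HB Require Import structures.
From mathcomp Require Import all_boot all_order all_algebra.
From mathcomp Require Import complex mxtens ring lra.
From mathcomp Require Import all_classical all_reals all_analysis.

Set Implicit Arguments.
Unset Strict Implicit.
Unset Printing Implicit Defensive.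

Import Order.TTheory GRing.Theory Num.Theory.
Import numFieldNormedType.Exports.

Local Open Scope classical_set_scope.
Local Open Scope ring_scope.
Local Open Scope complex_scope.
Local Open Scope sesquilinear_scope.

(** No free algebra of *-polynomials is built. A *-polynomial is represented by the relation [gpair]
    between its values at [b1], [b2] and at [bgen1], [bgen2]; that the second value determines the
    first is a consequence of the norm estimate. In the same way [even] carries an explicit
    polynomial, since two algebras are compared only through a common polynomial and its values on
    an explicit set. The factor 4 counts parity components. In the function algebra they are
    separated, without increase of norm, by conjugation with diagonal unitaries; an arbitrary target
    algebra need not contain such unitaries, hence a bound that is crude at first. Spectral theory
    is replaced by square roots of [1 - y], fixed points of a contraction. They yield positivity,
    monotonicity of seminorms and contractivity of *-homomorphisms. The half angles in V disappear
    because V Z V^* is the scalar exp(-i phi/2) times n(exp(i phi)), and a nonzero scalar does not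
    affect commutation. The first boundary condition involves Z in the second tensor factor because
    W equals 1 on one half of the space and -Z on the other. *)

Section ComplexModulus.
Context {R : realType}.
Implicit Types c d : Cplx R.

(** The norm of [Cplx R] as a numeric field is itself a complex number; this is its real version,
    the form in which scalars occur in [cnormZ]. *)
Definition cabs (c : Cplx R) : R := complex.Re `|c|.

Lemma normCE c : `|c| = (cabs c)%:C.
Proof. by rewrite /cabs normc_def. Qed.

Lemma cabs_sqrt c : cabs c = Num.sqrt (complex.Re c ^+ 2 + complex.Im c ^+ 2).
Proof. by rewrite /cabs normc_def. Qed.

Lemma cabs_ge0 c : 0 <= cabs c.
Proof. by rewrite cabs_sqrt sqrtr_ge0. Qed.

Lemma cabsM c d : cabs (c * d) = cabs c * cabs d.
Proof. by apply: (@complexI R); rewrite rmorphM /= -!normCE normrM. Qed.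

Lemma cabsD c d : cabs (c + d) <= cabs c + cabs d.
Proof. by rewrite -lecR rmorphD /= -!normCE ler_normD. Qed.

Lemma cabs_eq0 c : cabs c = 0 -> c = 0.
Proof. by move=> c0; apply/eqP; rewrite -normr_eq0 normCE c0. Qed.

Lemma cabs0 : cabs 0 = 0.
Proof. by rewrite /cabs normr0. Qed.

Lemma cabs1 : cabs 1 = 1.
Proof. by rewrite /cabs normr1. Qed.

Lemma cabsN c : cabs (- c) = cabs c.
Proof. by rewrite /cabs normrN. Qed.

Lemma cabsB c d : cabs (c - d) <= cabs c + cabs d.
Proof. by rewrite -(cabsN d) cabsD. Qed.

Lemma cabs_conj c : cabs (c^*)%R = cabs c.
Proof. by rewrite /cabs norm_conjC. Qed.

Lemma cabs_real (r : R) : cabs r%:C = `|r|.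
Proof. by rewrite cabs_sqrt /= expr0n addr0 sqrtr_sqr. Qed.

Lemma conj_realC (r : R) : ((r%:C : Cplx R)^*)%R = r%:C.
Proof. by rewrite conj_Creal // complex_real. Qed.

Lemma natC (n : nat) : real_complex R n%:R = n%:R :> Cplx R.
Proof. exact: rmorph_nat. Qed.

Lemma sqr_cabs c : (cabs c ^+ 2)%:C = (c^*)%R * c.
Proof. by rewrite mulrC -normCK normCE rmorphXn. Qed.

End ComplexModulus.

(** * Elementary facts on C*-algebras *)

Section CStarBasics.
Context {R : realType} {A : cStarAlgType R}.
Implicit Types x y a b : A.

Lemma cnorm0 : cnorm (0 : A) = 0.
Proof. by rewrite -(scale0r (0 : A)) cnormZ normr0 mul0r. Qed.

Lemma cnormN x : cnorm (- x) = cnorm x.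
Proof. by rewrite -scaleN1r cnormZ normrN normr1 mul1r. Qed.

Lemma cnorm_ge0 x : 0 <= cnorm x.
Proof. by have := cnormD x (- x); rewrite subrr cnorm0 cnormN; lra. Qed.

Lemma cnorm_subC x y : cnorm (x - y) = cnorm (y - x).
Proof. by rewrite -cnormN opprB. Qed.

Lemma cnorm_tri x y z : cnorm (x - z) <= cnorm (x - y) + cnorm (y - z).
Proof. by have := cnormD (x - y) (y - z); rewrite addrA subrK. Qed.

Lemma cnorm_gt0 x : x != 0 -> 0 < cnorm x.
Proof.
by move=> x0; rewrite lt_def cnorm_ge0 andbT; apply: contra x0 => /eqP/cnorm_eq0->.
Qed.

Lemma star0 : star (0 : A) = 0.
Proof. by rewrite -(scale0r (0 : A)) starZ rmorph0 !scale0r. Qed.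

Lemma starN x : star (- x) = - star x.
Proof. by rewrite -scaleN1r starZ rmorphN rmorph1 scaleN1r. Qed.

Lemma starB x y : star (x - y) = star x - star y.
Proof. by rewrite starD starN. Qed.

Lemma star1 : star (1 : A) = 1.
Proof. by rewrite -[LHS]mulr1 -{2}(starK 1) -starM mulr1 starK. Qed.

Lemma starX x n : star (x ^+ n) = star x ^+ n.
Proof. by elim: n => [|n IH]; rewrite ?star1// exprS exprSr starM IH. Qed.

Lemma cnorm1 : cnorm (1 : A) = 1.
Proof.
have := @cnorm_star R A 1; rewrite star1 mulr1 expr2 => h.
have /gt_eqF : 0 < cnorm (1 : A) by rewrite cnorm_gt0 ?oner_neq0.
by move=> h0; apply: (mulfI (negbT h0)); rewrite -h mulr1.
Qed.

Lemma cnorm_starE x : cnorm (star x) = cnorm x.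
Proof.
suff le y : cnorm y <= cnorm (star y).
  by apply/eqP; rewrite eq_le -{2}(starK x) !le.
have [->|y0] := eqVneq y 0; first by rewrite star0.
rewrite -(ler_pM2r (cnorm_gt0 y0)) -expr2 -cnorm_star; exact: cnormM.
Qed.

Lemma cnormX x n : cnorm (x ^+ n) <= cnorm x ^+ n.
Proof.
elim: n => [|n IH]; first by rewrite cnorm1.
by rewrite !exprS (le_trans (cnormM _ _))// ler_wpM2l ?cnorm_ge0.
Qed.

Lemma cnormZr (r : R) x : cnorm (r%:C *: x) = `|r| * cnorm x.
Proof. by rewrite cnormZ -/(cabs _) cabs_real. Qed.

Lemma starZr (r : R) x : star (r%:C *: x) = r%:C *: star x.
Proof. by rewrite starZ conj_realC. Qed.

Lemma cnorm_sqr_sa x : star x = x -> cnorm (x ^+ 2) = cnorm x ^+ 2.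
Proof. by move=> sx; rewrite -cnorm_star sx. Qed.

Lemma cnorm_pow2_sa x k : star x = x ->
  cnorm (x ^+ (2 ^ k)) = cnorm x ^+ (2 ^ k).
Proof.
move=> sx; elim: k => // k IH.
by rewrite expnSr !exprM cnorm_sqr_sa ?IH// starX sx.
Qed.

(* Arens' trick: [a + i b] is normal. *)
Lemma cnorm_sqr_le a b : star a = a -> star b = b -> a * b = b * a ->
  cnorm a ^+ 2 <= cnorm (a ^+ 2 + b ^+ 2).
Proof.
move=> sa sb ab; pose y := a + ('i)%R *: b.
have sy : star y = a - ('i)%R *: b by rewrite starD starZ conjCi sa sb scaleNr.
have -> : a ^+ 2 + b ^+ 2 = star y * y.
  have ii : ('i * 'i)%R = -1 :> Cplx R by rewrite -expr2 sqrCi.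
  rewrite sy mulrDr !mulrBl -!scalerAl -!scalerAr ab scalerA ii scaleN1r opprK.
  by rewrite addrA subrK -!expr2.
rewrite cnorm_star ler_sqr ?nnegrE ?cnorm_ge0//.
(* [a] is the real part of [y], and [star y] has the same norm as [y]. *)
have : cnorm (a *+ 2) <= cnorm y *+ 2.
  rewrite mulr2n; have -> : a + a = y + star y.
    by rewrite sy /y addrACA subrr addr0.
  by rewrite (le_trans (cnormD _ _))// cnorm_starE mulr2n.
rewrite -scaler_nat cnormZ.
have -> : complex.Re `|2%:R : Cplx R| = 2%:R.
  by rewrite normr_nat -(rmorph_nat (@real_complex R)) /=.
by rewrite mulr_natl lerMn2r.
Qed.

(** The norm is a plain field with no topology attached, so convergence takes the form of the
    conclusion of [cnorm_complete]. *)
Definition tends (u : nat -> A) (l : A) :=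
  forall e : R, 0 < e -> exists N, forall n, (N <= n)%N -> cnorm (u n - l) < e.

Lemma tends_unique u l l' : tends u l -> tends u l' -> l = l'.
Proof.
move=> ul ul'; apply/eqP; rewrite -subr_eq0; apply/eqP/cnorm_eq0/eqP.
rewrite eq_le cnorm_ge0 andbT; apply/ler_addgt0Pr => e e0.
have e2 : 0 < e / 2 by rewrite divr_gt0.
have [N hN] := ul _ e2; have [N' hN'] := ul' _ e2.
have := cnorm_tri l (u (maxn N N')) l'.
have := hN _ (leq_maxl N N'); have := hN' _ (leq_maxr N N').
rewrite (cnorm_subC l (u _)); lra.
Qed.

Lemma tends_cst l : tends (fun=> l) l.
Proof. by move=> e e0; exists 0%N => n _; rewrite subrr cnorm0. Qed.

Lemma tendsS u l : tends u l -> tends (fun n => u n.+1) l.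
Proof.
by move=> ul e /ul[N hN]; exists N => n Nn; apply: hN; rewrite (leq_trans Nn).
Qed.

Lemma tendsD u v l l' : tends u l -> tends v l' ->
  tends (fun n => u n + v n) (l + l').
Proof.
move=> ul vl e e0; have e2 : 0 < e / 2 by rewrite divr_gt0.
have [N hN] := ul _ e2; have [N' hN'] := vl _ e2.
exists (maxn N N') => n; rewrite geq_max => /andP[/hN h1 /hN' h2].
rewrite opprD addrACA (le_lt_trans (cnormD _ _))//; lra.
Qed.

Lemma tends_le u l (v : nat -> A) l' (C : R) : 0 < C ->
  (forall n, cnorm (v n - l') <= C * cnorm (u n - l)) ->
  tends u l -> tends v l'.
Proof.
move=> C0 h ul e e0; have [N hN] := ul _ (divr_gt0 e0 C0).
exists N => n /hN; rewrite ltr_pdivlMr// mulrC; exact: le_lt_trans.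
Qed.

Lemma tends_star u l : tends u l -> tends (fun n => star (u n)) (star l).
Proof.
by apply: (@tends_le _ _ _ _ 1) => // n; rewrite -starB cnorm_starE mul1r.
Qed.

Lemma tendsMl w u l : tends u l -> tends (fun n => w * u n) (w * l).
Proof.
apply: (@tends_le _ _ _ _ (cnorm w + 1)) => [|n].
  by rewrite ltr_wpDl// cnorm_ge0.
by rewrite -mulrBr (le_trans (cnormM _ _))// ler_wpM2r ?cnorm_ge0 ?lerDl.
Qed.

Lemma tendsMr w u l : tends u l -> tends (fun n => u n * w) (l * w).
Proof.
apply: (@tends_le _ _ _ _ (cnorm w + 1)) => [|n].
  by rewrite ltr_wpDl// cnorm_ge0.
by rewrite -mulrBl (le_trans (cnormM _ _))// mulrC ler_wpM2r ?cnorm_ge0 ?lerDl.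
Qed.

Lemma tendsZ c u l : tends u l -> tends (fun n => c *: u n) (c *: l).
Proof.
move=> /(tendsMl (c *: 1)); rewrite -scalerAl mul1r => h.
by move=> e /h[N hN]; exists N => n /hN; rewrite -scalerAl mul1r.
Qed.

Lemma tends_bounded u l : tends u l -> exists N, forall n, (N <= n)%N ->
  cnorm (u n) <= cnorm l + 1.
Proof.
move=> /(_ 1 ltr01)[N hN]; exists N => n /hN h.
by have := cnormD (u n - l) l; rewrite subrK; lra.
Qed.

Lemma tendsM u v l l' : tends u l -> tends v l' ->
  tends (fun n => u n * v n) (l * l').
Proof.
move=> ul vl e e0; have [N0 hN0] := tends_bounded ul.
have C0 : 0 < cnorm l + 1 by rewrite ltr_wpDl// cnorm_ge0.
have [N hN] := vl _ (divr_gt0 e0 (mulr_gt0 (@ltr0n R 2) C0)).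
have [N' hN'] := tendsMr l' ul (divr_gt0 e0 (@ltr0n R 2)).
exists (maxn N0 (maxn N N')) => n.
rewrite !geq_max => /and3P[/hN0 h0 /hN h1 /hN' h2].
have -> : u n * v n - l * l' = u n * (v n - l') + (u n * l' - l * l').
  by rewrite mulrBr addrA subrK.
rewrite (le_lt_trans (cnormD _ _))// [e](splitr e) ltr_leD ?(ltW h2)//.
apply: (le_lt_trans (cnormM _ _)).
apply: (le_lt_trans (ler_wpM2r (cnorm_ge0 _) h0)).
by move: h1; rewrite ltr_pdivlMr ?mulr_gt0// => h1; nra.
Qed.

Lemma geometric_small (t C e : R) : 0 <= t < 1 -> 0 < e ->
  exists N, forall n, (N <= n)%N -> C * t ^+ n < e.
Proof.
move=> /andP[t0 t1] e0.
have h : (fun n => C * t ^+ n) @ \oo --> 0.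
  rewrite -(mulr0 C); apply: cvgM; first exact: cvg_cst.
  by apply: cvg_expr; rewrite ger0_norm.
move/cvgrPdist_lt: h => /(_ _ e0)[N _ hN]; exists N => n Nn.
have := hN n Nn; rewrite /= sub0r normrN; exact/le_lt_trans/ler_norm.
Qed.

Lemma geometric_tends (u : nat -> A) (t C : R) : 0 <= t < 1 ->
  (forall n, cnorm (u n.+1 - u n) <= C * t ^+ n) -> exists l, tends u l.
Proof.
move=> t01 h; have /andP[t0 t1] := t01.
(* The partial geometric sum is kept in closed form, so that after the triangle inequality the
   induction step is an identity. *)
have step n k : cnorm (u (n + k)%N - u n) <= C / (1 - t) * t ^+ n * (1 - t ^+ k).
  elim: k => [|k IH]; first by rewrite addn0 subrr cnorm0 expr0 subrr mulr0.
  rewrite addnS; apply: (le_trans (cnorm_tri _ (u (n + k)%N) _)).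
  apply: (le_trans (lerD (h _) IH)); rewrite le_eqVlt; apply/orP; left.
  by apply/eqP; rewrite exprD exprS; field; lra.
have C0 : 0 <= C by have := h 0%N; rewrite expr0 mulr1; apply/le_trans/cnorm_ge0.
apply: cnorm_complete => e e0.
have [N hN] := @geometric_small t (C / (1 - t)) (e / 2) t01 (divr_gt0 e0 (@ltr0n R 2)).
have bd n : (N <= n)%N -> cnorm (u n - u N) < e / 2.
  move=> Nn; rewrite -(subnKC Nn); apply: (le_lt_trans (step _ _)).
  apply: le_lt_trans (hN N (leqnn _)); rewrite ler_piMr//.
    by rewrite mulr_ge0 ?divr_ge0 ?exprn_ge0// subr_ge0 ltW.
  by rewrite gerBl exprn_ge0.
exists N => m n /bd h1 /bd h2; have := cnorm_tri (u m) (u N) (u n).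
by rewrite (cnorm_subC (u N)); lra.
Qed.

(* [1 - v] is the fixed point of the contraction [x |-> (y + x ^+ 2) / 2]. *)
Lemma sqrt_one_sub y : star y = y -> cnorm y < 1 -> exists v,
  [/\ star v = v, v ^+ 2 = 1 - y & forall w, w * y = y * w -> w * v = v * w].
Proof.
move=> sy y1; set t := cnorm y in y1 *; have t0 : 0 <= t := cnorm_ge0 y.
have hC : 2^-1 >= 0 :> R by rewrite invr_ge0.
pose phi x : A := (2^-1 : R)%:C *: (y + x ^+ 2).
pose u n := iter n phi 0.
(* The ball of radius [t] is invariant since [(t + t^2)/2 <= t] for [t < 1], and on it [phi]
   contracts by the factor [t]. *)
have bu n : cnorm (u n) <= t.
  elim: n => [|n IH]; first by rewrite cnorm0.
  rewrite (_ : u n.+1 = phi (u n))// cnormZr ger0_norm// mulrC ler_pdivrMr//.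
  have := cnormD y (u n ^+ 2); have := cnormX (u n) 2; have := cnorm_ge0 (u n).
  by rewrite -/t; nra.
have su n : star (u n) = u n.
  by elim: n => [|n IH] /=; rewrite ?star0// starZr starD starX sy IH.
have cu w n : w * y = y * w -> w * u n = u n * w.
  move=> wy; elim: n => [|n IH] /=; first by rewrite mulr0 mul0r.
  rewrite -scalerAr -scalerAl mulrDl mulrDr wy; congr (_ *: (_ + _)).
  by rewrite expr2 mulrA IH -mulrA IH mulrA.
have dphi x x' : cnorm x <= t -> cnorm x' <= t ->
    cnorm (phi x - phi x') <= t * cnorm (x - x').
  move=> hx hx'; rewrite -scalerBr cnormZr ger0_norm//.
  have -> : y + x ^+ 2 - (y + x' ^+ 2) = x * (x - x') + (x - x') * x'.
    by rewrite opprD addrACA subrr add0r mulrBr mulrBl addrA subrK.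
  have := cnormD (x * (x - x')) ((x - x') * x').
  have := cnormM x (x - x'); have := cnormM (x - x') x'.
  have := ler_wpM2r (cnorm_ge0 (x - x')) hx.
  have := ler_wpM2l (cnorm_ge0 (x - x')) hx'.
  by rewrite ler_pdivrMl//; lra.
have [l ul] : exists l, tends u l.
  apply: (@geometric_tends _ t t); first by rewrite t0.
  elim=> [|n IH]; first by rewrite expr0 mulr1 subr0; apply: bu.
  rewrite (_ : u n.+2 - _ = phi (u n.+1) - phi (u n))//.
  apply: (le_trans (dphi _ _ (bu _) (bu _))).
  by rewrite exprS mulrA [_ * t]mulrC -mulrA ler_wpM2l.
have sl : star l = l.
  apply: (tends_unique (tends_star ul)).
  by move=> e /ul[N hN]; exists N => n; rewrite su; apply: hN.
have fixl : l = (2^-1 : R)%:C *: (y + l ^+ 2).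
  apply: (tends_unique (tendsS ul)); apply: tendsZ.
  exact/(tendsD (tends_cst _))/(tendsM ul ul).
exists (1 - l); split => [||w wy]; first by rewrite starB star1 sl.
- have : l *+ 2 = y + l ^+ 2.
    rewrite {1}fixl -scaler_nat scalerA -[2%:R](rmorph_nat (@real_complex R)).
    by rewrite -rmorphM /= divff ?scale1r ?pnatr_eq0.
  move=> h; rewrite expr2 mulrBr mulr1 mulrBl mul1r -expr2 opprB.
  have -> : l ^+ 2 = l *+ 2 - y by rewrite h addrAC subrr add0r.
  by rewrite mulr2n (addrAC (l + l)) addrK addrA subrK.
- rewrite mulrBr mulrBl mulr1 mul1r; congr (_ - _).
  apply: (tends_unique (tendsMl w ul)) => e e0.
  have [N hN] := tendsMr w ul e0.
  by exists N => n /hN; rewrite cu.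
Qed.

End CStarBasics.

(** * Contractivity of *-homomorphisms *)

Section StarHom.
Context {R : realType} {A B : cStarAlgType R} (h : A -> B).
Hypothesis hh : star_hom h.

Lemma star_hom0 : h 0 = 0.
Proof. by case: hh => _ hZ _ _ _; rewrite -(scale0r (0 : A)) hZ !scale0r. Qed.

Lemma star_homN x : h (- x) = - h x.
Proof. by case: hh => _ hZ _ _ _; rewrite -scaleN1r hZ scaleN1r. Qed.

Lemma star_homB x y : h (x - y) = h x - h y.
Proof. by case: hh => hD _ _ _ _; rewrite hD star_homN. Qed.

(* If [1 - f ^+ 2 = v ^+ 2] then [h f ^+ 2 + h v ^+ 2 = 1]. *)
Lemma star_hom_le x : cnorm (h x) <= cnorm x.
Proof.
have [hD hZ hM h1 hS] := hh.
have sa f : star f = f -> cnorm f < 1 -> cnorm (h f) <= 1.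
  move=> sf f1.
  have [||v [sv v2 cv]] := @sqrt_one_sub R A (f ^+ 2); first by rewrite starX sf.
    by rewrite (le_lt_trans (cnormX _ _))// expr_lt1// cnorm_ge0.
  have fv : f * v = v * f by apply: cv; rewrite -exprS -exprSr.
  rewrite -(@ler_pXn2r _ 2) ?nnegrE ?cnorm_ge0// expr1n.
  rewrite -(@cnorm1 _ B) -h1; have -> : 1 = f ^+ 2 + v ^+ 2 by rewrite v2 addrC subrK.
  rewrite hD !expr2 !hM -!expr2; apply: cnorm_sqr_le.
  - by rewrite -hS sf.
  - by rewrite -hS sv.
  - by rewrite -!hM fv.
(* Dividing by [cnorm f + e] makes the norm strictly less than 1, as the square root requires; the
   slack [e] also covers [f = 0]. *)
have sa' f : star f = f -> cnorm (h f) <= cnorm f.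
  move=> sf; apply/ler_addgt0Pr => e e0; have f0 := cnorm_ge0 f.
  set r := cnorm f + e; have r0 : 0 < r by rewrite ltr_wpDl.
  have ri : `|r^-1| = r^-1 by rewrite ger0_norm// invr_ge0 ltW.
  have := sa (r^-1%:C *: f); rewrite starZr sf hZ !cnormZr ri.
  by rewrite ltr_pdivrMl// ler_pdivrMl// mulr1 ltrDl; apply.
rewrite -(@ler_pXn2r _ 2) ?nnegrE ?cnorm_ge0// -!cnorm_star -hS -hM.
by apply: sa'; rewrite starM starK.
Qed.

End StarHom.

(** * C*-seminorms on commutative subalgebras *)

Section Localization.
Context {R : realType} {A : cStarAlgType R}.

(** [cs_sqrt] stands in for norm closure: it is the consequence of completeness that the arguments
    inside [S] rely on. *)
Record comm_subalg (S : A -> Prop) : Prop := CommSubalg {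
  cs1 : S 1;
  csD : forall x y, S x -> S y -> S (x + y);
  csM : forall x y, S x -> S y -> S (x * y);
  csZ : forall (c : Cplx R) x, S x -> S (c *: x);
  csS : forall x, S x -> S (star x);
  csC : forall x y, S x -> S y -> x * y = y * x;
  cs_sqrt : forall y, S y -> star y = y -> cnorm y < 1 -> exists v,
    [/\ S v, star v = v & v ^+ 2 = 1 - y] }.

Definition bicommutant (H : set A) (x : A) : Prop :=
  forall w, (forall h, H h -> w * h = h * w) -> w * x = x * w.

Lemma bicommutant_sub (H : set A) h : H h -> bicommutant H h.
Proof. by move=> Hh w; apply. Qed.

(** Elements of [H] lie in the commutant of [H], so elements of the bicommutant commute with [H],
    thus belong to the commutant themselves, and so commute with each other. Square roots stay
    inside because [sqrt_one_sub] gives a [v] that commutes with whatever commutes with [y]. *)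
Lemma bicommutant_subalg (H : set A) :
  (forall h h', H h -> H h' -> h * h' = h' * h) ->
  (forall h, H h -> H (star h)) -> comm_subalg (bicommutant H).
Proof.
move=> HC HS; have com x w : bicommutant H x ->
    (forall h, H h -> w * h = h * w) -> w * x = x * w by move=> + /[dup] + _; apply.
split.
- by move=> w _; rewrite mulr1 mul1r.
- by move=> x y Sx Sy w wH; rewrite mulrDr mulrDl (Sx w wH) (Sy w wH).
- by move=> x y Sx Sy w wH; rewrite mulrA (Sx w wH) -mulrA (Sy w wH) mulrA.
- by move=> c x Sx w wH; rewrite -scalerAr -scalerAl (Sx w wH).
- move=> x Sx w wH; apply: (can_inj starK); rewrite !starM starK; symmetry.
  apply: Sx => h /HS/wH/(congr1 star); rewrite !starM starK => ->.
  by [].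
- move=> x y Sx Sy; apply: Sy => h Hh; symmetry; apply: Sx => h' Hh'.
  exact: HC.
- move=> y Sy sy y1; have [v [sv v2 cv]] := sqrt_one_sub sy y1.
  by exists v; split=> // w /Sy/cv.
Qed.

Section Seminorms.
Variable S : A -> Prop.
Hypothesis CS : comm_subalg S.

Lemma csN x : S x -> S (- x).
Proof. by move=> Sx; rewrite -scaleN1r; exact: (csZ CS). Qed.

Lemma csB x y : S x -> S y -> S (x - y).
Proof. by move=> Sx Sy; apply: (csD CS) => //; exact: csN. Qed.

Lemma csX x n : S x -> S (x ^+ n).
Proof. by move=> Sx; elim: n => [|n IH]; [exact: (cs1 CS)|rewrite exprS; exact: (csM CS)]. Qed.

Lemma cs0 : S 0.
Proof. by rewrite -(subrr 1); apply: csB; exact: (cs1 CS). Qed.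

Lemma cs_mul_sa x y : S x -> S y -> star x = x -> star y = y ->
  star (x * y) = x * y.
Proof. by move=> Sx Sy sx sy; rewrite starM sx sy; exact: (csC CS). Qed.

(** Positivity expressed by the norm instead of the spectrum: the spectrum lies in the disc of
    radius [r] around [r]. In this form the triangle inequality gives sums. *)
Definition positive x :=
  [/\ S x, star x = x & exists2 r : R, 0 < r & cnorm (r%:C *: 1 - x) <= r].

Lemma positive0 : positive 0.
Proof.
split; [exact: cs0|exact: star0|exists 1 => //].
by rewrite subr0 scale1r cnorm1.
Qed.

Lemma positiveD x y : positive x -> positive y -> positive (x + y).
Proof.
move=> [Sx sx [r r0 hr]] [Sy sy [s s0 hs]].
split; [exact: (csD CS)|by rewrite starD sx sy|exists (r + s); first exact: addr_gt0].
rewrite rmorphD /= scalerDl opprD addrACA (le_trans (cnormD _ _))//.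
exact: lerD.
Qed.

(** For [b = a / r] of norm less than 1, write [1 - b ^+ 2 = v ^+ 2]. Then [r ^+ 2 - a ^+ 2] is
    [r ^+ 2] times [v ^+ 2], and Arens' trick bounds [v ^+ 2] by the norm of
    [v ^+ 2 + b ^+ 2 = 1]. *)
Lemma positive_sqr a : S a -> star a = a -> positive (a ^+ 2).
Proof.
move=> Sa sa; split; [exact: csX|by rewrite starX sa|].
set r := cnorm a + 1; have r0 : 0 < r by rewrite ltr_wpDl// cnorm_ge0.
exists (r ^+ 2); first exact: exprn_gt0.
pose b := r^-1%:C *: a.
have Sb : S b by exact: (csZ CS).
have sb : star b = b by rewrite starZr sa.
have b1 : cnorm b < 1.
  rewrite cnormZr ger0_norm ?invr_ge0 ?(ltW r0)// ltr_pdivrMl// mulr1.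
  by rewrite /r ltrDl.
have [||v [Sv sv v2]] := @cs_sqrt _ CS (b ^+ 2) (csX 2 Sb); first by rewrite starX sb.
  by rewrite (le_lt_trans (cnormX _ _))// expr_lt1// cnorm_ge0.
have -> : (r ^+ 2)%:C *: 1 - a ^+ 2 = (r ^+ 2)%:C *: v ^+ 2.
  rewrite v2 scalerBr exprZn scalerA -rmorphXn /= -rmorphM /= -exprMn divff ?gt_eqF//.
  by rewrite expr1n scale1r.
rewrite cnormZr ger0_norm ?sqr_ge0// ler_piMr ?sqr_ge0//.
rewrite (le_trans (cnormX _ _))// (le_trans (cnorm_sqr_le sv sb _)) ?v2 ?subrK ?cnorm1//.
exact: (csC CS).
Qed.

(** With [y = (r - x) / (r + e)] one has [x + e = (r + e) (1 - y)] and [cnorm y <= r / (r + e)]; the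
    shift by [e] supplies the strict inequality [cnorm y < 1]. *)
Lemma positive_sqrt x (e : R) : 0 < e -> positive x ->
  exists v, [/\ S v, star v = v & v ^+ 2 = x + e%:C *: 1].
Proof.
move=> e0 [Sx sx [r r0 hr]]; have re : 0 < r + e by exact: addr_gt0.
pose y := (r + e)^-1%:C *: (r%:C *: 1 - x).
have [|||v [Sv sv v2]] := @cs_sqrt _ CS y.
- by apply: (csZ CS); apply: csB => //; apply: (csZ CS); exact: (cs1 CS).
- by rewrite starZr starB starZr star1 sx.
- rewrite cnormZr ger0_norm ?invr_ge0 ?(ltW re)// ltr_pdivrMl// mulr1.
  by rewrite (le_lt_trans hr)// ltrDl.
exists ((Num.sqrt (r + e))%:C *: v); split; first exact: (csZ CS).
  by rewrite starZr sv.
rewrite exprZn -rmorphXn /= sqr_sqrtr ?ltW// v2 scalerBr scalerA -rmorphM /=.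
rewrite divff ?gt_eqF// scale1r opprB rmorphD /= scalerDl.
by rewrite addrC addrA subrK.
Qed.

(** Such a [p] should be thought of as the supremum of [|chi x|] over a nonempty closed set of
    characters [chi] of [S]; localization shrinks this set. *)
Record cstar_seminorm (p : A -> R) : Prop := CStarSeminorm {
  pD : forall x y, S x -> S y -> p (x + y) <= p x + p y;
  pZ : forall (c : Cplx R) x, S x -> p (c *: x) = cabs c * p x;
  pM : forall x y, S x -> S y -> p (x * y) <= p x * p y;
  pS : forall x, S x -> p (star x * x) = p x ^+ 2;
  p1 : p 1 = 1;
  p_le : forall x, S x -> p x <= cnorm x;
  p_ge0 : forall x, S x -> 0 <= p x }.

Lemma cnorm_cstar_seminorm : cstar_seminorm (@cnorm R A).
Proof.
split=> //; [by move=> *; exact: cnormD|by move=> *; exact: cnormZ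
  |by move=> *; exact: cnormM|by move=> *; exact: cnorm_star|exact: cnorm1
  |by move=> *; exact: cnorm_ge0].
Qed.

Section Step.
Variables (p : A -> R) (c : A).
Hypotheses (hp : cstar_seminorm p) (Sc : S c) (sc : star c = c) (pc : 0 < p c).

Let u x k := p (x * c ^+ (2 ^ k)) / p c ^+ (2 ^ k).

(** In terms of characters, this keeps those at which [|c|] attains its maximum [p c]. The sequence
    decreases by submultiplicativity, and with exponents [2 ^ k] the passage from [k] to [k.+1]
    squares the weight. *)
Definition localized x : R := lim (u x @ \oo).

Lemma seminormX n : p (c ^+ n) <= p c ^+ n.
Proof.
elim: n => [|n IH]; first by rewrite (p1 hp).
rewrite !exprS (le_trans (pM hp _ _)) ?ler_wpM2l ?(p_ge0 hp Sc)//; exact: csX.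
Qed.

Let u_ge0 x k : S x -> 0 <= u x k.
Proof.
by move=> Sx; rewrite divr_ge0 ?exprn_ge0 ?(ltW pc)// (p_ge0 hp)//;
  apply: (csM CS) => //; exact: csX.
Qed.

Let u_cvg x : S x -> u x @ \oo --> localized x.
Proof.
move=> Sx; apply: nonincreasing_is_cvgn.
  apply/nonincreasing_seqP => k; rewrite /u ler_pdivrMr ?exprn_gt0//.
  rewrite expnS mul2n -addnn !exprD mulrA.
  have [] : S (c ^+ (2 ^ k)) /\ S (x * c ^+ (2 ^ k)).
    by split; [|apply: (csM CS) => //]; exact: csX.
  move=> S1 S2; rewrite (le_trans (pM hp S2 S1))// mulrA divfK ?gt_eqF ?exprn_gt0//.
  by rewrite ler_wpM2l ?seminormX// (p_ge0 hp).
by exists 0 => _ [k _ <-]; exact: u_ge0.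
Qed.

Lemma localized_le x : S x -> localized x <= p x.
Proof.
move=> Sx; apply: (ler_cvg_to (u_cvg Sx) (cvg_cst (p x))).
apply: nearW => k; rewrite ler_pdivrMr ?exprn_gt0//.
have Sk : S (c ^+ (2 ^ k)) by exact: csX.
by rewrite (le_trans (pM hp Sx Sk))// ler_wpM2l ?seminormX// (p_ge0 hp).
Qed.

(** Eigenvalue relations gained in one localization survive the next ones; this is what makes
    repeated localization useful. *)
Lemma localized_eigen y (k : R) : S y -> (forall x, S x -> p (x * y) = k * p x) ->
  forall x, S x -> localized (x * y) = k * localized x.
Proof.
move=> Sy h x Sx; have Sxy : S (x * y) by exact: (csM CS).
apply: (cvg_unique _ (u_cvg Sxy)) => //.
rewrite (_ : u (x * y) = fun n => k * u x n); last first.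
  apply/funext => n; rewrite /u -mulrA (csC CS Sy (csX _ Sc)) mulrA h ?mulrA//.
  by apply: (csM CS) => //; exact: csX.
by apply: cvgM; [exact: cvg_cst|exact: u_cvg].
Qed.

(** One inequality is submultiplicativity. For the other, [x * c ^+ (2 ^ k.+1)] is split into
    [x * c * c ^+ (2 ^ k)] and [c ^+ (2 ^ k).-1], which bounds [u x k.+1] by [u (x * c) k / p c]. *)
Lemma localized_mul x : S x -> localized (x * c) = p c * localized x.
Proof.
move=> Sx; have Sxc : S (x * c) by exact: (csM CS).
have Sk k : S (x * c ^+ k) by apply: (csM CS) => //; exact: csX.
apply/eqP; rewrite eq_le; apply/andP; split.
  apply: (ler_cvg_to (u_cvg Sxc)).
    by apply: cvgM; [exact: cvg_cst|exact: u_cvg].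
  apply: nearW => k; rewrite /u /= /= mulrA ler_wpM2r ?invr_ge0 ?exprn_ge0 ?(ltW pc)//.
  have -> : x * c * c ^+ (2 ^ k) = x * c ^+ (2 ^ k) * c.
    by rewrite -!mulrA -exprS -exprSr.
  by rewrite mulrC (pM hp).
rewrite -ler_pdivlMl//.
have h : (fun k => u x k.+1) @ \oo --> localized x.
  by have := u_cvg Sx; rewrite -(cvg_shiftS (u x)).
apply: (ler_cvg_to h).
  by apply: cvgM; [exact: cvg_cst|exact: u_cvg].
apply: nearW => k; rewrite /u /=.
have n0 : (0 < 2 ^ k)%N by rewrite expn_gt0.
have e : (2 ^ k.+1 = 2 ^ k + (1 + (2 ^ k).-1))%N.
  by rewrite add1n prednK// addnn -mul2n expnS.
rewrite e !exprD expr1 mulrA ler_pdivrMr ?mulr_gt0 ?exprn_gt0// mulrA.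
have S1 : S (c ^+ (2 ^ k).-1) by exact: csX.
rewrite -[x * _ * c]mulrA -exprSr exprS mulrA.
have S2 : S (x * c * c ^+ (2 ^ k)) by rewrite -mulrA -exprS.
rewrite (le_trans (pM hp S2 S1))// (le_trans (ler_wpM2l (p_ge0 hp S2) (seminormX _)))//.
rewrite le_eqVlt; apply/orP; left; apply/eqP; field.
by rewrite expf_neq0 gt_eqF.
Qed.

(** For products, the term of index [k.+1] of the product is compared with the product of the terms
    of index [k]. The C*-identity is exact at this level: as [c] is self-adjoint and [S]
    commutative, [star x * x * c ^+ (2 ^ k.+1)] is [star z * z] for [z = x * c ^+ (2 ^ k)]. *)
Lemma localized_seminorm : cstar_seminorm localized.
Proof.
have Sk k x : S x -> S (x * c ^+ k) by move=> Sx; apply: (csM CS) => //; exact: csX.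
have k0 k : 0 <= (p c ^+ k)^-1 by rewrite invr_ge0 exprn_ge0 ?(ltW pc).
have shift x : S x -> (fun k => u x k.+1) @ \oo --> localized x.
  by move=> Sx; have := u_cvg Sx; rewrite -(cvg_shiftS (u x)).
split.
- move=> x y Sx Sy; apply: (ler_cvg_to (u_cvg (csD CS Sx Sy))).
    by apply: cvgD; exact: u_cvg.
  apply: nearW => k; rewrite /u /= -[leRHS]mulrDl ler_wpM2r// mulrDl.
  by rewrite (pD hp)//; exact: Sk.
- move=> d x Sx; apply: (cvg_unique _ (u_cvg (csZ CS d Sx))) => //.
  rewrite (_ : u (d *: x) = fun n => cabs d * u x n); last first.
    by apply/funext => n; rewrite /u -scalerAl (pZ hp) ?mulrA//; exact: Sk.
  by apply: cvgM; [exact: cvg_cst|exact: u_cvg].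
- move=> x y Sx Sy; apply: (ler_cvg_to (shift _ (csM CS Sx Sy))).
    by apply: cvgM; exact: u_cvg.
  apply: nearW => k; rewrite /u /= expnS mul2n -addnn !exprD invfM [leRHS]mulrACA.
  have -> : x * y * (c ^+ (2 ^ k) * c ^+ (2 ^ k)) =
      x * c ^+ (2 ^ k) * (y * c ^+ (2 ^ k)).
    rewrite -!mulrA; congr (x * _).
    by rewrite [RHS](csC CS (csX _ Sc) (Sk _ _ Sy)) -mulrA.
  by rewrite ler_wpM2r ?mulr_ge0// (pM hp)//; exact: Sk.
- move=> x Sx; have Sxx : S (star x * x) by apply: (csM CS) => //; exact: (csS CS).
  apply: (cvg_unique _ (shift _ Sxx)) => //.
  rewrite (_ : (fun k => u (star x * x) k.+1) = fun n => u x n * u x n); last first.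
    apply/funext => k; rewrite /u mulrACA -invfM -!expr2 -(pS hp); last exact: Sk.
    rewrite starM starX sc -exprM mulnC -expnS; congr (p _ / _).
    rewrite (csC CS (csX _ Sc) (csS CS Sx)) -!mulrA; congr (_ * _).
    rewrite (mulrA _ x) (csC CS (csX _ Sc) Sx) -mulrA -exprD addnn -mul2n -expnS.
    by [].
  by rewrite expr2; apply: cvgM; exact: u_cvg.
- apply: (cvg_unique _ (u_cvg (cs1 CS))) => //.
  rewrite (_ : u 1 = fun=> 1); first exact: cvg_cst.
  apply/funext => k; rewrite /u mul1r.
  have -> : p (c ^+ (2 ^ k)) = p c ^+ (2 ^ k).
    elim: k => // k IH; rewrite expnSr !exprM -IH -(pS hp); last exact: csX.
    by rewrite starX sc -expr2.
  by rewrite divff// gt_eqF// exprn_gt0.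
- by move=> x Sx; rewrite (le_trans (localized_le Sx))// (p_le hp).
- move=> x Sx; apply: (ler_cvg_to (cvg_cst 0) (u_cvg Sx)).
  by apply: nearW => k; exact: u_ge0.
Qed.

End Step.
End Seminorms.
End Localization.

(** * Seminorms under which self-adjoint elements become scalars *)

Section Characters.
Context {R : realType} {A : cStarAlgType R}.
Variable S : A -> Prop.
Hypothesis CS : comm_subalg S.

Lemma seminormN p x : cstar_seminorm S p -> S x -> p (- x) = p x.
Proof. by move=> hp Sx; rewrite -scaleN1r (pZ hp)// cabsN cabs1 mul1r. Qed.

(** Arens' trick with square roots [v], [w] of [x] and [y], each shifted by [e / 3]. The shift is
    paid once in passing from [x] to [v ^+ 2] and twice in passing to [x + y]. *)
Lemma seminorm_positive_le p x y : cstar_seminorm S p ->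
  positive S x -> positive S y -> p x <= p (x + y).
Proof.
move=> hp px py; have S1 := cs1 CS; have [Sx _ _] := px; have [Sy _ _] := py.
apply/ler_addgt0Pr => e e0; have e2 : 0 < e / 3 by rewrite divr_gt0.
have [v [Sv sv v2]] := positive_sqrt CS e2 px.
have [w [Sw sw w2]] := positive_sqrt CS e2 py.
have arens : p v ^+ 2 <= p (v ^+ 2 + w ^+ 2).
  pose z := v + ('i)%R *: w.
  have Sz : S z by apply: (csD CS) => //; exact: (csZ CS).
  have sz : star z = v - ('i)%R *: w by rewrite starD starZ conjCi sv sw scaleNr.
  have Ssz : S (star z) by exact: (csS CS).
  have pz : p (star z) = p z.
    apply: (@pexpIrn _ 2) => //; rewrite ?nnegrE ?(p_ge0 hp)//.
    by rewrite -!(pS hp)// starK (csC CS).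
  have -> : v ^+ 2 + w ^+ 2 = star z * z.
    have ii : ('i * 'i)%R = -1 :> Cplx R by rewrite -expr2 sqrCi.
    rewrite sz mulrDr !mulrBl -!scalerAl -!scalerAr (csC CS Sv Sw) scalerA ii.
    by rewrite scaleN1r opprK addrA subrK -!expr2.
  rewrite (pS hp)// ler_sqr ?nnegrE ?(p_ge0 hp)//.
  have : p (2%:C *: v) <= p z *+ 2.
    have -> : (2 : R)%:C *: v = z + star z.
      rewrite sz /z addrACA subrr addr0 -mulr2n -(scaler_nat 2 v).
      by rewrite (@natC R 2).
    by rewrite (le_trans (pD hp _ _))// pz mulr2n.
  by rewrite (pZ hp)// cabs_real ger0_norm// mulr_natl lerMn2r.
have Se c : S (c *: 1) by apply: (csZ CS); exact: (cs1 CS).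
have pe : p ((e / 3)%:C *: 1) = e / 3.
  by rewrite (pZ hp)// (p1 hp) mulr1 cabs_real gtr0_norm.
have pv : p v ^+ 2 = p (x + (e / 3)%:C *: 1) by rewrite -v2 -(pS hp)// sv expr2.
have h1 : p x <= p v ^+ 2 + e / 3.
  have := pD hp (csD CS Sx (Se (e / 3)%:C)) (csN CS (Se (e / 3)%:C)).
  rewrite addrK -pv -scaleNr (pZ hp)// (p1 hp) mulr1 cabsN cabs_real.
  by rewrite gtr0_norm.
have h2 : p (v ^+ 2 + w ^+ 2) <= p (x + y) + (e / 3 + e / 3).
  rewrite v2 w2 addrACA; have Sxy : S (x + y) by exact: (csD CS).
  apply: (le_trans (pD hp Sxy (csD CS (Se _) (Se _)))); rewrite lerD2l.
  by apply: (le_trans (pD hp (Se _) (Se _))); rewrite pe.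
lra.
Qed.

(* With [g = 1 - w ^+ 2] one has [(1 + w ^+ 2) ^+ 2 = g ^+ 2 + (w *+ 2) ^+ 2];
   in the binomial expansion of its [n]-th power all terms are squares, and the
   one that is linear in [g ^+ 2] has seminorm [n * 4 ^ n.-1 * q (g ^+ 2)], while
   the sum has seminorm at most [4 ^ n]. *)
Lemma localized_sqr_eq1 q w : cstar_seminorm S q -> S w -> star w = w ->
  (forall x, S x -> q (x * w ^+ 2) = q x) -> q (1 - w ^+ 2) = 0.
Proof.
move=> hq Sw sw qw; set g := 1 - w ^+ 2.
have S1 := cs1 CS; have Sw2 : S (w ^+ 2) by exact: (csX CS).
have Sg : S g by exact: (csB CS).
have sg : star g = g by rewrite starB star1 starX sw.
have q2 x : S x -> star x = x -> q (x ^+ 2) = q x ^+ 2.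
  by move=> Sx sx; rewrite -(pS hq)// sx expr2.
have qC n x : S x -> q (x * (w ^+ 2) ^+ n) = q x.
  move=> Sx; elim: n => [|n IH]; first by rewrite mulr1.
  by rewrite exprSr mulrA qw ?IH//; apply: (csM CS) => //; exact: (csX CS).
pose v := w *+ 2.
have Sv : S v by rewrite /v mulr2n; exact: (csD CS).
have sv : star v = v by rewrite /v mulr2n starD sw.
have v2 : v ^+ 2 = (4 : R)%:C *: w ^+ 2.
  rewrite /v -(scaler_nat 2 w) exprZn -natrX (@natC R 4).
  by [].
have sqr : (1 + w ^+ 2) ^+ 2 = g ^+ 2 + v ^+ 2.
  have -> : v ^+ 2 = w ^+ 2 *+ 4 by rewrite /v exprMn_n.
  rewrite /g -(opprB _ 1) sqrrN sqrrB1 addrC sqrrD1 -[4%N]/(2 + 2)%N mulrnDr.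
  by rewrite [RHS]addrAC [in RHS]addrA subrK.
(* Once [4 ^ n] is cancelled, the linear term leaves a bound that is independent of [n], so [q g]
   must vanish. *)
have bound n : n.+1%:R * q g ^+ 2 <= 4.
  have psq a b i j : S a -> star a = a -> S b -> star b = b ->
      positive S ((a ^+ 2) ^+ i * (b ^+ 2) ^+ j).
    move=> Sa sa Sb sb.
    have Sai : S (a ^+ i) by exact: (csX CS).
    have Sbj : S (b ^+ j) by exact: (csX CS).
    have -> : (a ^+ 2) ^+ i * (b ^+ 2) ^+ j = (a ^+ i * b ^+ j) ^+ 2.
      rewrite -!exprM mulnC (mulnC 2%N) !exprM !expr2 -!mulrA; congr (_ * _).
      by rewrite !mulrA (csC CS Sai Sbj).
    apply: (positive_sqr CS); first exact: (csM CS).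
    by rewrite (cs_mul_sa CS)// starX ?sa ?sb.
  have pmulrn x m : positive S x -> positive S (x *+ m).
    move=> px; elim: m => [|m IH]; first exact: (positive0 CS).
    by rewrite mulrSr; apply: (positiveD CS).
  have com : GRing.comm (g ^+ 2) (v ^+ 2) by apply: (csC CS); exact: (csX CS).
  have ord : (n < n.+2)%N by rewrite ltnW.
  have : q (g ^+ 2 * (v ^+ 2) ^+ n *+ n.+1) <= q ((1 + w ^+ 2) ^+ 2) ^+ n.+1.
    have Sc : S ((1 + w ^+ 2) ^+ 2) by apply: (csX CS); exact: (csD CS).
    apply: le_trans (seminormX CS hq Sc _).
    rewrite sqr (exprDn_comm _ com) (bigD1 (Ordinal ord))//= subSnn expr1 binSn.
    apply: seminorm_positive_le => //; first exact/pmulrn/(psq g v 1%N n).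
    apply: big_ind => [||i _]; [exact: (positive0 CS)|exact: (positiveD CS)|].
    exact/pmulrn/psq.
  have Sg2 : S (g ^+ 2) by exact: (csX CS).
  have Sv2 : S (v ^+ 2) by exact: (csX CS).
  have Sgv : S (g ^+ 2 * (v ^+ 2) ^+ n) by apply: (csM CS) => //; exact: (csX CS).
  rewrite -(scaler_nat n.+1) (pZ hq)// -(@natC R).
  rewrite cabs_real ger0_norm// v2 exprZn -scalerAr -rmorphXn /= (pZ hq); last first.
    by apply: (csM CS) => //; exact: (csX CS).
  rewrite cabs_real ger0_norm ?exprn_ge0// qC//.
  have Sd : S (1 + w ^+ 2) by exact: (csD CS).
  rewrite !q2//; last by rewrite starD star1 starX sw.
  have le2 : q (1 + w ^+ 2) <= 2.
    by rewrite (le_trans (pD hq _ _))// (p1 hq) -[w ^+ 2]mul1r qw// (p1 hq).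
  have le4 : q (1 + w ^+ 2) ^+ 2 <= 4 by have := p_ge0 hq Sd; nra.
  move=> /le_trans/(_ (lerXn2r n.+1 _ _ le4)); rewrite !nnegrE sqr_ge0 => /(_ isT (ler0n _ _)).
  by rewrite (exprS 4) mulrCA [leRHS]mulrC ler_pM2l// exprn_gt0.
apply/eqP; rewrite -sqrf_eq0; apply/eqP/le_anti; rewrite sqr_ge0 andbT leNgt.
apply/negP => q0; have := archi_boundP (divr_ge0 (ler0n R 4) (ltW q0)).
set n := Num.Def.archi_bound _; rewrite ltr_pdivrMr// => hn.
have := bound n; rewrite -natr1 mulrDl mul1r; lra.
Qed.

(** Rescaled to [d] with [p d <= 1/4] and shifted, [h] becomes [f = 1/2 + d], with spectrum in
    [[1/4, 3/4]] as seen by [p]. Localizing at [f ^+ 2] makes [1 - w ^+ 2] null for [w = f / p f].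
    The shift excludes [w = -1]: the factor [1 + w] is a small perturbation of a scalar, so [1 - w]
    is null already and [f] has become a scalar. *)
Lemma localize_sa p h : cstar_seminorm S p -> S h -> star h = h ->
  exists q, [/\ cstar_seminorm S q,
    forall x, S x -> q x <= p x,
    forall y k, S y -> (forall x, S x -> p (x * y) = k * p x) ->
      forall x, S x -> q (x * y) = k * q x &
    exists l : R, q (h - l%:C *: 1) = 0].
Proof.
move=> hp Sh sh; set r := cnorm h + 1.
have r0 : 0 < r by rewrite ltr_wpDl// cnorm_ge0.
have S1 := cs1 CS; have Sc c : S (c *: 1) by exact: (csZ CS).
pose d := (4 * r)^-1%:C *: h; have Sd : S d by exact: (csZ CS).
have sd : star d = d by rewrite starZr sh.
have pd : p d <= 4^-1.
  rewrite (pZ hp)// cabs_real gtr0_norm ?invr_gt0 ?mulr_gt0// invfM -mulrA.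
  rewrite ler_piMr ?invr_ge0// ler_pdivrMl// mulr1 (le_trans (p_le hp Sh))//.
  by rewrite /r lerDl.
pose f := 2^-1%:C *: 1 + d; have Sf : S f by exact: (csD CS).
have sf : star f = f by rewrite starD starZr star1 sd.
have pf : 4^-1 <= p f.
  have := pD hp Sf (csN CS Sd); rewrite addrK (seminormN hp Sd).
  by rewrite (pZ hp _ S1) (p1 hp) cabs_real gtr0_norm ?invr_gt0//; lra.
have pf0 : 0 < p f by lra.
have pff : p (f ^+ 2) = p f ^+ 2 by rewrite -(pS hp)// sf expr2.
have Sf2 : S (f ^+ 2) by exact: (csX CS).
have sf2 : star (f ^+ 2) = f ^+ 2 by rewrite starX sf.
have pf20 : 0 < p (f ^+ 2) by rewrite pff exprn_gt0.
pose q := localized p (f ^+ 2).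
have hq : cstar_seminorm S q by exact: (localized_seminorm CS).
have qp x : S x -> q x <= p x by move=> Sx; exact: (localized_le CS hp).
have qmul x : S x -> q (x * f ^+ 2) = p (f ^+ 2) * q x.
  by move=> Sx; exact: (localized_mul CS hp).
pose m := p f; pose w := m^-1%:C *: f; have Sw : S w by exact: (csZ CS).
have sw : star w = w by rewrite starZr sf.
have qw x : S x -> q (x * w ^+ 2) = q x.
  move=> Sx; rewrite exprZn -scalerAr -rmorphXn /= (pZ hq); last exact: (csM CS).
  rewrite qmul// pff cabs_real gtr0_norm ?exprn_gt0 ?invr_gt0//.
  by rewrite exprVn mulKf// expf_neq0// gt_eqF.
have g0 := localized_sqr_eq1 hq Sw sw qw.
pose b := 1 - w; have Sb : S b by exact: (csB CS).
have b0 : q b = 0.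
  have mi : 0 < m^-1 by rewrite invr_gt0.
  (* This is [1 - w ^+ 2 = b (1 + w)] with [1 + w = (1 + 1/(2 m)) + d / m]. As [q d <= 1/4], it
     yields [(1 + 1/(2 m)) q b <= q b / (4 m)], hence [q b = 0]. *)
  have e : (1 + m^-1 / 2)%:C *: b = (1 - w ^+ 2) - b * (m^-1%:C *: d).
    have -> : 1 - w ^+ 2 = b * (1 + w).
      by rewrite /b mulrDr mulr1 mulrBl mul1r -expr2 addrA subrK.
    rewrite -mulrBr -{1}[b]mulr1 scalerAr; congr (_ * _).
    rewrite /w /f scalerDr -addrA addrK scalerA -rmorphM /=.
    by rewrite rmorphD /= scalerDl scale1r.
  have Sbd : S (b * (m^-1%:C *: d)) by apply: (csM CS) => //; exact: (csZ CS).
  have : q ((1 + m^-1 / 2)%:C *: b) <= q b * (m^-1 / 4).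
    have Sg : S (1 - w ^+ 2) by apply: (csB CS) => //; exact: (csX CS).
    rewrite e (le_trans (pD hq Sg (csN CS Sbd)))// g0 add0r (seminormN hq Sbd).
    rewrite (le_trans (pM hq Sb (csZ CS _ Sd)))//.
    rewrite ler_wpM2l ?(p_ge0 hq)// (pZ hq _ Sd) cabs_real gtr0_norm//.
    by rewrite ler_wpM2l ?(ltW mi)// (le_trans (qp _ Sd)).
  rewrite (pZ hq)// cabs_real gtr0_norm; last by rewrite addr_gt0// divr_gt0.
  by have := p_ge0 hq Sb; move: (q b) => t; nra.
exists q; split=> //; first by move=> y k Sy; exact: (localized_eigen CS hp).
(* Modulo the null space of [q] one has [f = m], and [h = 4 r (f - 1/2)]. *)
exists (4 * r * (m - 2^-1)).
have -> : h - (4 * r * (m - 2^-1))%:C *: 1 = (- (4 * r * m))%:C *: b.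
  have m0 : m != 0 by rewrite gt_eqF.
  rewrite /b /w scalerBr scalerA -rmorphM /= mulNr mulfK// /f scalerDr /d !scalerA.
  rewrite -!rmorphM /= !mulNr. rewrite divff ?mulf_neq0 ?pnatr_eq0 ?(gt_eqF r0)//.
  rewrite rmorphN1 scaleN1r opprD opprK addrA -scalerBl -rmorphB /= [RHS]addrC.
  have -> : - (4 * r * m) - - (4 * r / 2) = - (4 * r * (m - 2^-1)) by lra.
  by rewrite rmorphN scaleNr.
by rewrite (pZ hq)// b0 mulr0.
Qed.

(* The seminorm [q] plays the role of a character at which [y] attains its norm. *)
Lemma character_at_norm (hs : seq A) y : S y ->
  (forall h, h \in hs -> S h /\ star h = h) ->
  exists q, [/\ cstar_seminorm S q, q y = cnorm y &
    forall h, h \in hs -> exists l : R, q (h - l%:C *: 1) = 0].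
Proof.
move=> Sy Hs; pose k := cnorm y ^+ 2; pose y2 := star y * y.
have Ss := csS CS Sy; have S2 : S y2 by exact: (csM CS).
(* The induction carries the eigenvalue relation for [star y * y], which later localizations
   preserve; [q y = cnorm y] follows from it at [x = 1]. *)
suff [q [hq qk H]] : exists q, [/\ cstar_seminorm S q,
    forall x, S x -> q (x * y2) = k * q x &
    forall h, h \in hs -> exists l : R, q (h - l%:C *: 1) = 0].
  exists q; split => //; apply: (@pexpIrn _ 2) => //; rewrite ?nnegrE ?cnorm_ge0//.
    exact: (p_ge0 hq).
  rewrite -(pS hq)// -/y2 -[y2]mul1r qk ?(p1 hq) ?mulr1//; exact: (cs1 CS).
elim: hs Hs => [_|h hs IH Hs].
  have [y0|y0] := eqVneq y 0.
    exists (@cnorm R A); split=> //; first exact: cnorm_cstar_seminorm.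
    by move=> x Sx; rewrite /y2 /k y0 mulr0 mulr0 cnorm0 expr0n mul0r.
  have hp := cnorm_cstar_seminorm S.
  have y20 : 0 < cnorm y2 by rewrite cnorm_star exprn_gt0// cnorm_gt0.
  have s2 : star y2 = y2 by rewrite starM starK.
  exists (localized (@cnorm R A) y2); split=> //.
    exact: (localized_seminorm CS).
  by move=> x Sx; rewrite (localized_mul CS hp)// cnorm_star.
have [|q [hq qk H]] := IH; first by move=> x xs; apply: Hs; rewrite inE xs orbT.
have [|Sh sh] := Hs h; first by rewrite inE eqxx.
have [q' [hq' le_q ev [l hl]]] := localize_sa hq Sh sh.
exists q'; split=> // [|x]; first exact: ev.
rewrite inE => /orP[/eqP->|xs]; first by exists l.
have [m hm] := H x xs; exists m.
have Sx : S (x - m%:C *: 1).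
  apply: (csB CS); last by apply: (csZ CS); exact: (cs1 CS).
  by have [|] := Hs x; rewrite // inE xs orbT.
by apply/eqP; rewrite eq_le (p_ge0 hq')// andbT -hm le_q.
Qed.

End Characters.

(** * The even part of the algebra *)

Section SingleRelation.
Context {R : realType} {A : cStarAlgType R} (b : A).
Hypothesis hb : star b * b + b * star b = 1.

Let z := b ^+ 2.
Let d := star b * b - b * star b.

Lemma star_mul_rel : star b * b = (2^-1 : R)%:C *: (1 + d).
Proof.
rewrite -hb /d addrACA subrr addr0 -mulr2n -(scaler_nat 2 (star b * b)) scalerA -(@natC R) -rmorphM /=.
by rewrite mulVf ?pnatr_eq0// scale1r.
Qed.

Lemma mul_star_rel : b * star b = (2^-1 : R)%:C *: (1 - d).
Proof.
rewrite -hb /d opprB addrC addrA subrK -mulr2n -(scaler_nat 2 (b * star b)) scalerA -(@natC R) -rmorphM /=.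
by rewrite mulVf ?pnatr_eq0// scale1r.
Qed.

(** Multiply the relation by [b] on the left and on the right and cancel the common term
    [b * star b * b]. *)
Lemma sqr_star_comm : z * star b = star b * z.
Proof.
have : b * (star b * b + b * star b) = (star b * b + b * star b) * b.
  by rewrite hb mulr1 mul1r.
by rewrite mulrDr mulrDl !mulrA addrC => /addIr; rewrite -!mulrA.
Qed.

Lemma diff_sa : star d = d.
Proof. by rewrite /d starB !starM starK. Qed.

Lemma diff_anti : b * d = - (d * b).
Proof.
rewrite /d mulrBl mulrBr opprB !mulrA; congr (_ - _).
by have := sqr_star_comm; rewrite /z expr2 -!mulrA.
Qed.

(** Put [p = star b * b] and [q = b * star b]. Then [p + q = 1] and [p q = q p = z * star z], so
    this is [(p - q)^2 = (p + q)^2 - 4 p q]. *)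
Lemma diff_sqr : d ^+ 2 = 1 - (4 : R)%:C *: (z * star z).
Proof.
have sz : star z = star b ^+ 2 by rewrite /z starX.
have szc : star z * b = b * star z.
  by apply: (can_inj starK); rewrite !starM !starK sqr_star_comm.
have pq : z * star z = star b * b * (b * star b).
  by rewrite sz (expr2 (star b)) mulrA sqr_star_comm /z expr2 -!mulrA.
have qp : z * star z = b * star b * (star b * b).
  by rewrite {1}/z expr2 -mulrA -szc sz expr2 !mulrA.
have e : star b * b * (b * star b) = b * star b * (star b * b) by rewrite -pq.
rewrite pq.
rewrite -{1}(expr1n A 2) -hb (@natC R 4) (scaler_nat 4) -[4%N]/(2 + 2)%N mulrnDr.
rewrite /d; move: e; move: (star b * b) (b * star b) => p q e.
have -> : (p + q) ^+ 2 = p ^+ 2 + q ^+ 2 + p * q *+ 2.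
  by rewrite !expr2 mulrDl !mulrDr -e addrA -!addrA [in RHS](addrC (q * q)) mulr2n -!addrA.
have -> : (p - q) ^+ 2 = p ^+ 2 + q ^+ 2 - p * q *+ 2.
  rewrite !expr2 mulrBl !mulrBr -e opprB mulr2n opprD addrA.
  by rewrite -!addrA; congr (_ + _); rewrite addrCA.
by rewrite [in RHS]opprD [RHS]addrA addrK.
Qed.

End SingleRelation.

Section TwoRelations.
Context {R : realType} {A : cStarAlgType R} (b1 b2 : A).
Hypothesis hb : relations_m1_0 b1 b2.

Definition letter (i s : bool) : A :=
  let b := if i then b2 else b1 in if s then star b else b.

Definition zel i := letter i false ^+ 2.
Definition del i := letter i true * letter i false - letter i false * letter i true.

Lemma letter_rel i :
  star (letter i false) * letter i false + letter i false * star (letter i false) = 1.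
Proof. by case: hb => h1 h2 _ _; case: i. Qed.

Lemma letter_star i s : star (letter i s) = letter i (~~ s).
Proof. by rewrite /letter; case: i; case: s => //=; rewrite starK. Qed.

Lemma letter_anti s t : letter true t * letter false s = - (letter false s * letter true t).
Proof.
have [_ _ h3 h4] := hb.
have h4' : b2 * b1 = - (b1 * b2) by apply/eqP; rewrite -addr_eq0 addrC h4.
have h3' : b2 * star b1 = - (star b1 * b2) by rewrite h3 opprK.
case: s; case: t => //=; apply: (can_inj starK); rewrite starN !starM ?starK//.
by rewrite h4' opprK.
Qed.

Lemma letter_del i s : letter i s * del i = - (del i * letter i s).
Proof.
have h := diff_anti (letter_rel i); rewrite /del -[letter i true](letter_star i false).
case: s => //; apply: (can_inj starK).
rewrite -[letter i true](letter_star i false) starN !starM starK diff_sa.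
by rewrite h opprK.
Qed.

Lemma anti_mul x y y' : x * y = - (y * x) -> x * y' = - (y' * x) ->
  x * (y * y') = y * y' * x :> A.
Proof. by move=> h h'; rewrite mulrA h mulNr -[X in - X]mulrA h' mulrN opprK mulrA. Qed.

Lemma letter_anti_other i s t :
  letter i s * letter (~~ i) t = - (letter (~~ i) t * letter i s).
Proof. by case: i; rewrite letter_anti ?opprK. Qed.

Lemma letter_del_other i s : letter i s * del (~~ i) = del (~~ i) * letter i s.
Proof. by rewrite /del mulrBr mulrBl !anti_mul//; exact: letter_anti_other. Qed.

Lemma letter_zel i j s : letter i s * zel j = zel j * letter i s.
Proof.
have [->|ij] := eqVneq i j.
  rewrite /zel; case: s; last by rewrite -exprS -exprSr.
  by rewrite -[letter j true](letter_star j false) (sqr_star_comm (letter_rel j)).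
have -> : j = ~~ i by case: i j ij => -[].
by rewrite /zel expr2 anti_mul//; exact: letter_anti_other.
Qed.

Lemma letter_zels i j s : letter i s * star (zel j) = star (zel j) * letter i s.
Proof.
by apply: (can_inj starK); rewrite !starM starK !letter_star letter_zel.
Qed.

(* The even part of the algebra is generated by the [zel i], their adjoints and the
   [del i]; [even x g] says that the element [x] is given by the polynomial [g] in
   [zel false], [zel true], [del false], [del true] and their conjugates. *)
Inductive even : A -> (Cplx R -> Cplx R -> Cplx R -> Cplx R -> Cplx R) -> Prop :=
| even_cst c : even (c *: 1) (fun _ _ _ _ => c)
| even_z1 : even (zel false) (fun z1 _ _ _ => z1)
| even_z2 : even (zel true) (fun _ z2 _ _ => z2)
| even_z1s : even (star (zel false)) (fun z1 _ _ _ => (z1^*)%R)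
| even_z2s : even (star (zel true)) (fun _ z2 _ _ => (z2^*)%R)
| even_d1 : even (del false) (fun _ _ r1 _ => r1)
| even_d2 : even (del true) (fun _ _ _ r2 => r2)
| even_add x y f g : even x f -> even y g ->
    even (x + y) (fun z1 z2 r1 r2 => f z1 z2 r1 r2 + g z1 z2 r1 r2)
| even_mul x y f g : even x f -> even y g ->
    even (x * y) (fun z1 z2 r1 r2 => f z1 z2 r1 r2 * g z1 z2 r1 r2).

Definition flip (i : bool) (g : Cplx R -> Cplx R -> Cplx R -> Cplx R -> Cplx R) :=
  fun z1 z2 r1 r2 => if i then g z1 z2 r1 (- r2) else g z1 z2 (- r1) r2.

Lemma even_opp x g : even x g -> even (- x) (fun z1 z2 r1 r2 => - g z1 z2 r1 r2).
Proof.
move=> /(even_mul (even_cst (-1))); rewrite -scalerAl mul1r scaleN1r.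
congr even; apply/funext => z1; apply/funext => z2; apply/funext => r1.
by apply/funext => r2; rewrite mulN1r.
Qed.

(** A letter commutes with every generator of the even part except the [del] of its own index, with
    which it anticommutes. The effect on [g] is thus one sign change, the same in every algebra. *)
Lemma even_letter i s x g : even x g -> exists x',
  even x' (flip i g) /\ letter i s * x = x' * letter i s.
Proof.
elim=> {x g} [c|||||||x y f g _ [x' [ex hx]] _ [y' [ey hy]]
    |x y f g _ [x' [ex hx]] _ [y' [ey hy]]].
- exists (c *: 1); rewrite -scalerAr mulr1 -scalerAl mul1r; split=> //.
  by case: i; exact: even_cst.
- by exists (zel false); rewrite letter_zel; split=> //; case: i; exact: even_z1.
- by exists (zel true); rewrite letter_zel; split=> //; case: i; exact: even_z2.
- by exists (star (zel false)); rewrite letter_zels; split=> //; case: i; exact: even_z1s.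
- by exists (star (zel true)); rewrite letter_zels; split=> //; case: i; exact: even_z2s.
- case: i.
    by exists (del false); rewrite (letter_del_other true); split=> //; exact: even_d1.
  by exists (- del false); rewrite letter_del mulNr; split=> //; exact: (even_opp even_d1).
- case: i.
    by exists (- del true); rewrite letter_del mulNr; split=> //; exact: (even_opp even_d2).
  by exists (del true); rewrite (letter_del_other false); split=> //; exact: even_d2.
- exists (x' + y'); rewrite mulrDr mulrDl hx hy; split=> //.
  by have := even_add ex ey; case: i {ex ey hx hy}.
- exists (x' * y'); rewrite mulrA hx -mulrA hy mulrA; split=> //.
  by have := even_mul ex ey; case: i {ex ey hx hy}.
Qed.

Definition even_sqr_val (i s t : bool) (z1 z2 r1 r2 : Cplx R) : Cplx R :=
  let z := if i then z2 else z1 in let r := if i then r2 else r1 in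
  if s then if t then (z^*)%R else (2^-1 : R)%:C * (1 + r)
  else if t then (2^-1 : R)%:C * (1 - r) else z.

Lemma even_sqr i s t : even (letter i s * letter i t) (even_sqr_val i s t).
Proof.
have cst1 := even_cst 1; rewrite scale1r in cst1.
have ed : even (del i) (fun z1 z2 r1 r2 => if i then r2 else r1).
  by case: i; [exact: even_d2|exact: even_d1].
have half x g : even x g -> even ((2^-1 : R)%:C *: x)
    (fun z1 z2 r1 r2 => (2^-1 : R)%:C * g z1 z2 r1 r2).
  by move=> /(even_mul (even_cst (2^-1 : R)%:C)); rewrite -scalerAl mul1r.
case: s; case: t.
- have -> : letter i true * letter i true = star (zel i).
    by rewrite /zel starX letter_star expr2.
  by case: i {ed}; [exact: even_z2s|exact: even_z1s].
- rewrite -[letter i true](letter_star i false) (star_mul_rel (letter_rel i)).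
  by rewrite letter_star; apply/half/even_add.
- rewrite -[letter i true](letter_star i false) (mul_star_rel (letter_rel i)).
  by rewrite letter_star; apply/half/even_add => //; exact: even_opp.
- by rewrite -expr2 -/(zel i); case: i {ed}; [exact: even_z2|exact: even_z1].
Qed.

End TwoRelations.

Section EvenNorm.
Context {R : realType} {A : cStarAlgType R} (b1 b2 : A).
Hypothesis hb : relations_m1_0 b1 b2.

Local Notation letter := (letter b1 b2).
Local Notation zel := (zel b1 b2).
Local Notation del := (del b1 b2).
Local Notation even := (even b1 b2).

Let H : set A := [set h | exists i, [\/ h = zel i, h = star (zel i) | h = del i]].

Let mul_comm x y y' : y * x = x * y -> y' * x = x * y' -> y * y' * x = x * (y * y') :> A.
Proof. by move=> h h'; rewrite -mulrA h' mulrA h mulrA. Qed.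

Let central_comm x h : (forall i s, letter i s * x = x * letter i s) -> H h ->
  h * x = x * h.
Proof.
move=> c [i [] ->]; first by rewrite /zel expr2; exact: mul_comm.
  by rewrite /zel starX letter_star expr2; exact: mul_comm.
by rewrite /del mulrBl mulrBr; congr (_ - _); exact: mul_comm.
Qed.

Let H_comm h h' : H h -> H h' -> h * h' = h' * h.
Proof.
move=> Hh [j [] ->]; try by apply: central_comm => // i s; rewrite ?letter_zel ?letter_zels.
case: Hh => i [] ->.
- by symmetry; apply: central_comm => [k s|]; [rewrite letter_zel|exists j; exact: Or33].
- by symmetry; apply: central_comm => [k s|]; [rewrite letter_zels|exists j; exact: Or33].
- have [->//|ij] := eqVneq i j; have -> : j = ~~ i by case: i j ij => -[].
  have key y : (forall s, letter i s * y = y * letter i s) -> del i * y = y * del i.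
    by move=> hy; rewrite /del mulrBl mulrBr; congr (_ - _); exact: mul_comm.
  by apply: key => s; rewrite letter_del_other.
Qed.

Let H_star h : H h -> H (star h).
Proof.
move=> [i [] ->]; exists i; [exact: Or32|by rewrite starK; exact: Or31|].
by apply: Or33; rewrite /del starB !starM !letter_star.
Qed.

Let S := bicommutant H.
Let CS : comm_subalg S := bicommutant_subalg H_comm H_star.

Let Sz i : S (zel i).
Proof. by apply: bicommutant_sub; exists i; exact: Or31. Qed.

Let Sd i : S (del i).
Proof. by apply: bicommutant_sub; exists i; exact: Or33. Qed.

Let Szs i : S (star (zel i)).
Proof. by apply: bicommutant_sub; exists i; exact: Or32. Qed.

Let even_sub x g : even x g -> S x.
Proof.
elim=> {x g} // [c|x y f g _ Sx _ Sy|x y f g _ Sx _ Sy].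
- by apply: (csZ CS); exact: (cs1 CS).
- exact: (csD CS).
- exact: (csM CS).
Qed.

(** Take a seminorm [q] that attains the norm at [x] and turns all generators of the even part into
    scalars. Modulo [q], [x] is then the scalar [g] of these values, and [diff_sqr] read modulo [q]
    shows that the values are among those where [g] is bounded by [M]. *)
Lemma even_norm_le x g (M : R) : even x g ->
  (forall z1 z2 : Cplx R, forall r1 r2 : R,
    r1 ^+ 2 = 1 - 4 * cabs z1 ^+ 2 -> r2 ^+ 2 = 1 - 4 * cabs z2 ^+ 2 ->
    cabs (g z1 z2 r1%:C r2%:C) <= M) ->
  cnorm x <= M.
Proof.
move=> ex hM; have Sx := even_sub ex; have S1 := cs1 CS.
(* Twice the real part and minus twice the imaginary part of [zel i]: only self-adjoint elements can
   be turned into scalars by [character_at_norm]. *)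
pose re i := zel i + star (zel i); pose im i := ('i)%R *: (zel i - star (zel i)).
have Sre i : S (re i) by exact: (csD CS).
have Sim i : S (im i) by apply: (csZ CS); exact: (csB CS).
have sre i : star (re i) = re i by rewrite starD starK addrC.
have sim i : star (im i) = im i.
  by rewrite starZ conjCi starB starK scaleNr -scalerN opprB.
have sd i : star (del i) = del i by rewrite /del starB !starM !letter_star.
have [h|q [hq qx hl]] := character_at_norm
    (hs := [:: re false; re true; im false; im true; del false; del true]) CS Sx.
  by rewrite !inE => /orP[/eqP->|/orP[/eqP->|/orP[/eqP->|/orP[/eqP->|/orP[]/eqP->]]]].
(* The null space of [q] in [S] is an ideal, so such values add and multiply; they are unique
   because [q 1 = 1]. *)
pose ev y (c : Cplx R) := S y /\ q (y - c *: 1) = 0.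
have Sc c : S (c *: 1) by exact: (csZ CS).
have evD y z c c' : ev y c -> ev z c' -> ev (y + z) (c + c').
  move=> [Sy yc] [Sz' zc]; split; first exact: (csD CS).
  apply/eqP; rewrite eq_le (p_ge0 hq) ?andbT; last by apply: (csB CS) => //; exact: (csD CS).
  rewrite scalerDl opprD addrACA (le_trans (pD hq _ _)) ?yc ?zc ?addr0//; exact: (csB CS).
have evM y z c c' : ev y c -> ev z c' -> ev (y * z) (c * c').
  move=> [Sy yc] [Sz' zc]; split; first exact: (csM CS).
  have Syz : S (y * z) by exact: (csM CS).
  have S2 : S (y - c *: 1) by exact: (csB CS).
  have S3 : S (z - c' *: 1) by exact: (csB CS).
  have S4 : S (c *: (z - c' *: 1)) by exact: (csZ CS).
  have S5 : S ((y - c *: 1) * z) by exact: (csM CS).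
  apply/eqP; rewrite eq_le (p_ge0 hq) ?andbT; last exact: (csB CS).
  have -> : y * z - (c * c') *: 1 = (y - c *: 1) * z + c *: (z - c' *: 1).
    by rewrite mulrBl -scalerAl mul1r scalerBr scalerA addrA subrK.
  rewrite (le_trans (pD hq S5 S4))// (pZ hq)// zc mulr0 addr0.
  by rewrite (le_trans (pM hq S2 Sz'))// yc mul0r.
have evC c : ev (c *: 1) c.
  by split=> //; rewrite subrr -(scale0r (1 : A)) (pZ hq)// cabs0 mul0r.
have evZ k y c : ev y c -> ev (k *: y) (k * c).
  by move=> /(evM _ _ _ _ (evC k)); rewrite -scalerAl mul1r.
have ev_inj y c c' : ev y c -> ev y c' -> c = c'.
  move=> [Sy yc] [_ yc']; apply/eqP; rewrite -subr_eq0; apply/eqP/cabs_eq0/eqP.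
  rewrite eq_le cabs_ge0 andbT.
  have Sa : S (y - c' *: 1) by exact: (csB CS).
  have Sb : S (y - c *: 1) by exact: (csB CS).
  have := pD hq Sa (csN CS Sb).
  by rewrite (seminormN hq Sb) yc yc' addr0 opprB addrC addrA subrK -scalerBl
    (pZ hq)// (p1 hq) mulr1.
have evz i : exists l, ev (zel i) l /\ ev (star (zel i)) (l^*)%R.
  have [l hlr] : exists l : R, q (re i - l%:C *: 1) = 0.
    by apply: hl; rewrite !inE; case: i; rewrite eqxx ?orbT.
  have [m hmi] : exists m : R, q (im i - m%:C *: 1) = 0.
    by apply: hl; rewrite !inE; case: i {hlr}; rewrite eqxx ?orbT.
  have er : ev (re i) l%:C by [].
  have ei : ev (im i) m%:C by [].
  have ii : ('i * 'i)%R = -1 :> Cplx R by rewrite -expr2 sqrCi.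
  have two (y : A) : (2^-1 : R)%:C *: (y + y) = y.
    rewrite -mulr2n -(scaler_nat 2 y) scalerA -(@natC R) -rmorphM /=.
    by rewrite mulVf ?pnatr_eq0// scale1r.
  exists ((2^-1 : R)%:C * (l%:C + (- ('i)%R) * m%:C)); split.
    have -> : zel i = (2^-1 : R)%:C *: (re i + (- ('i)%R) *: im i).
      by rewrite /im scalerA mulNr ii opprK scale1r /re addrACA subrr addr0 two.
    exact/evZ/evD/evZ.
  have -> : star (zel i) = (2^-1 : R)%:C *: (re i + ('i)%R *: im i).
    by rewrite /im scalerA ii scaleN1r opprB /re addrC addrA subrK two.
  rewrite rmorphM rmorphD rmorphM rmorphN /= conjCi opprK !conj_realC.
  exact/evZ/evD/evZ.
have evd i : exists r : R, ev (del i) r%:C.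
  have [l hlr] : exists l : R, q (del i - l%:C *: 1) = 0.
    by apply: hl; rewrite !inE; case: i; rewrite eqxx ?orbT.
  by exists l.
have evr i z r : ev (zel i) z -> ev (star (zel i)) (z^*)%R -> ev (del i) r%:C ->
    r ^+ 2 = 1 - 4 * cabs z ^+ 2.
  move=> ez ezs ed; have e1 := evM _ _ _ _ ed ed.
  have e2 := evD _ _ _ _ (evC 1) (evZ (- (4 : R)%:C) _ _ (evM _ _ _ _ ez ezs)).
  have dd : del i * del i = 1 *: 1 + - (4 : R)%:C *: (zel i * star (zel i)).
    have := diff_sqr (letter_rel hb i); rewrite letter_star /= expr2 scale1r scaleNr.
    by [].
  move: e1; rewrite dd => e1; have := ev_inj _ _ _ e1 e2.
  rewrite mulNr [(z * _)%R]mulrC -sqr_cabs => h; apply: (@complexI R).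
  by rewrite (expr2 r) rmorphM /= h rmorphB rmorph1 -rmorphM.
have [z1 [ez1 ez1s]] := evz false; have [z2 [ez2 ez2s]] := evz true.
have [r1 er1] := evd false; have [r2 er2] := evd true.
have evx : ev x (g z1 z2 r1%:C r2%:C).
  elim: ex => // [y z f f' _ h1 _ h2|y z f f' _ h1 _ h2].
  - exact: evD.
  - exact: evM.
apply: le_trans (hM z1 z2 r1 r2 (evr _ _ _ ez1 ez1s er1) (evr _ _ _ ez2 ez2s er2)).
rewrite -qx; have [_ h0] := evx; set c := g _ _ _ _ in h0 *.
have := pD hq (csB CS Sx (Sc c)) (Sc c).
by rewrite subrK h0 add0r (pZ hq)// (p1 hq) mulr1.
Qed.

End EvenNorm.

(** * The operator norm *)

Lemma sum_cauchy_schwarz (R : realType) (I : finType) (a b : I -> R) :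
  (\sum_i a i * b i) ^+ 2 <= (\sum_i a i ^+ 2) * (\sum_i b i ^+ 2).
Proof.
set X := \sum_i a i ^+ 2; set Y := \sum_i b i ^+ 2; set Z := \sum_i a i * b i.
have Y0 : 0 <= Y by apply: sumr_ge0 => i _; exact: sqr_ge0.
have [Y00|Yn0] := eqVneq Y 0.
  have b0 i : b i = 0.
    apply/eqP; rewrite -sqrf_eq0.
    by have /psumr_eq0P := Y00; move=> ->// => j _; exact: sqr_ge0.
  have -> : Z = 0 by apply: big1 => i _; rewrite b0 mulr0.
  by rewrite Y00 mulr0 expr0n.
have : 0 <= \sum_i (Y * a i - Z * b i) ^+ 2 by apply: sumr_ge0 => i _; exact: sqr_ge0.
have -> : \sum_i (Y * a i - Z * b i) ^+ 2 = Y * (X * Y - Z ^+ 2).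
  have e i : (Y * a i - Z * b i) ^+ 2 =
      Y ^+ 2 * a i ^+ 2 - 2 * Y * Z * (a i * b i) + Z ^+ 2 * b i ^+ 2 by ring.
  rewrite (eq_bigr _ (fun i _ => e i)) big_split /= sumrB -!mulr_sumr -/X -/Y -/Z. by ring.
by rewrite pmulr_rge0 ?subr_ge0// lt_def Yn0.
Qed.

Section OperatorNorm.
Context {R : realType} {n : nat}.
Implicit Types (v w : 'cV[Cplx R]_n) (M N : 'M[Cplx R]_n).

Let sqr_cabsE (c : Cplx R) :
  complex.Re c ^+ 2 + complex.Im c ^+ 2 = cabs c ^+ 2.
Proof. by rewrite cabs_sqrt sqr_sqrtr// addr_ge0// sqr_ge0. Qed.

Lemma l2norm_ge0 v : 0 <= l2norm v.
Proof. exact: sqrtr_ge0. Qed.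

Lemma l2norm_sqr v : l2norm v ^+ 2 = \sum_i cabs (v i 0) ^+ 2.
Proof.
rewrite /l2norm (eq_bigr _ (fun i _ => sqr_cabsE _)) sqr_sqrtr//.
by apply: sumr_ge0 => i _; exact: sqr_ge0.
Qed.

Lemma l2normZ (c : Cplx R) v : l2norm (c *: v) = cabs c * l2norm v.
Proof.
apply: (@pexpIrn _ 2) => //; rewrite ?nnegrE ?mulr_ge0 ?l2norm_ge0 ?cabs_ge0//.
rewrite exprMn !l2norm_sqr mulr_sumr; apply: eq_bigr => i _.
by rewrite mxE cabsM exprMn.
Qed.

Lemma l2norm0 : l2norm (0 : 'cV[Cplx R]_n) = 0.
Proof. by rewrite -(scale0r (0 : 'cV_n)) l2normZ cabs0 mul0r. Qed.

Lemma l2norm_eq0 v : l2norm v = 0 -> v = 0.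
Proof.
move=> v0; have := l2norm_sqr v; rewrite v0 expr0n /= => /esym/psumr_eq0P h.
apply/matrixP => i j; rewrite ord1 mxE; apply: cabs_eq0; apply/eqP.
by rewrite -sqrf_eq0; apply/eqP/h => // k _; exact: sqr_ge0.
Qed.

Lemma l2norm_dot v w : cabs ((v^t* *m w) 0 0) <= l2norm v * l2norm w.
Proof.
have le_sum (I : Type) (s : seq I) (F : I -> Cplx R) :
    cabs (\sum_(i <- s) F i) <= \sum_(i <- s) cabs (F i).
  elim: s => [|i s IH]; first by rewrite !big_nil cabs0.
  by rewrite !big_cons (le_trans (cabsD _ _))// lerD2l.
rewrite -(@ler_pXn2r _ 2) ?nnegrE ?mulr_ge0 ?l2norm_ge0 ?cabs_ge0//.
rewrite exprMn !l2norm_sqr; apply: le_trans (sum_cauchy_schwarz _ _).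
rewrite ler_pXn2r ?nnegrE ?cabs_ge0//; last first.
  by apply: sumr_ge0 => i _; rewrite mulr_ge0 ?cabs_ge0.
rewrite mxE (le_trans (le_sum _ _ _))//; apply: ler_sum => i _.
by rewrite !mxE cabsM cabs_conj.
Qed.

Lemma l2norm_dotE v : (l2norm v ^+ 2)%:C = (v^t* *m v) 0 0.
Proof.
rewrite l2norm_sqr rmorph_sum /= mxE; apply: eq_bigr => i _.
by rewrite !mxE sqr_cabs.
Qed.

Lemma l2normD v w : l2norm (v + w) <= l2norm v + l2norm w.
Proof.
rewrite -(@ler_pXn2r _ 2) ?nnegrE ?addr_ge0 ?l2norm_ge0// sqrrD !l2norm_sqr.
have h : \sum_i cabs (v i 0) * cabs (w i 0) <= l2norm v * l2norm w.
  rewrite -(@ler_pXn2r _ 2) ?nnegrE ?mulr_ge0 ?l2norm_ge0//.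
    by rewrite exprMn !l2norm_sqr; exact: sum_cauchy_schwarz.
  by apply: sumr_ge0 => i _; rewrite mulr_ge0 ?cabs_ge0.
have le i : cabs ((v + w) i 0) ^+ 2 <= cabs (v i 0) ^+ 2 +
    (cabs (v i 0) * cabs (w i 0)) *+ 2 + cabs (w i 0) ^+ 2.
  by rewrite -sqrrD mxE ler_pXn2r ?nnegrE ?addr_ge0 ?cabs_ge0// cabsD.
apply: (le_trans (ler_sum _ (fun i _ => le i))).
by rewrite !big_split /= lerD2r lerD2l mulr2n lerD.
Qed.

(** A crude bound which shows that the supremum in [opnorm] is finite, and which reduces continuity
    in norm to continuity of the entries. *)
Definition entry_sum M : R := \sum_i \sum_j cabs (M i j).

Lemma entry_sum_ge0 M : 0 <= entry_sum M.
Proof. by do 2!apply: sumr_ge0 => ? _; exact: cabs_ge0. Qed.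

Lemma l2norm_entry v i : cabs (v i 0) <= l2norm v.
Proof.
rewrite -(@ler_pXn2r _ 2) ?nnegrE ?l2norm_ge0 ?cabs_ge0// l2norm_sqr (bigD1 i)//=.
by rewrite lerDl; apply: sumr_ge0 => j _; exact: sqr_ge0.
Qed.

Lemma l2norm_le_sum v : l2norm v <= \sum_i cabs (v i 0).
Proof.
have s0 : 0 <= \sum_i cabs (v i 0) by apply: sumr_ge0 => i _; exact: cabs_ge0.
rewrite -(@ler_pXn2r _ 2) ?nnegrE ?l2norm_ge0// l2norm_sqr expr2 mulr_suml.
apply: ler_sum => i _; rewrite expr2 ler_wpM2l ?cabs_ge0// (bigD1 i)//= lerDl.
by apply: sumr_ge0 => j _; exact: cabs_ge0.
Qed.

Lemma l2norm_mul_le M v : l2norm (M *m v) <= entry_sum M * l2norm v.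
Proof.
rewrite (le_trans (l2norm_le_sum _))// /entry_sum mulr_suml; apply: ler_sum => i _.
rewrite mxE mulr_suml; elim/big_ind2 : _ => [|x1 x2 y1 y2 h1 h2|j _].
- by rewrite cabs0.
- by rewrite (le_trans (cabsD _ _))// lerD.
- by rewrite cabsM ler_wpM2l ?cabs_ge0// l2norm_entry.
Qed.

Let opset M := [set l2norm (M *m v) | v in [set v | l2norm v <= 1]].

Let opset_ub M : ubound (opset M) (entry_sum M).
Proof.
move=> _ [v v1 <-]; rewrite (le_trans (l2norm_mul_le _ _))// ler_piMr//.
exact: entry_sum_ge0.
Qed.

Let opset_sup M : has_sup (opset M).
Proof.
split; last by exists (entry_sum M); exact: opset_ub.
by exists (l2norm (M *m 0)), 0 => //=; rewrite l2norm0.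
Qed.

Lemma opnorm_ge0 M : 0 <= opnorm M.
Proof.
rewrite -[leLHS]l2norm0 -(mulmx0 _ M).
by apply: (ub_le_sup (proj2 (opset_sup M))); exists 0; rewrite /= ?l2norm0.
Qed.

Lemma l2norm_opnorm M v : l2norm (M *m v) <= opnorm M * l2norm v.
Proof.
have [->|v0] := eqVneq v 0; first by rewrite mulmx0 l2norm0 mulr0.
have nv : 0 < l2norm v.
  by rewrite lt_def l2norm_ge0 andbT; apply: contra v0 => /eqP/l2norm_eq0->.
have nz (w : 'cV_n) : l2norm ((l2norm v)^-1%:C *: w) = (l2norm v)^-1 * l2norm w.
  by rewrite l2normZ cabs_real gtr0_norm// invr_gt0.
rewrite mulrC -ler_pdivrMl// -nz scalemxAr.
apply: (ub_le_sup (proj2 (opset_sup M))).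
by exists ((l2norm v)^-1%:C *: v) => //=; rewrite nz mulVf ?gt_eqF.
Qed.

Lemma opnorm_le M (C : R) : 0 <= C ->
  (forall v, l2norm (M *m v) <= C * l2norm v) -> opnorm M <= C.
Proof.
move=> C0 h; apply: ge_sup; first exact: (proj1 (opset_sup M)).
by move=> _ [v v1 <-]; rewrite (le_trans (h v))// ler_piMr.
Qed.

Lemma opnorm_entry_sum M : opnorm M <= entry_sum M.
Proof. by apply: opnorm_le => [|v]; [exact: entry_sum_ge0|exact: l2norm_mul_le]. Qed.

Lemma opnorm_entry M i j : cabs (M i j) <= opnorm M.
Proof.
have e1 : l2norm (delta_mx j 0 : 'cV[Cplx R]_n) = 1.
  apply: (@pexpIrn _ 2) => //; rewrite ?nnegrE ?l2norm_ge0// expr1n l2norm_sqr.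
  rewrite (bigD1 j)//= mxE !eqxx cabs1 expr1n big1 ?addr0// => k /negPf kj.
  by rewrite mxE kj cabs0 expr0n.
have := l2norm_opnorm M (delta_mx j 0); rewrite e1 mulr1; apply: le_trans.
by have := l2norm_entry (M *m delta_mx j 0) i; rewrite -colE mxE.
Qed.

Lemma opnorm_eq0 M : opnorm M = 0 -> M = 0.
Proof.
move=> M0; apply/matrixP => i j; rewrite mxE; apply: cabs_eq0.
by apply/eqP; rewrite eq_le cabs_ge0 andbT -M0 opnorm_entry.
Qed.

Lemma opnormD M N : opnorm (M + N) <= opnorm M + opnorm N.
Proof.
apply: opnorm_le => [|v]; first by rewrite addr_ge0 ?opnorm_ge0.
rewrite mulmxDl (le_trans (l2normD _ _))// mulrDl lerD// l2norm_opnorm//.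
Qed.

Lemma opnormM M N : opnorm (M *m N) <= opnorm M * opnorm N.
Proof.
apply: opnorm_le => [|v]; first by rewrite mulr_ge0 ?opnorm_ge0.
rewrite -mulmxA (le_trans (l2norm_opnorm _ _))// -mulrA ler_wpM2l ?opnorm_ge0//.
exact: l2norm_opnorm.
Qed.

Lemma opnormZ c M : opnorm (c *: M) = cabs c * opnorm M.
Proof.
have le d N : opnorm (d *: N) <= cabs d * opnorm N.
  apply: opnorm_le => [|v]; first by rewrite mulr_ge0 ?opnorm_ge0 ?cabs_ge0.
  by rewrite -scalemxAl l2normZ -mulrA ler_wpM2l ?cabs_ge0// l2norm_opnorm.
apply/eqP; rewrite eq_le le /=.
have [->|c0] := eqVneq c 0; first by rewrite cabs0 mul0r opnorm_ge0.
have cn : 0 < cabs c.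
  by rewrite lt_def cabs_ge0 andbT; apply: contra c0 => /eqP/cabs_eq0->.
rewrite -ler_pdivlMl//; have := le c^-1 (c *: M).
rewrite scalerA mulVf// scale1r => /le_trans; apply.
rewrite ler_wpM2r ?opnorm_ge0//; suff -> : cabs c^-1 = (cabs c)^-1 by [].
by apply: (mulfI (lt0r_neq0 cn)); rewrite -cabsM divff // cabs1 divff ?lt0r_neq0.
Qed.

Lemma opnorm0 : opnorm (0 : 'M[Cplx R]_n) = 0.
Proof. by rewrite -(scale0r (0 : 'M[Cplx R]_n)) opnormZ cabs0 mul0r. Qed.

Lemma opnormN M : opnorm (- M) = opnorm M.
Proof. by rewrite -scaleN1r opnormZ cabsN cabs1 mul1r. Qed.

Lemma adjM M N : (M *m N)^t* = (N^t* ) *m (M^t* ).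
Proof. by rewrite trmx_mul map_mxM. Qed.

Let opnorm_sqr_le N : opnorm N ^+ 2 <= opnorm (N^t* *m N).
Proof.
have T0 := opnorm_ge0 (N^t* *m N).
rewrite -(@sqr_sqrtr _ (opnorm (N^t* *m N)))//.
rewrite ler_pXn2r ?nnegrE ?opnorm_ge0 ?sqrtr_ge0//.
apply: opnorm_le => [|v]; first exact: sqrtr_ge0.
rewrite -(@ler_pXn2r _ 2) ?nnegrE ?mulr_ge0 ?l2norm_ge0 ?sqrtr_ge0//.
rewrite exprMn (sqr_sqrtr T0).
have -> : l2norm (N *m v) ^+ 2 = cabs ((v^t* *m (N^t* *m N *m v)) 0 0).
  rewrite -[LHS]ger0_norm ?sqr_ge0// -cabs_real l2norm_dotE.
  by rewrite trmx_mul map_mxM !mulmxA.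
rewrite (le_trans (l2norm_dot _ _))// expr2 mulrCA ler_wpM2l ?l2norm_ge0//.
exact: l2norm_opnorm.
Qed.

Lemma opnorm_adj M : opnorm (M^t* ) = opnorm M.
Proof.
have le N : opnorm N <= opnorm (N^t* ).
  have [N0|N0] := eqVneq (opnorm N) 0; first by rewrite N0 opnorm_ge0.
  have Np : 0 < opnorm N by rewrite lt_def N0 opnorm_ge0.
  have := le_trans (opnorm_sqr_le N) (opnormM (N^t* ) N).
  by rewrite expr2 (ler_pM2r Np).
apply: le_anti; apply/andP; split; last exact: le.
by have := le (M^t* ); rewrite (trmxCK M).
Qed.

Lemma opnorm_star M : opnorm (M^t* *m M) = opnorm M ^+ 2.
Proof.
apply: le_anti; rewrite opnorm_sqr_le andbT; have := opnormM (M^t* ) M.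
by rewrite opnorm_adj expr2.
Qed.

End OperatorNorm.

(** * The domain and the boundary conditions *)

Section DomTopology.
Context {R : realType}.
Local Notation Dom := (Dom R).
Local Notation C := (Cplx R).
Local Notation M4 := 'M[Cplx R]_4.

Lemma expi_surj (z : C) : `|z| = 1 -> exists2 phi, phi \in `[0, 2 * pi] & z = expi phi.
Proof.
move=> z1; have : cabs z = 1 by rewrite /cabs z1.
case: z {z1} => x y; rewrite cabs_sqrt /= => /(congr1 (fun t => t ^+ 2)).
rewrite sqr_sqrtr ?addr_ge0 ?sqr_ge0// expr1n => xy.
have x1 : -1 <= x <= 1 by nra.
have [a0 ac] := acos_def x1; have sa := sin_acos x1.
have pi0 := pi_ge0 R.
have ysq : Num.sqrt (1 - x ^+ 2) = `|y| by rewrite -xy addrAC subrr add0r sqrtr_sqr.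
have [y0|y0] := leP 0 y.
  exists (acos x); last by rewrite /expi ac sa ysq ger0_norm.
  by rewrite in_itv /=; lra.
exists (2 * pi - acos x); first by rewrite in_itv /=; lra.
rewrite /expi mulr_natl cosB sinB cos2pi sin2pi mul1r !mul0r addr0 sub0r ac sa ysq.
by rewrite ltr0_norm// mul1r opprK.
Qed.

Lemma continuous_cplxP (T : topologicalType) (g : T -> C) (p : T) :
  g @ p --> g p <-> forall e : R, 0 < e -> \forall q \near p, cabs (g q - g p) < e.
Proof.
split=> [/cvgrPdist_lt h e e0|h].
  have e0C : 0 < (e%:C : C) by rewrite ltcR.
  have := h _ e0C; apply: filter_app; apply: nearW => q.
  by rewrite distrC normCE ltcR.
apply/cvgrPdist_lt => e e0.
have er : e = (complex.Re e)%:C by case: e e0 => a b; rewrite ltcE /= => /andP[/eqP-> _].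
have e0R : 0 < complex.Re e by move: e0; rewrite er ltcR.
have := h _ e0R; apply: filter_app; apply: nearW => q.
by rewrite distrC normCE er ltcR.
Qed.

Lemma continuous_entryP (T : topologicalType) (f : T -> M4) (p : T) :
  f @ p --> f p <-> forall i j, (fun q => f q i j) @ p --> f p i j.
Proof.
split=> [h i j U nU|h U [P hP sP]].
  suff /h : nbhs (f p) [set N : M4 | U (N i j)] by [].
  exists (fun i' j' => if (i' == i) && (j' == j) then U else setT).
    by move=> i' j'; case: ifP => [/andP[/eqP-> /eqP->]//|_]; exact: filterT.
  by move=> N /(_ i j); rewrite /= !eqxx.
have : \forall q \near p, forall i j, P i j (f q i j).
  apply: filter_forall => i; apply: filter_forall => j; exact: h (hP i j).
by apply: filter_app; apply: nearW => q hq; exact: sP.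
Qed.

Lemma continuous_opnormP (T : topologicalType) (f : T -> M4) (p : T) :
  f @ p --> f p <->
  forall e : R, 0 < e -> \forall q \near p, opnorm (f q - f p) < e.
Proof.
rewrite continuous_entryP; split=> [h e e0|h i j].
  (* Sixteen entries of size at most [e / 17] sum to strictly less than [e]. *)
  have e16 : 0 < e / 17 by rewrite divr_gt0.
  have : \forall q \near p, forall i j, cabs (f q i j - f p i j) < e / 17.
    apply: filter_forall => i; apply: filter_forall => j.
    exact: (proj1 (continuous_cplxP (fun q => f q i j) p) (h i j) _ e16).
  apply: filter_app; apply: nearW => q hq.
  apply: le_lt_trans (opnorm_entry_sum _) _.
  apply: (@le_lt_trans _ _ (\sum_(i < 4) \sum_(j < 4) (e / 17))).
    by apply: ler_sum => i _; apply: ler_sum => j _; rewrite !mxE ltW.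
  rewrite !sumr_const !card_ord -mulrnA -[X in X < _]mulr_natr; lra.
apply/(continuous_cplxP (fun q => f q i j)) => e /h; apply: filter_app; apply: nearW => q.
by apply: le_lt_trans; have := opnorm_entry (f q - f p) i j; rewrite !mxE.
Qed.

Lemma continuous_Rp (T : topologicalType) (g : T -> R) (p : T) :
  g @ p --> g p <-> forall e : R, 0 < e -> \forall q \near p, `|g q - g p| < e.
Proof.
split=> [/cvgrPdist_lt h e /h|h]; last apply/cvgrPdist_lt => e /h;
  by apply: filter_app; apply: nearW => q; rewrite distrC.
Qed.

Lemma continuous_realC (T : topologicalType) (g : T -> R) (p : T) :
  g @ p --> g p -> (fun q => (g q)%:C : C) @ p --> ((g p)%:C : C).
Proof.
move=> /continuous_Rp h; apply/(@continuous_cplxP _ (fun q => (g q)%:C : C)) => e /h.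
by apply: filter_app; apply: nearW => q; rewrite -rmorphB /= cabs_real.
Qed.

Definition dx1 (p : Dom) : R := \val p.1.1.1.
Definition dx2 (p : Dom) : R := \val p.1.1.2.
Definition dz1 (p : Dom) : C := \val p.1.2.
Definition dz2 (p : Dom) : C := \val p.2.

Let val_continuous (T : topologicalType) (X : set T) : continuous (\val : X -> T).
Proof. exact: initial_continuous. Qed.

Lemma dx1_continuous : continuous dx1.
Proof.
move=> p; apply: (@continuous_comp _ _ _ (fun p : Dom => p.1.1.1) \val); last exact: val_continuous.
by apply: (@continuous_comp _ _ _ (fun p : Dom => p.1.1) fst);
  [apply: (@continuous_comp _ _ _ (fun p : Dom => p.1) fst)|]; exact: cvg_fst.
Qed.

Lemma dx2_continuous : continuous dx2.
Proof.
move=> p; apply: (@continuous_comp _ _ _ (fun p : Dom => p.1.1.2) \val); last exact: val_continuous.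
apply: (@continuous_comp _ _ _ (fun p : Dom => p.1.1) snd); last exact: cvg_snd.
by apply: (@continuous_comp _ _ _ (fun p : Dom => p.1) fst); exact: cvg_fst.
Qed.

Lemma dz1_continuous : continuous dz1.
Proof.
move=> p; apply: (@continuous_comp _ _ _ (fun p : Dom => p.1.2) \val); last exact: val_continuous.
by apply: (@continuous_comp _ _ _ (fun p : Dom => p.1) snd); [exact: cvg_fst|exact: cvg_snd].
Qed.

Lemma dz2_continuous : continuous dz2.
Proof.
by move=> p; apply: (@continuous_comp _ _ _ (fun p : Dom => p.2) \val);
  [exact: cvg_snd|exact: val_continuous].
Qed.

Lemma dx1_itv p : 0 <= dx1 p <= 1/2.
Proof. by rewrite /dx1; case: (p.1.1.1) => x /= /set_mem; rewrite /Ihalf /= in_itv. Qed.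

Lemma dx2_itv p : 0 <= dx2 p <= 1/2.
Proof. by rewrite /dx2; case: (p.1.1.2) => x /= /set_mem; rewrite /Ihalf /= in_itv. Qed.

Lemma dz1_norm p : `|dz1 p| = 1.
Proof. by rewrite /dz1; case: (p.1.2) => x /= /set_mem. Qed.

Lemma dz2_norm p : `|dz2 p| = 1.
Proof. by rewrite /dz2; case: (p.2) => x /= /set_mem. Qed.

Lemma clamp_in (x : R) : Num.max 0 (Num.min x (1/2)) \in @Ihalf R.
Proof.
apply/mem_set; rewrite /Ihalf /= in_itv /= le_max lexx /= ge_max divr_ge0//=.
by rewrite ge_min lexx orbT.
Qed.

(** A continuous retraction of the line, which exhibits the subtype as the image of a compact
    segment. *)
Definition clamp (x : R) : @Ihalf R :=
  exist (fun y => y \in @Ihalf R) _ (clamp_in x).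

Lemma compact_Ihalf : compact [set: @Ihalf R].
Proof.
have -> : [set: @Ihalf R] = [set clamp x | x in `[0, 1/2]].
  apply/seteqP; split=> // -[x hx] _; have := set_mem hx; rewrite /Ihalf /= => xI.
  exists x => //; apply/val_inj => /=; move: xI; rewrite in_itv /= => /andP[x0 x1].
  by rewrite min_l// max_r.
apply: continuous_compact; last exact: segment_compact.
apply: continuous_subspaceT; apply: continuous_comp_initial => x.
suff h : (fun x : R => Num.max 0 (Num.min x (1/2))) @ x --> Num.max 0 (Num.min x (1/2)).
  exact: h.
apply/(@continuous_Rp _ (fun x : R => Num.max 0 (Num.min x (1/2)))) => e e0.
have : \forall y \near x, `|y - x| < e.
  by apply: (proj1 (@continuous_Rp _ id x)) e0; exact: cvg_id.
apply: filterS => y /=; apply: le_lt_trans.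
have := ler_norm (y - x); have := ler_norm (x - y); rewrite (distrC x) ler_norml.
move: `|_| => t h1 h2; rewrite /Num.max /Num.min.
by case: (ltP y); case: (ltP x) => ? ?; case: ltP => ?; case: ltP => ?;
  apply/andP; split; lra.
Qed.

Lemma compact_S1 : compact [set: @S1 R].
Proof.
have -> : [set: @S1 R] = [set z_exp phi | phi in `[0, 2 * pi]].
  apply/seteqP; split=> // -[z hz] _; have /= z1 := set_mem hz.
  by have [phi hphi zE] := expi_surj z1; exists phi => //; apply/val_inj.
apply: continuous_compact; last exact: segment_compact.
apply: continuous_subspaceT; apply: continuous_comp_initial => x.
suff h : @expi R @ x --> expi x by exact: h.
apply/(@continuous_cplxP _ (@expi R)) => e e0.
have e2 : 0 < e / 2 by rewrite divr_gt0.
have /continuous_Rp/(_ _ e2) hc := @continuous_cos R x.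
have /continuous_Rp/(_ _ e2) hs := @continuous_sin R x.
near=> y; have -> : expi y - expi x = (cos y - cos x)%:C + 'i%C * (sin y - sin x)%:C :> C.
  by rewrite /expi; simpc.
rewrite (le_lt_trans (cabsD _ _))// cabsM !cabs_real.
have -> : cabs ('i%C : C) = 1 by rewrite cabs_sqrt /= expr0n expr1n add0r sqrtr1.
by rewrite mul1r [e]splitr ltrD//; near: y.
Unshelve. all: by end_near.
Qed.

Lemma compact_Dom : compact [set: Dom].
Proof.
have h (U V : topologicalType) : compact [set: U] -> compact [set: V] ->
    compact [set: U * V].
  by move=> cU cV; rewrite -setXTT; exact: compact_setX.
by apply: (h _ _ (h _ _ (h _ _ _ _) _) _);
  [exact: compact_Ihalf|exact: compact_Ihalf|exact: compact_S1|exact: compact_S1].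
Qed.

End DomTopology.

(** * The boundary conditions as commutation relations *)

Section Matrices.
Context {R : realType}.
Local Notation C := (Cplx R).
Local Notation M2 := 'M[Cplx R]_2.
Local Notation M4 := 'M[Cplx R]_4.
Implicit Types (a b c d : C).

Lemma mx22E (M : M2) : M = mx22 (M 0 0) (M 0 1) (M 1 0) (M 1 1).
Proof.
by apply/matrixP => i j; rewrite mxE; case: i => [[|[|//]] ?]; case: j => [[|[|//]] ?] /=;
  congr (M _ _); apply/val_inj.
Qed.

Lemma mx22_mul a b c d a' b' c' d' : mx22 a b c d *m mx22 a' b' c' d' =
  mx22 (a * a' + b * c') (a * b' + b * d') (c * a' + d * c') (c * b' + d * d').
Proof.
apply/matrixP => i j; rewrite !mxE !big_ord_recl big_ord0 addr0 !mxE.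
by case: i => [[|[|//]] ?]; case: j => [[|[|//]] ?].
Qed.

Lemma mx22D a b c d a' b' c' d' : mx22 a b c d + mx22 a' b' c' d' =
  mx22 (a + a') (b + b') (c + c') (d + d').
Proof.
apply/matrixP => i j; rewrite !mxE.
by case: i => [[|[|//]] ?]; case: j => [[|[|//]] ?].
Qed.

Lemma mx22N a b c d : - mx22 a b c d = mx22 (- a) (- b) (- c) (- d).
Proof.
apply/matrixP => i j; rewrite !mxE.
by case: i => [[|[|//]] ?]; case: j => [[|[|//]] ?].
Qed.

Lemma mx22Z k a b c d : k *: mx22 a b c d = mx22 (k * a) (k * b) (k * c) (k * d).
Proof.
apply/matrixP => i j; rewrite !mxE.
by case: i => [[|[|//]] ?]; case: j => [[|[|//]] ?].
Qed.

Lemma mx22_adj a b c d :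
  (mx22 a b c d)^t* = mx22 (a^*)%R (c^*)%R (b^*)%R (d^*)%R.
Proof.
apply/matrixP => i j; rewrite !mxE.
by case: i => [[|[|//]] ?]; case: j => [[|[|//]] ?].
Qed.

Lemma mx22_scalar a : a%:M = mx22 a 0 0 a :> M2.
Proof.
apply/matrixP => i j; rewrite !mxE.
by case: i => [[|[|//]] ?]; case: j => [[|[|//]] ?].
Qed.

Lemma mx22_inj a b c d a' b' c' d' : mx22 a b c d = mx22 a' b' c' d' ->
  [/\ a = a', b = b', c = c' & d = d'].
Proof.
move=> /matrixP h; split.
- by have := h 0 0; rewrite !mxE.
- by have := h 0 1; rewrite !mxE.
- by have := h 1 0; rewrite !mxE.
- by have := h 1 1; rewrite !mxE.
Qed.

Lemma kronE (A B : M2) i j k l :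
  kron A B (@mxtens_index 2 2 (i, j)) (@mxtens_index 2 2 (k, l)) = A i k * B j l.
Proof. exact: tensmxE. Qed.

Lemma kronM (A B A' B' : M2) : kron A B *m kron A' B' = kron (A *m A') (B *m B').
Proof. exact: (@tensmx_mul (Cplx R) 2 2 2 2 2 2 A B A' B'). Qed.

Lemma adjB (M N : M4) : (M - N)^t* = M^t* - N^t*.
Proof. by apply/matrixP => i j; rewrite !mxE rmorphB. Qed.

Lemma kron_eqP (M N : M4) : (forall i j k l : 'I_2,
  M (@mxtens_index 2 2 (i, j)) (@mxtens_index 2 2 (k, l)) =
  N (@mxtens_index 2 2 (i, j)) (@mxtens_index 2 2 (k, l))) -> M = N.
Proof.
move=> h; apply/matrixP => x y; case: (@mxtens_indexP 2 2 x) => i j.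
by case: (@mxtens_indexP 2 2 y) => k l.
Qed.

Lemma kronDl (A A' B : M2) : kron (A + A') B = kron A B + kron A' B.
Proof. by apply: kron_eqP => i j k l; rewrite [RHS]mxE !kronE mxE mulrDl. Qed.

Lemma kronDr (A B B' : M2) : kron A (B + B') = kron A B + kron A B'.
Proof. by apply: kron_eqP => i j k l; rewrite [RHS]mxE !kronE mxE mulrDr. Qed.

Lemma kronZl k (A B : M2) : kron (k *: A) B = k *: kron A B.
Proof. by apply: kron_eqP => i j m l; rewrite [RHS]mxE !kronE mxE mulrA. Qed.

Lemma kronZr k (A B : M2) : kron A (k *: B) = k *: kron A B.
Proof. by apply: kron_eqP => i j m l; rewrite [RHS]mxE !kronE mxE mulrCA. Qed.

Lemma kronNl (A B : M2) : kron (- A) B = - kron A B.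
Proof. by rewrite -scaleN1r kronZl scaleN1r. Qed.

Lemma kronNr (A B : M2) : kron A (- B) = - kron A B.
Proof. by rewrite -scaleN1r kronZr scaleN1r. Qed.

Lemma kron0l (B : M2) : kron 0 B = 0.
Proof. by apply: kron_eqP => i j k l; rewrite kronE !mxE mul0r. Qed.

Lemma kron11 : kron 1%:M 1%:M = 1%:M :> M4.
Proof.
apply: kron_eqP => i j k l; rewrite kronE !mxE -natrM mulnb.
by rewrite (can_eq (@mxtens_indexK 2 2)) xpair_eqE.
Qed.

Lemma kron_adj (A B : M2) : (kron A B)^t* = kron (A^t* ) (B^t* ).
Proof.
apply: kron_eqP => i j k l; rewrite kronE [LHS]mxE [X in _ X = _]mxE kronE rmorphM.
by rewrite !mxE.
Qed.

Lemma kron_T (A B : M2) : Tmx R *m kron A B = kron B A *m Tmx R.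
Proof.
apply: kron_eqP => i j k l; rewrite !mxE.
rewrite (bigD1 (@mxtens_index 2 2 (j, i)))//= big1 ?addr0; last first.
  move=> m; case: (@mxtens_indexP 2 2 m) => i' j' ne; rewrite mxE !mxtens_indexK /=.
  by case: eqP => [[e1 e2]|]; [rewrite e1 e2 eqxx in ne|rewrite mul0r].
rewrite (bigD1 (@mxtens_index 2 2 (l, k)))//= big1 ?addr0; last first.
  move=> m; case: (@mxtens_indexP 2 2 m) => i' j' ne; rewrite [Tmx R _ _]mxE !mxtens_indexK /=.
  by case: eqP => [[e1 e2]|]; [rewrite e1 e2 eqxx in ne|rewrite mulr0].
by rewrite [Tmx R _ _]mxE [Tmx R _ _]mxE !mxtens_indexK /= !eqxx mul1r mulr1 !kronE mulrC.
Qed.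

Lemma Tmx_sqr : Tmx R *m Tmx R = 1%:M.
Proof.
apply: kron_eqP => i j k l; rewrite !mxE (bigD1 (@mxtens_index 2 2 (j, i)))//= big1 ?addr0.
  rewrite !mxE !mxtens_indexK /= eqxx mul1r !xpair_eqE andbC.
  by rewrite (can_eq (@mxtens_indexK 2 2)) xpair_eqE.
move=> m; case: (@mxtens_indexP 2 2 m) => i' j' ne; rewrite mxE !mxtens_indexK /=.
by case: eqP => [[e1 e2]|]; [rewrite e1 e2 eqxx in ne|rewrite mul0r].
Qed.

Lemma Tmx_adj : (Tmx R)^t* = Tmx R.
Proof.
apply: kron_eqP => i j k l; rewrite !mxE !mxtens_indexK /= conjC_nat.
by rewrite !xpair_eqE andbC (eq_sym k) (eq_sym l).
Qed.

Definition Zmx : M2 := mx22 1 0 0 (-1).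
Definition nmx (z : C) : M2 := mx22 0 z 1 0.
Definition comm4 (M N : M4) := M *m N = N *m M.

Lemma one_adj : (1%:M : M2)^t* = 1%:M.
Proof. by rewrite mx22_scalar mx22_adj conjC0 conjC1. Qed.

Lemma Zmx_adj : Zmx^t* = Zmx.
Proof. by rewrite /Zmx mx22_adj !conjC0 conjC1 rmorphN1. Qed.

Lemma Zmx_sqr : Zmx *m Zmx = 1%:M.
Proof. by rewrite /Zmx mx22_mul mx22_scalar; congr mx22; ring. Qed.

Lemma kronZ1_block : kron Zmx 1%:M = @block_mx _ 2 2 2 2 1%:M 0 0 (- 1%:M).
Proof.
apply: kron_eqP => i j k l; rewrite kronE.
have e0 m : @mxtens_index 2 2 (0, m) = lshift 2 m by exact/val_inj.
have e1 m : @mxtens_index 2 2 (1, m) = rshift 2 m by exact/val_inj.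
have o2 (m : 'I_2) : m = 0 \/ m = 1.
  by case: m => [[|[|//]] ?]; [left|right]; exact/val_inj.
have [->|->] := o2 i; have [->|->] := o2 k; rewrite ?e0 ?e1.
- by rewrite (@block_mxEul _ 2 2 2 2) !mxE mul1r.
- by rewrite (@block_mxEur _ 2 2 2 2) !mxE mul0r.
- by rewrite (@block_mxEdl _ 2 2 2 2) !mxE mul0r.
- by rewrite (@block_mxEdr _ 2 2 2 2) !mxE mulN1r.
Qed.

(** Commuting with [diag(1, 1, -1, -1)] forces the off-diagonal blocks to equal their negatives.
    Unlike a block shape, a commutation relation can be carried through the conjugation by [nu1] or
    [nu2]. *)
Lemma in_M2_plus_M2P (M : M4) : in_M2_plus_M2 M <-> comm4 M (kron Zmx 1%:M).
Proof.
rewrite /comm4 kronZ1_block; split=> [[B1 [B2 ->]]|].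
  by rewrite !(@mulmx_block _ 2 2 2 2 2 2) !(mulmx0, mul0mx, mulmxN, mulNmx, mulmx1, mul1mx, addr0, add0r).
move: M; rewrite [4%N]/(2 + 2)%N => M.
rewrite -{1 2}(submxK M) !(@mulmx_block _ 2 2 2 2 2 2).
rewrite !(mulmx0, mul0mx, mulmxN, mulNmx, mulmx1, mul1mx, addr0, add0r).
move=> /eq_block_mx[_ h1 h2 _].
have z (N : 'M[C]_2) : - N = N -> N = 0.
  move=> /eqP; rewrite eq_sym -addr_eq0 -mulr2n -scaler_nat scaler_eq0 pnatr_eq0 /=.
  by move/eqP.
exists (ulsubmx M), (drsubmx M).
by rewrite -{1}(submxK M) (z _ h1) (z _ (esym h2)).
Qed.

Lemma unitary_conj_comm (U M D : M4) : U *m U^t* = 1%:M ->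
  comm4 (U^t* *m M *m U) D <-> comm4 M (U *m D *m U^t* ).
Proof.
move=> U1; have U2 : U^t* *m U = 1%:M by exact: mulmx1C.
rewrite /comm4; split=> h.
- have {}h : U *m (U^t* *m M *m U *m D) *m U^t* = U *m (D *m (U^t* *m M *m U)) *m U^t*.
    by rewrite h.
  have e1 : U *m (U^t* *m M *m U *m D) *m U^t* = M *m (U *m D *m U^t* ).
    by rewrite !mulmxA U1 mul1mx.
  by rewrite -e1 h !mulmxA -(mulmxA _ U) U1 mulmx1.
- have {}h : U^t* *m (M *m (U *m D *m U^t* )) *m U = U^t* *m (U *m D *m U^t* *m M) *m U.
    by rewrite h.
  have e1 : U^t* *m (M *m (U *m D *m U^t* )) *m U = U^t* *m M *m U *m D.
    by rewrite !mulmxA -(mulmxA _ _ U) U2 mulmx1.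
  by rewrite -e1 h !mulmxA U2 mul1mx.
Qed.

Lemma comm4Z k (M N : M4) : k != 0 -> comm4 M (k *: N) <-> comm4 M N.
Proof.
move=> k0; rewrite /comm4 -scalemxAr -scalemxAl; split=> [/(scalerI k0)//|->//].
Qed.

Lemma expi_half (phi : R) : expi phi = expi (phi / 2) * expi (phi / 2).
Proof.
rewrite {1}(splitr phi) /expi cosD sinD; simpc.
by congr (_ +i* _); ring.
Qed.

Lemma expi_conjM (phi : R) : expi phi * (expi phi)^*%R = 1.
Proof. by rewrite -normCK; have /set_mem -> := S1_expi phi; rewrite expr1n. Qed.

(** The conjugate of [Zmx] by [Vmx phi], equal to [nmx (expi phi)] up to a scalar of modulus 1. *)
Let pmx (phi : R) : M2 := mx22 0 (expi (phi / 2)) (expi (phi / 2))^*%R 0.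

Let sqrt2 : ((Num.sqrt 2)^-1%:C : C) * ((Num.sqrt 2)^-1%:C)^*%R = (2^-1 : R)%:C.
Proof. by rewrite conj_realC -rmorphM /= -invfM -expr2 sqr_sqrtr. Qed.

Let half2 (c : C) : (2^-1 : R)%:C * (c + c) = c.
Proof. by rewrite -mulr2n -(mulr_natl c) mulrA -(@natC R 2) -rmorphM /= mulVf ?mul1r// pnatr_eq0. Qed.

Lemma Vmx_unitary (phi : R) : Vmx phi *m (Vmx phi)^t* = 1%:M.
Proof.
rewrite /Vmx mx22Z mx22_adj mx22_mul mx22_scalar !rmorphM !rmorphN !rmorph1 /=.
have e1 := expi_conjM (phi / 2); set e := expi (phi / 2) in e1 *.
set r := ((Num.sqrt 2)^-1%:C : C); have r2 : r * r^*%R = (2^-1 : R)%:C by exact: sqrt2.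
congr mx22.
- rewrite -[RHS]half2 -r2 -{1 2}e1; ring.
- ring.
- ring.
- rewrite -[RHS]half2 -r2; ring.
Qed.

Lemma Vmx_conjZ (phi : R) : Vmx phi *m Zmx *m (Vmx phi)^t* = pmx phi.
Proof.
rewrite /Vmx /Zmx mx22Z mx22_adj !mx22_mul /pmx !rmorphM !rmorphN !rmorph1 /=.
set e := expi (phi / 2).
set r := ((Num.sqrt 2)^-1%:C : C); have r2 : r * r^*%R = (2^-1 : R)%:C by exact: sqrt2.
congr mx22.
- ring.
- rewrite -[RHS]half2 -r2; ring.
- rewrite -[RHS]half2 -r2; ring.
- ring.
Qed.

Lemma Vmx_conjX (phi : R) : Vmx phi *m mx22 0 1 1 0 *m (Vmx phi)^t* = - Zmx.
Proof.
rewrite /Vmx /Zmx mx22Z mx22_adj !mx22_mul mx22N !rmorphM !rmorphN !rmorph1 /=.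
have e1 := expi_conjM (phi / 2); set e := expi (phi / 2) in e1 *.
set r := ((Num.sqrt 2)^-1%:C : C); have r2 : r * r^*%R = (2^-1 : R)%:C by exact: sqrt2.
congr mx22.
- have m1 : -1 = - (e * e^*%R) by rewrite e1.
  rewrite m1 -[RHS]half2 -r2; ring.
- ring.
- ring.
- rewrite -[RHS]half2 -r2; ring.
Qed.

(** Conjugation by [Vmx phi] takes the flip to [- Zmx] for every [phi], so [Wmx] is constant in its
    argument. *)
Lemma WmxE (phi : R) : Wmx phi = kron (mx22 1 0 0 0) 1%:M - kron (mx22 0 0 0 1) Zmx.
Proof.
rewrite /Wmx /Smx mulmxDr mulmxDl !kronM !mul1mx !mulmx1.
have -> : mx22 1 0 0 1 = 1%:M :> M2 by rewrite mx22_scalar.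
by rewrite mulmx1 Vmx_unitary Vmx_conjX kronNr.
Qed.

Let Wmx_sa (phi : R) : (Wmx phi)^t* = Wmx phi.
Proof.
by rewrite WmxE adjB !kron_adj one_adj Zmx_adj !mx22_adj !conjC0 !conjC1.
Qed.

Let Wmx_sqr (phi : R) : Wmx phi *m Wmx phi = 1%:M.
Proof.
have z : mx22 0 0 0 0 = 0 :> M2 by rewrite -mx22_scalar -scalemx1 scale0r.
rewrite WmxE mulmxBl !mulmxBr !kronM Zmx_sqr mulmx1 mul1mx !mx22_mul.
rewrite !(mul0r, mulr0, mul1r, addr0, add0r) z !kron0l subr0 sub0r opprK -kronDl.
by rewrite mx22D !(addr0, add0r) -mx22_scalar kron11.
Qed.

Let kronV_unitary (phi : R) : kron (Vmx phi) 1%:M *m (kron (Vmx phi) 1%:M)^t* = 1%:M.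
Proof.
by rewrite kron_adj one_adj kronM Vmx_unitary mul1mx kron11.
Qed.

Let kronV_conjZ (phi : R) :
  kron (Vmx phi) 1%:M *m kron Zmx 1%:M *m (kron (Vmx phi) 1%:M)^t* = kron (pmx phi) 1%:M.
Proof.
by rewrite kron_adj one_adj !kronM Vmx_conjZ !mul1mx.
Qed.

Lemma nu1_unitary (phi1 phi2 : R) : nu1 phi1 phi2 *m (nu1 phi1 phi2)^t* = 1%:M.
Proof.
rewrite /nu1 adjM Wmx_sa; move: (Wmx_sqr phi2) (kronV_unitary phi1).
move: (Wmx phi2) (kron (Vmx phi1) 1%:M) => W V W2 V1.
by rewrite mulmxA -(mulmxA W) V1 mulmx1.
Qed.

(** [pmx phi1] is off-diagonal, so each of its entries meets the block [1] of [Wmx] on one side and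
    the block [- Zmx] on the other. *)
Lemma nu1_conj (phi1 phi2 : R) :
  nu1 phi1 phi2 *m kron Zmx 1%:M *m (nu1 phi1 phi2)^t* = - kron (pmx phi1) Zmx.
Proof.
transitivity (Wmx phi2 *m kron (pmx phi1) 1%:M *m Wmx phi2).
  rewrite /nu1 adjM Wmx_sa -kronV_conjZ.
  by move: (Wmx phi2) (kron (Vmx phi1) 1%:M) (kron Zmx 1%:M) => W V D; rewrite !mulmxA.
have z : mx22 0 0 0 0 = 0 :> M2 by rewrite -mx22_scalar -scalemx1 scale0r.
rewrite WmxE mulmxBl !kronM mul1mx mulmx1 mulmxBl !mulmxBr !kronM Zmx_sqr.
rewrite !(mul1mx, mulmx1) /pmx !mx22_mul !(mul0r, mulr0, mul1r, mulr1, addr0, add0r).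
by rewrite z !kron0l !(subr0, sub0r) -opprD -kronDl mx22D !(addr0, add0r).
Qed.

Lemma nu2_unitary (phi2 : R) : nu2 phi2 *m (nu2 phi2)^t* = 1%:M.
Proof.
rewrite /nu2 adjM Tmx_adj; move: (kronV_unitary phi2) Tmx_sqr.
move: (Tmx R) (kron (Vmx phi2) 1%:M) => W V V1 W2.
by rewrite mulmxA -(mulmxA W) V1 mulmx1.
Qed.

Lemma nu2_conj (phi2 : R) :
  nu2 phi2 *m kron Zmx 1%:M *m (nu2 phi2)^t* = kron 1%:M (pmx phi2).
Proof.
transitivity (Tmx R *m kron (pmx phi2) 1%:M *m Tmx R).
  rewrite /nu2 adjM Tmx_adj -kronV_conjZ.
  by move: (Tmx R) (kron (Vmx phi2) 1%:M) (kron Zmx 1%:M) => W V D; rewrite !mulmxA.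
by rewrite kron_T -mulmxA Tmx_sqr mulmx1.
Qed.

Let nmx_pmx (phi : R) : nmx (expi phi) = expi (phi / 2) *: pmx phi.
Proof. by rewrite /pmx mx22Z expi_conjM !mulr0 -expi_half. Qed.

Let expi_neq0 (phi : R) : expi phi != 0.
Proof.
apply/eqP => e0; have := expi_conjM phi; rewrite e0 mul0r => /esym/eqP.
by rewrite oner_eq0.
Qed.

Lemma nu1P (phi1 phi2 : R) (M : M4) :
  in_M2_plus_M2 ((nu1 phi1 phi2)^t* *m M *m nu1 phi1 phi2) <->
  comm4 M (kron (nmx (expi phi1)) Zmx).
Proof.
rewrite in_M2_plus_M2P unitary_conj_comm ?nu1_unitary// nu1_conj nmx_pmx kronZl.
by rewrite comm4Z// -scaleN1r comm4Z// oppr_eq0 oner_eq0.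
Qed.

Lemma nu2P (phi2 : R) (M : M4) :
  in_M2_plus_M2 ((nu2 phi2)^t* *m M *m nu2 phi2) <->
  comm4 M (kron 1%:M (nmx (expi phi2))).
Proof.
rewrite in_M2_plus_M2P unitary_conj_comm ?nu2_unitary// nu2_conj nmx_pmx kronZr.
by rewrite comm4Z.
Qed.

(* Points of [Dom] that the two boundary conditions at [0] identify. *)
Definition same_base (p q : Dom R) := [/\ dx1 p = dx1 q, dx2 p = dx2 q,
  dx1 p = 0 \/ dz1 p = dz1 q & dx2 p = 0 \/ dz2 p = dz2 q].

(** The commutation relations involve the angles only through [expi], and every point of the circle
    has an angle in [[0, 2 * pi]]; conditions on angles thus become conditions at points of the
    domain. *)
Lemma boundary_algebraP (f : Dom R -> M4) : boundary_algebra R f <->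
  [/\ continuous f,
    forall p q, same_base p q -> f p = f q,
    forall p, dx1 p = 1/2 -> comm4 (f p) (kron (nmx (dz1 p)) Zmx) &
    forall p, dx2 p = 1/2 -> comm4 (f p) (kron 1%:M (nmx (dz2 p)))].
Proof.
have expS (z : @S1 R) : exists2 phi, phi \in `[0, 2 * pi] & z = z_exp phi.
  have /= z1 := set_mem (valP z).
  by have [phi h e] := expi_surj z1; exists phi => //; apply/val_inj.
split=> [[cf f1 f2 f3 f4]|[cf ff f3 f4]]; split=> //.
- move=> [[[x1 x2] z1] z2] [[[y1 y2] w1] w2] [/val_inj/= -> /val_inj/= ->] /= h1 h2.
  have -> : f (y1, y2, z1, z2) = f (y1, y2, w1, z2).
    case: h1 => [y10|/val_inj/= ->//].
    have -> : y1 = x_zero R by exact/val_inj.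
    by rewrite f1 [RHS]f1.
  case: h2 => [y20|/val_inj/= ->//].
  have -> : y2 = x_zero R by exact/val_inj.
  by rewrite f2 [RHS]f2.
- move=> [[[x1 x2] z1] z2] /= x1h; have -> : x1 = x_half R by exact/val_inj.
  have [phi1 h1 ->] := expS z1; have [phi2 h2 ->] := expS z2.
  exact/(nu1P phi1 phi2)/f3.
- move=> [[[x1 x2] z1] z2] /= x2h; have -> : x2 = x_half R by exact/val_inj.
  have [phi1 h1 ->] := expS z1; have [phi2 h2 ->] := expS z2.
  exact/nu2P/f4.
- by move=> x2 z1 z2; apply: ff; split=> //=; [left|right].
- by move=> x1 z1 z2; apply: ff; split=> //=; [right|left].
- by move=> x2 phi1 phi2 _ _; apply/nu1P/(f3 (_, _, _, _)).
- by move=> x1 phi1 phi2 _ _; apply/nu2P/(f4 (_, _, _, _)).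
Qed.

End Matrices.

(* Otherwise unification unfolds the suprema when it compares two norms. *)
#[local] Opaque opnorm.

(** * Closure of the function algebra under algebraic operations and uniform limits *)

Section BoundaryClosure.
Context {R : realType}.
Local Notation C := (Cplx R).
Local Notation M4 := 'M[Cplx R]_4.
Local Notation F := (boundary_algebra R).
Implicit Types f g : Dom R -> M4.

Let commD (M M' N : M4) : comm4 M N -> comm4 M' N -> comm4 (M + M') N.
Proof. by rewrite /comm4 mulmxDl mulmxDr => -> ->. Qed.

Let commM (M M' N : M4) : comm4 M N -> comm4 M' N -> comm4 (M *m M') N.
Proof. by rewrite /comm4 => h h'; rewrite -mulmxA h' mulmxA h mulmxA. Qed.

(** The adjoint of a commutation relation concerns [N^t*]; for [nmx z] with [z] on the circle this
    is a scalar multiple of the original matrix. *)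
Let comm_adj (M N : M4) k : N^t* = k *: N -> comm4 M N -> comm4 (M^t* ) N.
Proof.
move=> Nk h; have /(congr1 (fun X : M4 => X^t* )) : comm4 M (N^t* ).
  by rewrite Nk /comm4 -scalemxAl -scalemxAr h.
by rewrite /comm4 /= !adjM trmxCK => <-.
Qed.

Let nmx_adj (z : C) : `|z| = 1 -> (nmx z)^t* = (z^*)%R *: nmx z.
Proof.
move=> z1; rewrite /nmx mx22_adj mx22Z !conjC0 conjC1 !mulr0 mulr1.
by rewrite [(z^* * z)%R]mulrC -normCK z1 expr1n.
Qed.

Let opnorm_bound (M : M4) : exists2 m : R, 0 < m & opnorm M + 1 <= m.
Proof.
exists (opnorm M + 1); last exact: lexx.
by apply: ltr_wpDl; [exact: opnorm_ge0|exact: ltr01].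
Qed.

Lemma boundary_scalar (c : C) : F (fun=> c%:M).
Proof.
apply/boundary_algebraP; split=> // [p|p _|p _]; first exact: cst_continuous.
  by rewrite /comm4 scalar_mxC.
by rewrite /comm4 scalar_mxC.
Qed.

Lemma boundary_add f g : F f -> F g -> F (fun p => f p + g p).
Proof.
move=> /boundary_algebraP[cf bf f1 f2] /boundary_algebraP[cg bg g1 g2].
apply/boundary_algebraP; split=> [p|p q pq|p hp|p hp].
- apply/continuous_opnormP => e e0; have e2 : 0 < e / 2 by rewrite divr_gt0.
  have /continuous_opnormP/(_ _ e2) hf := cf p.
  have /continuous_opnormP/(_ _ e2) hg := cg p.
  apply: filterS2 hf hg => q h1 h2; rewrite opprD addrACA.
  by apply: le_lt_trans (opnormD _ _) _; rewrite [ltRHS]splitr; exact: ltrD h1 h2.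
- by rewrite (bf _ _ pq) (bg _ _ pq).
- by apply: commD; [exact: f1|exact: g1].
- by apply: commD; [exact: f2|exact: g2].
Qed.

Lemma boundary_mul f g : F f -> F g -> F (fun p => f p *m g p).
Proof.
move=> /boundary_algebraP[cf bf f1 f2] /boundary_algebraP[cg bg g1 g2].
apply/boundary_algebraP; split=> [p|p q pq|p hp|p hp].
- apply/continuous_opnormP => e e0.
  have [m m0 fm] := opnorm_bound (f p); have [m' m0' gm] := opnorm_bound (g p).
  have ef : 0 < e / 2 / m' by rewrite !divr_gt0.
  have eg : 0 < e / 2 / m by rewrite !divr_gt0.
  have /continuous_opnormP/(_ _ ltr01) hf1 := cf p.
  have /continuous_opnormP/(_ _ ef) hf := cf p.
  have /continuous_opnormP/(_ _ eg) hg := cg p.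
  apply: filterS3 hf1 hf hg => q h1 h2 h3.
  have -> : f q *m g q - f p *m g p = f q *m (g q - g p) + (f q - f p) *m g p.
    by rewrite mulmxBr mulmxBl addrA subrK.
  have fq : opnorm (f q) <= m.
    have := opnormD (f q - f p) (f p); rewrite subrK => /le_trans; apply.
    by rewrite addrC; apply: le_trans fm; exact: lerD (lexx _) (ltW h1).
  have gp : opnorm (g p) <= m' by apply: le_trans gm; rewrite lerDl.
  apply: le_lt_trans (opnormD _ _) _; rewrite [ltRHS]splitr; apply: ltrD.
    apply: le_lt_trans (opnormM _ _) _.
    apply: le_lt_trans (ler_wpM2r (opnorm_ge0 _) fq) _.
    by rewrite mulrC -ltr_pdivlMr; [exact: h3|exact: m0].
  apply: le_lt_trans (opnormM _ _) _.
  apply: le_lt_trans (ler_wpM2l (opnorm_ge0 _) gp) _.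
  by rewrite -ltr_pdivlMr; [exact: h2|exact: m0'].
- by rewrite (bf _ _ pq) (bg _ _ pq).
- by apply: commM; [exact: f1|exact: g1].
- by apply: commM; [exact: f2|exact: g2].
Qed.

Lemma boundary_scale c f : F f -> F (fun p => c *: f p).
Proof.
move=> Ff; have := boundary_mul (boundary_scalar c) Ff.
by congr F; apply/funext => p; rewrite mul_scalar_mx.
Qed.

Lemma boundary_opp f : F f -> F (fun p => - f p).
Proof.
move=> /(boundary_scale (-1)); congr F; apply/funext => p.
by rewrite scaleN1r.
Qed.

Lemma boundary_adj f : F f -> F (fun p => (f p)^t* ).
Proof.
move=> /boundary_algebraP[cf bf f1 f2].
apply/boundary_algebraP; split=> [p|p q pq|p hp|p hp].
- apply/continuous_opnormP => e e0; have /continuous_opnormP/(_ _ e0) := cf p.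
  apply: filterS => q; rewrite -adjB opnorm_adj; exact.
- by rewrite (bf _ _ pq).
- apply: comm_adj (f1 _ hp); rewrite kron_adj Zmx_adj nmx_adj ?dz1_norm// kronZl.
  by [].
- apply: comm_adj (f2 _ hp); rewrite kron_adj one_adj nmx_adj ?dz2_norm// kronZr.
  by [].
Qed.

Lemma boundary_limit (l : Dom R -> M4) :
  (forall e : R, 0 < e -> exists2 f, F f & forall p, opnorm (f p - l p) < e) -> F l.
Proof.
move=> h.
have comm_lim N p : (forall f, F f -> comm4 (f p) N) -> comm4 (l p) N.
  move=> hN; apply/eqP; rewrite -subr_eq0; apply/eqP/opnorm_eq0/eqP.
  rewrite eq_le opnorm_ge0 andbT; apply/ler_addgt0Pr => e e0; rewrite add0r.
  have [m m0 Nm1] := opnorm_bound N.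
  have Nm : opnorm N <= m by apply: le_trans Nm1; rewrite lerDl.
  have e2m : 0 < e / 2 / m by rewrite !divr_gt0.
  have [f Ff /(_ p) hf] := h _ e2m.
  have -> : l p *m N - N *m l p = N *m (f p - l p) - (f p - l p) *m N.
    by rewrite mulmxBr mulmxBl (hN f Ff) opprB [RHS]addrC addrA subrK.
  apply: le_trans (opnormD _ _) _; rewrite opnormN [leRHS]splitr; apply: lerD.
    apply: le_trans (opnormM _ _) _; apply: le_trans (ler_wpM2r (opnorm_ge0 _) Nm) _.
    by rewrite mulrC -ler_pdivlMr; [exact: ltW hf|exact: m0].
  apply: le_trans (opnormM _ _) _; apply: le_trans (ler_wpM2l (opnorm_ge0 _) Nm) _.
  by rewrite -ler_pdivlMr; [exact: ltW hf|exact: m0].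
apply/boundary_algebraP; split=> [p|p q pq|p hp|p hp].
- apply/continuous_opnormP => e e0; have e3 : 0 < e / 3 by rewrite divr_gt0.
  have [f /boundary_algebraP[cf _ _ _] hf] := h _ e3.
  have /continuous_opnormP/(_ _ e3) := cf p; apply: filterS => q hq.
  have -> : l q - l p = (l q - f q) + ((f q - f p) + (f p - l p)).
    by rewrite [(f q - _) + _]addrA subrK addrA subrK.
  have -> : e = e / 3 + (e / 3 + e / 3) by lra.
  apply: le_lt_trans (opnormD _ _) _; apply: ltrD.
    by have := hf q; rewrite -(opnormN (f q - l q)) opprB; exact.
  by apply: le_lt_trans (opnormD _ _) _; exact: ltrD hq (hf p).
- apply/eqP; rewrite -subr_eq0; apply/eqP/opnorm_eq0/eqP.
  rewrite eq_le opnorm_ge0 andbT; apply/ler_addgt0Pr => e e0; rewrite add0r.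
  have e2 : 0 < e / 2 by rewrite divr_gt0.
  have [f /boundary_algebraP[_ bf _ _] hf] := h _ e2.
  have -> : l p - l q = (f q - l q) - (f p - l p).
    by rewrite (bf _ _ pq) opprB [RHS]addrC addrA subrK.
  apply: le_trans (opnormD _ _) _; rewrite opnormN [leRHS]splitr.
  exact: lerD (ltW (hf q)) (ltW (hf p)).
- by apply: comm_lim => f /boundary_algebraP[_ _ f1 _]; exact: f1.
- by apply: comm_lim => f /boundary_algebraP[_ _ _ f2]; exact: f2.
Qed.

Lemma boundary_bounded f : F f -> exists M : R, forall p, opnorm (f p) <= M.
Proof.
move=> /boundary_algebraP[cf _ _ _].
have /compact_near_coveringP/(_ nat \oo (fun n p => opnorm (f p) <= n%:R)) := @compact_Dom R.
case=> [p _|N _ hN]; last by exists N%:R => p; apply: (hN N (leqnn N)).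
have /continuous_opnormP/(_ _ ltr01) hf := cf p.
have hn : \forall n \near \oo, opnorm (f p) + 1 <= n%:R by exact: nbhs_infty_ger.
exists ([set q | opnorm (f q - f p) < 1], [set n | opnorm (f p) + 1 <= n%:R]) => //.
move=> [q n] [/= h1 h2]; have := opnormD (f q - f p) (f p); rewrite subrK => /le_trans.
by apply; rewrite addrC; apply: le_trans h2; exact: lerD (lexx _) (ltW h1).
Qed.

Let supset f := [set opnorm (f p) | p in [set: Dom R]].
Let pt : Dom R := (x_zero R, x_zero R, z_one R, z_one R).

Let supset_has_sup f : F f -> has_sup (supset f).
Proof.
move=> /boundary_bounded[M hM]; split; first by exists (opnorm (f pt)), pt.
by exists M => _ [p _ <-].
Qed.

Lemma opnorm_supnorm f p : F f -> opnorm (f p) <= supnorm f.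
Proof. by move=> /supset_has_sup[_ h]; apply: ub_le_sup => //; exists p. Qed.

Lemma supnorm_le f M : (forall p, opnorm (f p) <= M) -> supnorm f <= M.
Proof.
move=> h; apply: ge_sup; first by exists (opnorm (f pt)), pt.
by move=> _ [p _ <-].
Qed.

Lemma supnorm_ge0 f : F f -> 0 <= supnorm f.
Proof. by move=> Ff; rewrite (le_trans (opnorm_ge0 (f pt)))// opnorm_supnorm. Qed.

Lemma supnorm_complete (u : nat -> Dom R -> M4) : (forall n, F (u n)) ->
  (forall e : R, 0 < e -> exists N, forall m n,
       (N <= m)%N -> (N <= n)%N -> supnorm (fun p => u m p - u n p) < e) ->
  exists2 l, F l & forall e : R, 0 < e -> exists N, forall n,
      (N <= n)%N -> supnorm (fun p => u n p - l p) < e.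
Proof.
move=> Fu cu.
have FB m n : F (fun p => u m p - u n p).
  by apply: boundary_add => //; exact: boundary_opp.
have cR (x : nat -> R) : (forall e : R, 0 < e -> exists N, forall m n,
    (N <= m)%N -> (N <= n)%N -> `|x m - x n| < e) -> cvg (x @ \oo).
  move=> hx; apply/cauchy_cvgP/cauchy_exP => e e0; have [N hN] := hx e e0.
  exists (x N); exists N => // n /= Nn; rewrite -ball_normE /=; exact: hN.
have entry m n p i j : cabs (u m p i j - u n p i j) <= supnorm (fun p => u m p - u n p).
  apply: le_trans (opnorm_supnorm p (FB m n)); have := opnorm_entry (u m p - u n p) i j.
  by rewrite !mxE.
have re_le (c : C) : `|complex.Re c| <= cabs c.
  by rewrite cabs_sqrt -sqrtr_sqr ler_wsqrtr// lerDl sqr_ge0.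
have im_le (c : C) : `|complex.Im c| <= cabs c.
  by rewrite cabs_sqrt -sqrtr_sqr ler_wsqrtr// lerDr sqr_ge0.
have reB (c d : C) : complex.Re c - complex.Re d = complex.Re (c - d) by case: c d => ? ? [].
have imB (c d : C) : complex.Im c - complex.Im d = complex.Im (c - d) by case: c d => ? ? [].
pose xr p i j n := complex.Re (u n p i j); pose xi p i j n := complex.Im (u n p i j).
have cr p i j : cvg (xr p i j @ \oo).
  apply: cR => e /cu[N hN]; exists N => m n hm hn; rewrite reB (le_lt_trans (re_le _))//.
  by rewrite (le_lt_trans (entry _ _ _ _ _))// hN.
have ci p i j : cvg (xi p i j @ \oo).
  apply: cR => e /cu[N hN]; exists N => m n hm hn; rewrite imB (le_lt_trans (im_le _))//.
  by rewrite (le_lt_trans (entry _ _ _ _ _))// hN.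
pose l p : M4 := \matrix_(i, j) (lim (xr p i j @ \oo) +i* lim (xi p i j @ \oo)).
have unif e : 0 < e -> exists N, forall n, (N <= n)%N -> forall p, opnorm (u n p - l p) <= e.
  (* Each of the 16 entries has a real and an imaginary part, so 32 errors of size [e / 33] are
     summed. *)
  move=> e0; have e33 : 0 < e / 33 by rewrite divr_gt0.
  have [N hN] := cu _ e33; exists N => n Nn p.
  have ent m i j : (N <= m)%N -> cabs (u n p i j - u m p i j) <= e / 33.
    by move=> Nm; rewrite (le_trans (entry _ _ _ _ _))// ltW// hN.
  have lr (x : nat -> R) y : cvg (x @ \oo) -> (forall m, (N <= m)%N -> `|y - x m| <= e / 33) ->
      `|y - lim (x @ \oo)| <= e / 33.
    move=> cx hx; have : (fun m => `|y - x m|) @ \oo --> `|y - lim (x @ \oo)|.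
      by apply: cvg_norm; apply: cvgB; [exact: cvg_cst|].
    by move=> h; apply: (ler_cvg_to h (cvg_cst (e / 33))); exists N.
  apply: (le_trans (opnorm_entry_sum _)).
  apply: (@le_trans _ _ (\sum_(i < 4) \sum_(j < 4) (e / 33 + e / 33))); last first.
    rewrite !sumr_const !card_ord -mulrnA -[X in X <= _]mulr_natr; lra.
  apply: ler_sum => i _; apply: ler_sum => j _; rewrite !mxE.
  have h1 : `|complex.Re (u n p i j) - lim (xr p i j @ \oo)| <= e / 33.
    by apply: lr => // m Nm; rewrite reB (le_trans (re_le _))// ent.
  have h2 : `|complex.Im (u n p i j) - lim (xi p i j @ \oo)| <= e / 33.
    by apply: lr => // m Nm; rewrite imB (le_trans (im_le _))// ent.
  case: (u n p i j) h1 h2 => a b /= h1 h2; simpc.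
  have -> : (a - lim (xr p i j @ \oo)) +i* (b - lim (xi p i j @ \oo)) =
      (a - lim (xr p i j @ \oo))%:C + 'i%C * (b - lim (xi p i j @ \oo))%:C :> C by simpc.
  rewrite (le_trans (cabsD _ _))// cabsM !cabs_real.
  have -> : cabs ('i%C : C) = 1 by rewrite cabs_sqrt /= expr0n expr1n add0r sqrtr1.
  by rewrite mul1r lerD.
have Fl : F l.
  apply: boundary_limit => e e0; have e2 : 0 < e / 2 by rewrite divr_gt0.
  have [N hN] := unif _ e2; exists (u N) => // p.
  by rewrite (le_lt_trans (hN N (leqnn N) p))// ltr_pdivrMr// ltr_pMr// ltr1n.
exists l => // e e0; have e2 : 0 < e / 2 by rewrite divr_gt0.
have [N hN] := unif _ e2; exists N => n Nn.
by rewrite (le_lt_trans (supnorm_le (hN n Nn)))// ltr_pdivrMr// ltr_pMr// ltr1n.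
Qed.

End BoundaryClosure.

(** * The C*-algebra of functions and its generators *)

Section BoundaryAlgebra.
Variable R : realType.
Local Notation C := (Cplx R).

Record bdry := Bdry {
  bfun :> Dom R -> 'M[Cplx R]_4;
  bfunP : boundary_algebra R bfun }.

HB.instance Definition _ := gen_eqMixin bdry.
HB.instance Definition _ := gen_choiceMixin bdry.

Lemma bdry_eq (f g : bdry) : (forall p, f p = g p) -> f = g.
Proof.
case: f g => f Ff [g Fg] /= h; have fg : f = g by exact/funext.
by move: Ff; rewrite fg => Ff; congr Bdry; exact: Prop_irrelevance.
Qed.

Definition bdry_add (f g : bdry) := Bdry (boundary_add (bfunP f) (bfunP g)).
Definition bdry_opp (f : bdry) := Bdry (boundary_opp (bfunP f)).
Definition bdry_mul (f g : bdry) := Bdry (boundary_mul (bfunP f) (bfunP g)).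
Definition bdry_scale (c : C) (f : bdry) := Bdry (boundary_scale c (bfunP f)).
Definition bdry_star (f : bdry) := Bdry (boundary_adj (bfunP f)).
Definition bdry_cst (c : C) := Bdry (@boundary_scalar R c).

Let addA : associative bdry_add.
Proof. by move=> f g h; apply: bdry_eq => p /=; rewrite addrA. Qed.
Let addC : commutative bdry_add.
Proof. by move=> f g; apply: bdry_eq => p /=; rewrite addrC. Qed.
Let add0 : left_id (bdry_cst 0) bdry_add.
Proof. by move=> f; apply: bdry_eq => p /=; rewrite -scalemx1 scale0r add0r. Qed.
Let addN : left_inverse (bdry_cst 0) bdry_opp bdry_add.
Proof. by move=> f; apply: bdry_eq => p /=; rewrite -scalemx1 scale0r addNr. Qed.

HB.instance Definition _ := GRing.isZmodule.Build bdry addA addC add0 addN.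

Let mulA : associative bdry_mul.
Proof. by move=> f g h; apply: bdry_eq => p /=; rewrite mulmxA. Qed.
Let mul1 : left_id (bdry_cst 1) bdry_mul.
Proof. by move=> f; apply: bdry_eq => p /=; rewrite mul1mx. Qed.
Let mulr1' : right_id (bdry_cst 1) bdry_mul.
Proof. by move=> f; apply: bdry_eq => p /=; rewrite mulmx1. Qed.
Let mulDl' : left_distributive bdry_mul bdry_add.
Proof. by move=> f g h; apply: bdry_eq => p /=; rewrite mulmxDl. Qed.
Let mulDr' : right_distributive bdry_mul bdry_add.
Proof. by move=> f g h; apply: bdry_eq => p /=; rewrite mulmxDr. Qed.
Let one_neq0 : bdry_cst 1 != bdry_cst 0.
Proof.
apply/eqP => /(congr1 (fun f : bdry => f (x_zero R, x_zero R, z_one R, z_one R) 0 0)).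
by rewrite /= !mxE /= => /eqP; rewrite oner_eq0.
Qed.

HB.instance Definition _ :=
  GRing.Zmodule_isNzRing.Build bdry mulA mul1 mulr1' mulDl' mulDr' one_neq0.

Let scaleA' a b f : bdry_scale a (bdry_scale b f) = bdry_scale (a * b) f.
Proof. by apply: bdry_eq => p /=; rewrite scalerA. Qed.
Let scale1' : left_id 1 bdry_scale.
Proof. by move=> f; apply: bdry_eq => p /=; rewrite scale1r. Qed.
Let scaleDr' : right_distributive bdry_scale +%R.
Proof. by move=> c f g; apply: bdry_eq => p /=; rewrite scalerDr. Qed.
Let scaleDl' f : {morph bdry_scale^~ f : a b / a + b}.
Proof. by move=> a b; apply: bdry_eq => p /=; rewrite scalerDl. Qed.

HB.instance Definition _ :=
  GRing.Zmodule_isLmodule.Build C bdry scaleA' scale1' scaleDr' scaleDl'.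

Let scaleAl (c : C) (f g : bdry) : c *: (f * g) = (c *: f) * g.
Proof. by apply: bdry_eq => p /=; rewrite scalemxAl. Qed.

HB.instance Definition _ := GRing.Lmodule_isLalgebra.Build C bdry scaleAl.

Let scaleAr (c : C) (f g : bdry) : c *: (f * g) = f * (c *: g).
Proof. by apply: bdry_eq => p /=; rewrite scalemxAr. Qed.

HB.instance Definition _ := GRing.Lalgebra_isAlgebra.Build C bdry scaleAr.

Definition bdry_norm (f : bdry) : R := supnorm f.

Let starK' : involutive bdry_star.
Proof. by move=> f; apply: bdry_eq => p /=; rewrite trmxCK. Qed.
Let starD' : {morph bdry_star : f g / f + g}.
Proof.
by move=> f g; apply: bdry_eq => p /=; apply/matrixP => i j; rewrite !mxE rmorphD.
Qed.
Let starZ' (c : C) (f : bdry) : bdry_star (c *: f) = (c^*)%R *: bdry_star f.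
Proof.
by apply: bdry_eq => p /=; apply/matrixP => i j; rewrite !mxE rmorphM.
Qed.
Let starM' (f g : bdry) : bdry_star (f * g) = bdry_star g * bdry_star f.
Proof. by apply: bdry_eq => p /=; rewrite adjM. Qed.
Let norm_eq0 (f : bdry) : bdry_norm f = 0 -> f = 0.
Proof.
move=> f0; apply: bdry_eq => p; rewrite /= -scalemx1 scale0r; apply: opnorm_eq0.
apply: le_anti; rewrite opnorm_ge0 andbT -[leRHS]f0; apply: opnorm_supnorm.
exact: bfunP.
Qed.
Let normZ_le (c : C) (f : bdry) : bdry_norm (c *: f) <= cabs c * bdry_norm f.
Proof.
apply: supnorm_le => p /=; rewrite opnormZ; apply: ler_wpM2l; first exact: cabs_ge0.
exact/opnorm_supnorm/bfunP.
Qed.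
Let normZ (c : C) (f : bdry) : bdry_norm (c *: f) = cabs c * bdry_norm f.
Proof.
apply: le_anti; rewrite normZ_le /=.
have [->|c0] := eqVneq c 0; first by rewrite cabs0 mul0r; exact/supnorm_ge0/bfunP.
have cn : 0 < cabs c.
  by rewrite lt_def cabs_ge0 andbT; apply: contra c0 => /eqP/cabs_eq0->.
have := normZ_le c^-1 (c *: f); rewrite scalerA mulVf// scale1r.
suff -> : cabs c^-1 = (cabs c)^-1 by rewrite -ler_pdivlMl// invrK.
by apply: (mulfI (lt0r_neq0 cn)); rewrite -cabsM divff// cabs1 divff// lt0r_neq0.
Qed.
Let normD (f g : bdry) : bdry_norm (f + g) <= bdry_norm f + bdry_norm g.
Proof.
apply: supnorm_le => p /=; apply: le_trans (opnormD _ _) _.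
by apply: lerD; exact/opnorm_supnorm/bfunP.
Qed.
Let normM (f g : bdry) : bdry_norm (f * g) <= bdry_norm f * bdry_norm g.
Proof.
apply: supnorm_le => p /=; apply: le_trans (opnormM _ _) _.
by apply: ler_pM; rewrite ?opnorm_ge0//; exact/opnorm_supnorm/bfunP.
Qed.
Let norm_star (f : bdry) : bdry_norm (bdry_star f * f) = bdry_norm f ^+ 2.
Proof.
have s0 g : 0 <= bdry_norm g by exact/supnorm_ge0/bfunP.
apply: le_anti; apply/andP; split.
  apply: supnorm_le => p /=; rewrite opnorm_star ler_pXn2r// ?nnegrE ?opnorm_ge0//.
  exact/opnorm_supnorm/bfunP.
rewrite -[leRHS](sqr_sqrtr (s0 _)) ler_pXn2r ?nnegrE ?s0 ?sqrtr_ge0//.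
apply: supnorm_le => p; rewrite -(ler_pXn2r (ltn0Sn 1)) ?nnegrE ?opnorm_ge0 ?sqrtr_ge0//.
rewrite (sqr_sqrtr (s0 _)) -opnorm_star.
exact: (opnorm_supnorm p (bfunP (bdry_star f * f))).
Qed.
Let norm_complete (u : nat -> bdry) :
  (forall e : R, 0 < e -> exists N, forall m n,
     (N <= m)%N -> (N <= n)%N -> bdry_norm (u m - u n) < e) ->
  exists l : bdry, forall e : R, 0 < e -> exists N, forall n,
    (N <= n)%N -> bdry_norm (u n - l) < e.
Proof.
move=> /(supnorm_complete (fun n => bfunP (u n)))[l Fl hl].
by exists (Bdry Fl).
Qed.

HB.instance Definition _ := isCStarAlgebra.Build R bdry starK' starD' starZ' starM'
  norm_eq0 normZ normD normM norm_star norm_complete.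

Lemma bdryD (f g : bdry) p : (f + g) p = f p + g p. Proof. by []. Qed.
Lemma bdryM (f g : bdry) p : (f * g) p = f p *m g p. Proof. by []. Qed.
Lemma bdryZ (c : C) (f : bdry) p : (c *: f) p = c *: f p. Proof. by []. Qed.
Lemma bdryS (f : bdry) p : (star f) p = (f p)^t*. Proof. by []. Qed.
Lemma bdry1 p : (1 : bdry) p = 1%:M. Proof. by []. Qed.
Lemma bdryN (f : bdry) p : (- f) p = - f p. Proof. by []. Qed.
Lemma bdry0 p : (0 : bdry) p = 0.
Proof. by rewrite -[RHS](scale0r 1%:M) scalemx1. Qed.
Lemma cnorm_bdry (f : bdry) : cnorm f = supnorm f. Proof. by []. Qed.

End BoundaryAlgebra.

(** * The two generators of the function algebra *)

Section Generators.
Context {R : realType}.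
Local Notation C := (Cplx R).
Local Notation M2 := 'M[Cplx R]_2.

Definition amx (x : R) (z : C) : M2 :=
  mx22 0 ((Num.sqrt x)%:C * z) (Num.sqrt (1 - x))%:C 0.

Lemma amx_anti x z : amx x z *m Zmx = - (Zmx *m amx x z).
Proof. by rewrite /amx /Zmx !mx22_mul mx22N; congr mx22; ring. Qed.

Lemma amx_half z : amx (1/2) z = (Num.sqrt (1/2) : R)%:C *: nmx z.
Proof.
rewrite /amx /nmx mx22Z !mulr0 mulr1; congr (mx22 0 _ _%:C 0).
by congr Num.sqrt; lra.
Qed.

Lemma amx_adj x z : (amx x z)^t* =
  mx22 0 (Num.sqrt (1 - x))%:C ((Num.sqrt x)%:C * (z^*)%R) 0.
Proof. by rewrite /amx mx22_adj !conjC0 rmorphM /= !conj_realC. Qed.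

Let sqrtC_sqr (x : R) : 0 <= x -> ((Num.sqrt x)%:C : C) * (Num.sqrt x)%:C = x%:C.
Proof. by move=> x0; rewrite -rmorphM /= -expr2 sqr_sqrtr. Qed.

Let conjC_mul1 (z : C) : `|z| = 1 -> (z^*)%R * z = 1.
Proof. by move=> z1; rewrite mulrC -normCK z1 expr1n. Qed.

Lemma amx_star_mul x z : 0 <= x <= 1/2 -> `|z| = 1 ->
  (amx x z)^t* *m amx x z = mx22 (1 - x)%:C 0 0 x%:C.
Proof.
move=> /andP[x0 x1] z1; rewrite amx_adj /amx mx22_mul.
rewrite !(mul0r, mulr0, addr0, add0r) sqrtC_sqr; last lra.
by rewrite mulrACA sqrtC_sqr// conjC_mul1// mulr1.
Qed.

Lemma amx_mul_star x z : 0 <= x <= 1/2 -> `|z| = 1 ->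
  amx x z *m (amx x z)^t* = mx22 x%:C 0 0 (1 - x)%:C.
Proof.
move=> /andP[x0 x1] z1; rewrite amx_adj /amx mx22_mul.
rewrite !(mul0r, mulr0, addr0, add0r) sqrtC_sqr; last lra.
by rewrite mulrACA sqrtC_sqr// [(z * _)%R]mulrC conjC_mul1// mulr1.
Qed.

(** The scalar by which the square of [amx x z] acts. On [[0, 1/2]] the modulus increases from 0 to
    1/2, so these are polar coordinates of a disc, with the circle [x = 0] collapsed to the centre
    exactly as in [same_base]. *)
Definition lam (x : R) (z : C) : C := (Num.sqrt x * Num.sqrt (1 - x))%:C * z.

Lemma amx_sqr x z : amx x z *m amx x z = (lam x z)%:M.
Proof.
rewrite /amx mx22_mul mx22_scalar !(mul0r, mulr0, addr0, add0r) /lam rmorphM /=.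
by congr mx22; ring.
Qed.

Let mx22_continuous (g k : Dom R -> C) (p : Dom R) i j :
  g @ p --> g p -> k @ p --> k p ->
  (fun q => mx22 0 (g q) (k q) 0 i j) @ p --> mx22 0 (g p) (k p) 0 i j.
Proof.
move=> cg ck; rewrite /mx22 mxE; under eq_fun do rewrite mxE.
case: i => [[|[|i]] hi]; last by exfalso.
  case: j => [[|[|j]] hj]; [exact: cvg_cst|exact: cg|by exfalso].
case: j => [[|[|j]] hj]; [exact: ck|exact: cvg_cst|by exfalso].
Qed.

Lemma amx_continuous (x : Dom R -> R) (z : Dom R -> C) (p : Dom R) i j :
  x @ p --> x p -> z @ p --> z p ->
  (fun q => amx (x q) (z q) i j) @ p --> amx (x p) (z p) i j.
Proof.
move=> cx cz.
have cs : (fun q => (Num.sqrt (x q))%:C : C) @ p --> ((Num.sqrt (x p))%:C : C).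
  apply: (@continuous_realC _ _ (fun q => Num.sqrt (x q))).
  by apply: (cvg_comp _ _ cx); exact: sqrt_continuous.
have cs' : (fun q => (Num.sqrt (1 - x q))%:C : C) @ p --> ((Num.sqrt (1 - x p))%:C : C).
  apply: (@continuous_realC _ _ (fun q => Num.sqrt (1 - x q))).
  have c1 : (fun q => 1 - x q) @ p --> 1 - x p by apply: cvgB => //; exact: cvg_cst.
  by apply: (cvg_comp _ _ c1); exact: sqrt_continuous.
apply: (@mx22_continuous (fun q => (Num.sqrt (x q))%:C * z q) (fun q => _%:C)).
  by apply: cvgM; [exact: cs|exact: cz].
exact: cs'.
Qed.

Let gen_boundary1 : boundary_algebra R (fun p => kron (amx (dx1 p) (dz1 p)) 1%:M).
Proof.
apply/boundary_algebraP; split=> [p|p q [e1 e2 h1 h2]|p hp|p hp].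
- apply/continuous_entryP => k l; case: (@mxtens_indexP 2 2 k) => i j.
  case: (@mxtens_indexP 2 2 l) => i' j'.
  under eq_fun do rewrite kronE; rewrite kronE.
  apply: cvgM; last exact: cvg_cst.
  by apply: amx_continuous; [exact: dx1_continuous|exact: dz1_continuous].
- by case: h1 => h; rewrite -e1 /amx h // sqrtr0 !mul0r.
- by rewrite hp amx_half kronZl /comm4 -scalemxAl -scalemxAr !kronM mulmx1 mul1mx.
- by rewrite /comm4 !kronM !mulmx1 !mul1mx.
Qed.

Let gen_boundary2 : boundary_algebra R (fun p => kron Zmx (amx (dx2 p) (dz2 p))).
Proof.
apply/boundary_algebraP; split=> [p|p q [e1 e2 h1 h2]|p hp|p hp].
- apply/continuous_entryP => k l; case: (@mxtens_indexP 2 2 k) => i j.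
  case: (@mxtens_indexP 2 2 l) => i' j'.
  under eq_fun do rewrite kronE; rewrite kronE.
  apply: cvgM; first exact: cvg_cst.
  by apply: amx_continuous; [exact: dx2_continuous|exact: dz2_continuous].
- by case: h2 => h; rewrite -e2 /amx h // sqrtr0 !mul0r.
- rewrite /comm4 !kronM amx_anti kronNr -kronNl; congr (kron _ _).
  by rewrite /Zmx /nmx !mx22_mul mx22N; congr mx22; ring.
- by rewrite hp amx_half kronZr /comm4 -scalemxAl -scalemxAr !kronM mulmx1 mul1mx.
Qed.

Definition bgen1 : bdry R := Bdry gen_boundary1.
Definition bgen2 : bdry R := Bdry gen_boundary2.

Lemma bgen1E p : bgen1 p = kron (amx (dx1 p) (dz1 p)) 1%:M. Proof. by []. Qed.
Lemma bgen2E p : bgen2 p = kron Zmx (amx (dx2 p) (dz2 p)). Proof. by []. Qed.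

Let mx22_sum (x : R) : mx22 (1 - x)%:C 0 0 x%:C + mx22 x%:C 0 0 (1 - x)%:C = 1%:M :> M2.
Proof.
rewrite mx22D mx22_scalar addr0 -!rmorphD /= subrK.
by rewrite [x + _]addrC subrK.
Qed.

Lemma bgen_relations : relations_m1_0 bgen1 bgen2.
Proof.
split; apply: bdry_eq => p.
- rewrite bdryD !bdryM bdryS bgen1E kron_adj one_adj !kronM mulmx1 -kronDl.
  by rewrite amx_star_mul ?amx_mul_star ?dx1_itv ?dz1_norm// mx22_sum kron11.
- rewrite bdryD !bdryM bdryS bgen2E kron_adj Zmx_adj !kronM Zmx_sqr -kronDr.
  by rewrite amx_star_mul ?amx_mul_star ?dx2_itv ?dz2_norm// mx22_sum kron11.
- rewrite bdryN !bdryM bdryS bgen1E bgen2E kron_adj one_adj !kronM mul1mx mulmx1.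
  rewrite -kronNl; congr (kron _ _).
  rewrite amx_adj /Zmx.
  by rewrite !mx22_mul mx22N; congr mx22; ring.
- rewrite bdryD !bdryM bgen1E bgen2E !kronM mul1mx mulmx1 amx_anti kronNl addNr.
  by rewrite bdry0.
Qed.

Lemma bgen_zel1 p : zel bgen1 bgen2 false p = (lam (dx1 p) (dz1 p))%:M.
Proof.
rewrite /zel expr2 bdryM bgen1E kronM amx_sqr mulmx1 -(scalemx1 2 (lam _ _)) kronZl kron11.
by rewrite scalemx1.
Qed.

Lemma bgen_zel2 p : zel bgen1 bgen2 true p = (lam (dx2 p) (dz2 p))%:M.
Proof.
rewrite /zel expr2 bdryM bgen2E kronM amx_sqr Zmx_sqr -(scalemx1 2 (lam _ _)) kronZr kron11.
by rewrite scalemx1.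
Qed.

Let mx22_diff (x : R) :
  mx22 (1 - x)%:C 0 0 x%:C - mx22 x%:C 0 0 (1 - x)%:C = (1 - 2 * x)%:C *: Zmx :> M2.
Proof.
rewrite mx22N mx22D /Zmx mx22Z oppr0 addr0 !mulr0 mulr1 mulrN1 -!rmorphN -!rmorphD /=.
by congr (mx22 _%:C _ _ _%:C); lra.
Qed.

Lemma bgen_del1 p : del bgen1 bgen2 false p = (1 - 2 * dx1 p)%:C *: kron Zmx 1%:M.
Proof.
rewrite /del bdryD bdryN !bdryM bdryS bgen1E kron_adj one_adj !kronM mulmx1.
rewrite -kronNl -kronDl amx_star_mul ?amx_mul_star ?dx1_itv ?dz1_norm// mx22_diff.
by rewrite kronZl.
Qed.

Lemma bgen_del2 p : del bgen1 bgen2 true p = (1 - 2 * dx2 p)%:C *: kron 1%:M Zmx.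
Proof.
rewrite /del bdryD bdryN !bdryM bdryS bgen2E kron_adj Zmx_adj !kronM Zmx_sqr.
rewrite -kronNr -kronDr amx_star_mul ?amx_mul_star ?dx2_itv ?dz2_norm// mx22_diff.
by rewrite kronZr.
Qed.

End Generators.

(** * The norm estimate *)

Section GradedPairs.
Context {R : realType} {B : cStarAlgType R} (b1 b2 : B).
Variables (P : Type) (p0 : P) (sh : bool -> P -> P) (add : P -> P -> P).
Hypothesis add0p : forall p, add p0 p = p.
Hypothesis add_sh : forall i p q, add (sh i p) q = sh i (add p q).
Hypothesis add_shr : forall i p, add p (sh i p0) = sh i p.

(* The pairs consisting of the values of a *-polynomial at [(b1, b2)] and at
   [(bgen1, bgen2)], graded by [P]. *)
Inductive gpair : P -> B -> bdry R -> Prop :=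
| gpair0 p : gpair p 0 0
| gpair_cst (c : Cplx R) : gpair p0 (c *: 1) (c *: 1)
| gpair_add p x y f g : gpair p x f -> gpair p y g -> gpair p (x + y) (f + g)
| gpair_letter i s p x f : gpair p x f ->
    gpair (sh i p) (letter b1 b2 i s * x) (letter bgen1 bgen2 i s * f).

Lemma gpair1 : gpair p0 1 1.
Proof. by have := gpair_cst 1; rewrite !scale1r. Qed.

Lemma gpair_scale p c x f : gpair p x f -> gpair p (c *: x) (c *: f).
Proof.
elim=> {p x f} [p|d|p x y f g _ h1 _ h2|i s p x f _ h].
- by rewrite !scaler0; exact: gpair0.
- by rewrite !scalerA; exact: gpair_cst.
- by rewrite !scalerDr; exact: gpair_add.
- by rewrite !scalerAr; exact: gpair_letter.
Qed.

Lemma gpair_mul p q x y f g : gpair p x f -> gpair q y g ->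
  gpair (add p q) (x * y) (f * g).
Proof.
move=> + hy; elim=> {p x f} [p|d|p x x' f f' _ h1 _ h2|i s p x f _ h].
- by rewrite !mul0r; exact: gpair0.
- by rewrite add0p -!scalerAl !mul1r; exact: gpair_scale.
- by rewrite !mulrDl; exact: gpair_add.
- by rewrite add_sh -!mulrA; exact: gpair_letter.
Qed.

Lemma gpair_star p x f : gpair p x f -> gpair p (star x) (star f).
Proof.
elim=> {p x f} [p|d|p x y f g _ h1 _ h2|i s p x f _ h].
- by rewrite !star0; exact: gpair0.
- by rewrite !starZ !star1; exact: gpair_cst.
- by rewrite !starD; exact: gpair_add.
- rewrite !starM !letter_star -add_shr; apply: gpair_mul => //.
  by have := gpair_letter i (~~ s) gpair1; rewrite !mulr1.
Qed.

End GradedPairs.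

Section EvenWords.
Context {R : realType}.

(** Representatives of words modulo even factors: two letters of the same index merge into an even
    element, so at most one of each remains, in a fixed order. *)
Definition word (A : cStarAlgType R) (b1 b2 : A) (e1 e2 s t : bool) : A :=
  (if e1 then letter b1 b2 false s else 1) * (if e2 then letter b1 b2 true t else 1).

Lemma even_eq (A : cStarAlgType R) (b1 b2 : A) x y g :
  even b1 b2 x g -> x = y -> even b1 b2 y g.
Proof. by move=> + <-. Qed.

Definition one_val (z1 z2 r1 r2 : Cplx R) : Cplx R := 1.
Definition opp_val (g : Cplx R -> Cplx R -> Cplx R -> Cplx R -> Cplx R)
  (z1 z2 r1 r2 : Cplx R) := - g z1 z2 r1 r2.

Let even1 (A : cStarAlgType R) (b1 b2 : A) : even b1 b2 1 one_val.
Proof. by apply: even_eq (even_cst _ _ 1) _; rewrite scale1r. Qed.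

(* The coefficient [g] and the word do not depend on the algebra. *)
Lemma letter_word (i s e1 e2 s' t' : bool) : exists g s'' t'',
  forall (A : cStarAlgType R) (b1 b2 : A), relations_m1_0 b1 b2 ->
  exists2 v, even b1 b2 v g & letter b1 b2 i s * word b1 b2 e1 e2 s' t' =
    v * word b1 b2 (if i then e1 else ~~ e1) (if i then ~~ e2 else e2) s'' t''.
Proof.
case: i; last first.
  case: e1.
    exists (even_sqr_val false s s'), s', t' => A b1 b2 hb.
    exists (letter b1 b2 false s * letter b1 b2 false s'); first exact: even_sqr.
    by rewrite /word /= mul1r mulrA.
  exists one_val, s, t' => A b1 b2 hb; exists 1; first exact: even1.
  by rewrite /word /= !mul1r.
case: e1; case: e2.
- exists (opp_val (even_sqr_val true s t')), s', t' => A b1 b2 hb.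
  exists (- (letter b1 b2 true s * letter b1 b2 true t')).
    by apply: even_opp; exact: even_sqr.
  rewrite /word /= mulr1 mulrA letter_anti// !mulNr -[X in - X = _]mulrA; congr (- _).
  by apply: anti_mul; rewrite (letter_anti hb) opprK.
- exists (opp_val one_val), s', s => A b1 b2 hb; exists (- 1).
    by apply: even_opp; exact: even1.
  by rewrite /word /= mulr1 letter_anti// mulN1r.
- exists (even_sqr_val true s t'), s', t' => A b1 b2 hb.
  exists (letter b1 b2 true s * letter b1 b2 true t'); first exact: even_sqr.
  by rewrite /word /= mul1r !mulr1.
- exists one_val, s', s => A b1 b2 hb; exists 1; first exact: even1.
  by rewrite /word /= !mul1r mulr1.
Qed.

End EvenWords.

Section Estimate.
Context {R : realType} {B : cStarAlgType R} (b1 b2 : B).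
Hypothesis hb : relations_m1_0 b1 b2.
Let ha := @bgen_relations R.

Definition shift (i : bool) (p : bool * bool) : bool * bool :=
  if i then (p.1, ~~ p.2) else (~~ p.1, p.2).
Definition parity_add (p q : bool * bool) := (p.1 (+) q.1, p.2 (+) q.2).

Local Notation gh := (gpair b1 b2 (false, false) shift).

Let add0p p : parity_add (false, false) p = p. Proof. by case: p. Qed.
Let add_sh i p q : parity_add (shift i p) q = shift i (parity_add p q).
Proof. by case: i; case: p => -[] []; case: q => -[] []. Qed.
Let add_shr i p : parity_add p (shift i (false, false)) = shift i p.
Proof. by case: i; case: p => -[] []. Qed.

(** The common polynomial [g] of the two even factors is what ties an element of [B] to a
    function. *)
Inductive normal (p : bool * bool) : B -> bdry R -> Prop :=
| normal0 : normal p 0 0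
| normal_word u v g s t : even b1 b2 u g -> even bgen1 bgen2 v g ->
    normal p (u * word b1 b2 p.1 p.2 s t) (v * word bgen1 bgen2 p.1 p.2 s t)
| normal_add x y f g : normal p x f -> normal p y g -> normal p (x + y) (f + g).

Let normal_letter i s p x f : normal p x f ->
  normal (shift i p) (letter b1 b2 i s * x) (letter bgen1 bgen2 i s * f).
Proof.
elim=> {x f} [|u v g s' t' hu hv|x y f g _ h1 _ h2].
- by rewrite !mulr0; exact: normal0.
- have [g' [s'' [t'' h]]] := @letter_word R i s p.1 p.2 s' t'.
  have [w hw ew] := h B b1 b2 hb; have [w' hw' ew'] := h (bdry R) bgen1 bgen2 ha.
  have [u' [hu' eu]] := even_letter hb i s hu.
  have [v' [hv' ev]] := even_letter ha i s hv.
  have := normal_word (shift i p) s'' t'' (even_mul hu' hw) (even_mul hv' hw').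
  have -> : (shift i p).1 = if i then p.1 else ~~ p.1 by case: (i).
  have -> : (shift i p).2 = if i then ~~ p.2 else p.2 by case: (i).
  move: ew ew'; move: (word b1 b2 p.1 p.2 s' t') (word bgen1 bgen2 p.1 p.2 s' t') => W W'.
  move: (word _ _ _ _ _ _) (word _ _ _ _ _ _) => V V' ew ew'.
  by rewrite (mulrA _ u) eu -[u' * _ * W]mulrA ew (mulrA u')
    (mulrA _ v) ev -[v' * _ * W']mulrA ew' (mulrA v').
- by rewrite !mulrDr; exact: normal_add.
Qed.

Let gh_normal p x f : gh p x f -> normal p x f.
Proof.
elim=> {p x f} [p|c|p x y f g _ h1 _ h2|i s p x f _ h].
- exact: normal0.
- have := normal_word (false, false) false false (even_cst b1 b2 c) (even_cst bgen1 bgen2 c).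
  by rewrite /word /= !mulr1.
- exact: normal_add.
- exact: normal_letter.
Qed.

Let even0 (A : cStarAlgType R) (c1 c2 : A) : even c1 c2 0 (fun _ _ _ _ => 0).
Proof. by apply: even_eq (even_cst _ _ 0) _; rewrite scale0r. Qed.

Let gh_even x f : gh (false, false) x f ->
  exists2 g, even b1 b2 x g & even bgen1 bgen2 f g.
Proof.
move=> /gh_normal; elim=> {x f} [|u v g s t hu hv|x y f g _ [h h1 h2] _ [k k1 k2]].
- by exists (fun _ _ _ _ => 0); exact: even0.
- by exists g; rewrite /word /= !mulr1.
- by exists (fun z1 z2 r1 r2 => h z1 z2 r1 r2 + k z1 z2 r1 r2); exact: even_add.
Qed.

Let sgn (i : 'I_2) : Cplx R := if i == 0 then 1 else - 1.
Let lam1 (p : Dom R) := lam (dx1 p) (dz1 p).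
Let lam2 (p : Dom R) := lam (dx2 p) (dz2 p).
Let rho1 (p : Dom R) : Cplx R := (1 - 2 * dx1 p)%:C.
Let rho2 (p : Dom R) : Cplx R := (1 - 2 * dx2 p)%:C.

(** At [bgen1], [bgen2] each [zel] is scalar and each [del] diagonal with eigenvalues of both signs;
    the four diagonal entries correspond to the four choices of signs. *)
Let even_diag f g : even bgen1 bgen2 f g -> forall p, f p =
  diag_mx (\row_(k < 2 * 2) g (lam1 p) (lam2 p)
    (sgn (mxtens_unindex k).1 * rho1 p) (sgn (mxtens_unindex k).2 * rho2 p)) :> 'M[Cplx R]_4.
Proof.
move=> ef p; have ZE (i k : 'I_2) : Zmx i k = sgn i *+ (i == k) :> Cplx R.
  rewrite /Zmx mxE /sgn.
  by case: i => [[|[|//]] ?]; case: k => [[|[|//]] ?]; rewrite ?mulr1n ?mulr0n.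
have oneE (i k : 'I_2) : (1%:M : 'M[Cplx R]_2) i k = 1 *+ (i == k) by rewrite mxE.
have scal (c : Cplx R) : c%:M = diag_mx (\row_(k < 2 * 2) c) :> 'M[Cplx R]_4.
  by apply/matrixP => k l; rewrite !mxE.
elim: ef => {f g} [c|||||||x y f g _ h1 _ h2|x y f g _ h1 _ h2].
- by rewrite bdryZ bdry1 scalemx1 -scal.
- by rewrite bgen_zel1 -scal.
- by rewrite bgen_zel2 -scal.
- rewrite bdryS bgen_zel1 -scal; apply/matrixP => k l.
  by rewrite !mxE rmorphMn eq_sym.
- rewrite bdryS bgen_zel2 -scal; apply/matrixP => k l.
  by rewrite !mxE rmorphMn eq_sym.
- rewrite bgen_del1; apply: kron_eqP => i j k l.
  rewrite [LHS]mxE kronE ZE oneE [RHS]mxE [in RHS]mxE mxtens_indexK /=.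
  rewrite (can_eq (@mxtens_indexK 2 2)) xpair_eqE.
  by case: eqP => _; case: eqP => _; rewrite ?mulr1n ?mulr0n ?mul0r ?mulr0 ?mulr1// mulrC.
- rewrite bgen_del2; apply: kron_eqP => i j k l.
  rewrite [LHS]mxE kronE ZE oneE [RHS]mxE [in RHS]mxE mxtens_indexK /=.
  rewrite (can_eq (@mxtens_indexK 2 2)) xpair_eqE.
  by case: eqP => _; case: eqP => _; rewrite ?mulr1n ?mulr0n ?mul0r ?mulr0 ?mul1r// mulrC.
- by rewrite bdryD h1 h2; apply/matrixP => k l; rewrite !mxE mulrnDl.
- rewrite bdryM h1 h2 mulmx_diag; apply/matrixP => k l; by rewrite !mxE.
Qed.

(* Every point of the joint spectrum of the even part occurs on the diagonal. *)
Let spectrum_surj (z1 z2 : Cplx R) (r1 r2 : R) :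
  r1 ^+ 2 = 1 - 4 * cabs z1 ^+ 2 -> r2 ^+ 2 = 1 - 4 * cabs z2 ^+ 2 ->
  exists p i j, [/\ lam1 p = z1, lam2 p = z2,
    sgn i * rho1 p = r1%:C & sgn j * rho2 p = r2%:C].
Proof.
have one (z : Cplx R) (r : R) : r ^+ 2 = 1 - 4 * cabs z ^+ 2 ->
    exists (x : @Ihalf R) (w : @S1 R) (i : 'I_2),
      lam (\val x) (\val w) = z /\ sgn i * (1 - 2 * \val x)%:C = r%:C.
  (* Solves [1 - 2 x = |r|], whence [x (1 - x) = |z|^2]. The sign of [r] selects the diagonal index
     [i], and [w] is the phase of [z], with the value 1 chosen for [z = 0]. *)
  move=> hr; pose x := (1 - `|r|) / 2.
  have rle1 : `|r| <= 1.
    rewrite -(@ler_pXn2r _ 2)// ?nnegrE ?normr_ge0// expr1n real_normK ?num_real//.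
    by rewrite hr gerBl mulr_ge0// sqr_ge0.
  have rge0 := normr_ge0 r.
  have xI : x \in @Ihalf R by apply/mem_set; rewrite /Ihalf /= in_itv /= /x; lra.
  have xx : x * (1 - x) = cabs z ^+ 2.
    have : `|r| ^+ 2 = r ^+ 2 by rewrite real_normK ?num_real.
    by rewrite hr /x => h; lra.
  have sx : Num.sqrt x * Num.sqrt (1 - x) = cabs z.
    rewrite -sqrtrM; last by rewrite /x; lra.
    by rewrite xx sqrtr_sqr ger0_norm// cabs_ge0.
  have wS : (if z == 0 then 1 else z / `|z|) \in @S1 R.
    apply/mem_set; rewrite /S1 /=; case: eqVneq => [_|z0]; first by rewrite normr1.
    by rewrite normrM normfV normr_id divff// normr_eq0.
  exists (exist (fun y => y \in @Ihalf R) x xI), (exist (fun y => y \in @S1 R) _ wS).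
  exists (if 0 <= r then 0 else 1); split => /=.
    rewrite /lam sx -normCE; case: eqVneq => [->|z0]; first by rewrite normr0 mul0r.
    by rewrite mulrCA divff ?mulr1// normr_eq0.
  have -> : 1 - 2 * x = `|r| by rewrite /x; lra.
  rewrite /sgn; case: (leP 0 r) => h; rewrite ?eqxx ?mul1r.
    by rewrite ger0_norm.
  by rewrite /= mulN1r -rmorphN /= ltr0_norm// opprK.
move=> h1 h2; have [x1 [w1 [i [e1 e2]]]] := one _ _ h1.
have [x2 [w2 [j [e3 e4]]]] := one _ _ h2.
by exists (x1, x2, w1, w2), i, j.
Qed.

Let gh_even_norm x f : gh (false, false) x f -> cnorm x <= cnorm f.
Proof.
move=> /gh_even[g ex ef]; apply: (even_norm_le hb ex) => z1 z2 r1 r2 h1 h2.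
have [p [i [j [<- <- <- <-]]]] := spectrum_surj h1 h2.
have := opnorm_entry (f p) (@mxtens_index 2 2 (i, j)) (@mxtens_index 2 2 (i, j)).
rewrite {1}(even_diag ef p) !mxE mxtens_indexK /= eqxx mulr1n => /le_trans; apply.
by rewrite cnorm_bdry; exact/opnorm_supnorm/bfunP.
Qed.

Let gh_norm p x f : gh p x f -> cnorm x <= cnorm f.
Proof.
move=> h; rewrite -(@ler_pXn2r _ 2) ?nnegrE ?cnorm_ge0// -!cnorm_star.
apply: gh_even_norm; have := gpair_mul add0p add_sh (gpair_star add0p add_sh add_shr h) h.
by case: p h => -[] [].
Qed.

(** Conjugation by this unitary changes the sign of one generator and fixes the other at every
    point, so it implements the parity automorphism. *)
Let grading (i : bool) : 'M[Cplx R]_4 := if i then kron 1%:M Zmx else kron Zmx 1%:M.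

Let grading_sqr i : grading i *m grading i = 1%:M.
Proof. by case: i; rewrite /grading kronM Zmx_sqr mulmx1 kron11. Qed.

Let grading_norm i : opnorm (grading i) <= 1.
Proof.
have ga : (grading i)^t* = grading i.
  by case: i; rewrite /grading kron_adj one_adj Zmx_adj.
have := opnorm_star (grading i); rewrite ga grading_sqr => h.
rewrite -(@ler_pXn2r _ 2) ?nnegrE ?opnorm_ge0// expr1n -h.
by apply: opnorm_le => // v; rewrite mul1mx mul1r.
Qed.

Let grading_letter i j s p : grading i *m letter bgen1 bgen2 j s p =
  (-1) ^+ (i == j) *: (letter bgen1 bgen2 j s p *m grading i).
Proof.
have anti_adj (X : 'M[Cplx R]_2) : X *m Zmx = - (Zmx *m X) -> Zmx *m X^t* = - (X^t* *m Zmx).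
  move=> h; have := congr1 (fun Y : 'M[Cplx R]_2 => Y^t* ) h.
  rewrite adjM Zmx_adj => ->; rewrite -[in RHS]Zmx_adj -adjM.
  by apply/matrixP => k l; rewrite !mxE rmorphN.
have an (x : R) z : Zmx *m amx x z = - (amx x z *m Zmx) by rewrite amx_anti opprK.
have an' (x : R) z := anti_adj _ (amx_anti x z).
case: i; case: j; case: s; rewrite /grading /letter /= ?bdryS ?bgen1E ?bgen2E ?kron_adj
  ?one_adj ?Zmx_adj !kronM ?mul1mx ?mulmx1 ?an ?an' ?kronNl ?kronNr ?expr1 ?expr0
  ?scale1r ?scaleN1r//.
Qed.

Let gh_grading i p x f : gh p x f -> forall q, grading i *m f q =
  (-1) ^+ (if i then p.2 else p.1) *: (f q *m grading i).
Proof.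
elim=> {p x f} [p|c|p x y f g _ h1 _ h2|j s p x f _ h] q.
- by rewrite bdry0 mulmx0 mul0mx scaler0.
- have -> : (if i then (false, false).2 else (false, false).1) = false by case: i.
  by rewrite expr0 scale1r bdryZ bdry1 -scalemxAl -scalemxAr mulmx1 mul1mx.
- by rewrite bdryD mulmxDr mulmxDl h1 h2 scalerDr.
- rewrite bdryM mulmxA grading_letter -scalemxAl -mulmxA h -scalemxAr scalerA mulmxA.
  by congr (_ *: _); case: i {h}; case: j; case: p => -[] [];
    rewrite /= ?expr0 ?expr1 ?mulr1 ?mul1r ?mulrNN ?mulr1.
Qed.

(* Averaging over conjugation by [U] is the projection onto the part commuting
   with [U]. *)
Let opnorm_part (U X Y : 'M[Cplx R]_4) : U *m U = 1%:M -> opnorm U <= 1 ->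
  U *m X = X *m U -> U *m Y = - (Y *m U) ->
  opnorm X <= opnorm (X + Y) /\ opnorm Y <= opnorm (X + Y).
Proof.
move=> U2 U1 UX UY.
have US T : opnorm (U *m T *m U) <= opnorm T.
  apply: le_trans (opnormM _ _) _; apply: le_trans (ler_piMr (opnorm_ge0 _) U1) _.
  by apply: le_trans (opnormM _ _) _; exact: ler_piMl (opnorm_ge0 _) U1.
have USE : U *m (X + Y) *m U = X - Y.
  by rewrite mulmxDr mulmxDl UX UY mulNmx -!mulmxA U2 !mulmx1.
have half (Z T T' : 'M[Cplx R]_4) : Z + Z = T + T' -> opnorm T' <= opnorm T -> opnorm Z <= opnorm T.
  move=> hZ hT; have : opnorm (Z + Z) <= opnorm T + opnorm T.
    by rewrite hZ; apply: le_trans (opnormD _ _) _; exact: lerD (lexx _) hT.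
  have -> : Z + Z = (2%:R : Cplx R) *: Z by rewrite scaler_nat mulr2n.
  rewrite opnormZ -(@natC R 2) cabs_real normr_nat mulr_natl -mulr2n.
  by rewrite lerMn2r.
have := US (X + Y); rewrite USE => hS.
split; [apply: half hS|apply: (half _ _ (- (X - Y)))].
- by rewrite addrACA subrr addr0.
- by rewrite opprB [RHS]addrC addrA subrK.
- by rewrite opnormN.
Qed.

(** The one-point grading admits sums of words of arbitrary parities. *)
Local Notation gen := (gpair b1 b2 tt (fun _ _ => tt)).

Let gen_split x f : gen tt x f -> exists X : bool -> bool -> B, exists F,
  [/\ forall e1 e2, gh (e1, e2) (X e1 e2) (F e1 e2),
    x = (X false false + X false true) + (X true false + X true true) &
    f = (F false false + F false true) + (F true false + F true true)].
Proof.
elim=> {x f} [_|c|_ x y f g _ [X [F [h1 -> ->]]] _ [Y [G [h2 -> ->]]]|i s _ x f _ [X [F [h -> ->]]]].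
- by exists (fun _ _ => 0), (fun _ _ => 0); rewrite !addr0; split=> // *; exact: gpair0.
- exists (fun e1 e2 => if e1 || e2 then 0 else c *: 1).
  exists (fun e1 e2 => if e1 || e2 then 0 else c *: 1); rewrite /= !addr0; split=> // e1 e2.
  by case: e1; case: e2 => /=; [exact: gpair0..|exact: gpair_cst].
- exists (fun e1 e2 => X e1 e2 + Y e1 e2), (fun e1 e2 => F e1 e2 + G e1 e2).
  split; first by move=> e1 e2; exact: gpair_add.
    by rewrite addrACA; congr (_ + _); rewrite addrACA.
  by rewrite addrACA; congr (_ + _); rewrite addrACA.
- case: i.
    exists (fun e1 e2 => letter b1 b2 true s * X e1 (~~ e2)).
    exists (fun e1 e2 => letter bgen1 bgen2 true s * F e1 (~~ e2)).
    split.
    + move=> e1 e2; have := gpair_letter true s (h e1 (~~ e2)).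
      by rewrite /shift /= negbK.
    + by rewrite /= !mulrDr [X in X + _]addrC; congr (_ + _); rewrite addrC.
    + by rewrite /= !mulrDr [X in X + _]addrC; congr (_ + _); rewrite addrC.
  exists (fun e1 e2 => letter b1 b2 false s * X (~~ e1) e2).
  exists (fun e1 e2 => letter bgen1 bgen2 false s * F (~~ e1) e2).
  split.
  + move=> e1 e2; have := gpair_letter false s (h (~~ e1) e2).
    by rewrite /shift /= negbK.
  + by rewrite /= !mulrDr addrC.
  + by rewrite /= !mulrDr addrC.
Qed.

(** Each of the four parity components of [x] is bounded by its counterpart in [f], and two
    applications of [opnorm_part], one for each generator, bound that counterpart pointwise by
    [f]. *)
Let gen_crude x f : gen tt x f -> cnorm x <= 4 * cnorm f.
Proof.
move=> /gen_split[X [F [h -> fE]]].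
have part e1 e2 : cnorm (X e1 e2) <= cnorm f.
  apply: le_trans (gh_norm (h e1 e2)) _; rewrite cnorm_bdry; apply: supnorm_le => p.
  apply: le_trans (opnorm_supnorm p (bfunP f)); rewrite fE !bdryD.
  have gr i e e' := gh_grading i (h e e') p.
  have c0 e2' : grading false *m F false e2' p = F false e2' p *m grading false.
    by rewrite (gr false) /= expr0 scale1r.
  have c1 e2' : grading false *m F true e2' p = - (F true e2' p *m grading false).
    by rewrite (gr false) /= expr1 scaleN1r.
  have d0 e1' : grading true *m F e1' false p = F e1' false p *m grading true.
    by rewrite (gr true) /= expr0 scale1r.
  have d1 e1' : grading true *m F e1' true p = - (F e1' true p *m grading true).
    by rewrite (gr true) /= expr1 scaleN1r.
  have [|| h1 h2] := opnorm_part (X := F false false p + F false true p)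
    (Y := F true false p + F true true p) (grading_sqr false) (grading_norm false).
  - by rewrite mulmxDr mulmxDl !c0.
  - by rewrite mulmxDr mulmxDl !c1 opprD.
  have g1 := opnorm_part (grading_sqr true) (grading_norm true) (d0 false) (d1 false).
  have g2 := opnorm_part (grading_sqr true) (grading_norm true) (d0 true) (d1 true).
  case: e1; case: e2.
  - exact: le_trans (proj2 g2) h2.
  - exact: le_trans (proj1 g2) h2.
  - exact: le_trans (proj2 g1) h1.
  - exact: le_trans (proj1 g1) h1.
apply: le_trans (cnormD _ _) _.
have := cnormD (X false false) (X false true); have := cnormD (X true false) (X true true).
have := part false false; have := part false true.
have := part true false; have := part true true; lra.
Qed.

Let gadd0 (p : unit) : (fun _ _ : unit => tt) tt p = p. Proof. by case: p. Qed.

Lemma gen_mul x y f g : gen tt x f -> gen tt y g -> gen tt (x * y) (f * g).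
Proof. exact: (gpair_mul gadd0 (fun _ _ _ => erefl)). Qed.

Lemma gen_star x f : gen tt x f -> gen tt (star x) (star f).
Proof. exact: (gpair_star gadd0 (fun _ _ _ => erefl) (fun _ _ => erefl)). Qed.

Lemma gen_exp x f n : gen tt x f -> gen tt (x ^+ n) (f ^+ n).
Proof.
by move=> h; elim: n => [|n IH]; [exact: gpair1|rewrite !exprS; exact: gen_mul].
Qed.

(* The constant [4] disappears when the crude bound is applied to high powers of
   [star x * x]. *)
Lemma gen_norm_le x f : gen tt x f -> cnorm x <= cnorm f.
Proof.
move=> h; rewrite -(@ler_pXn2r _ 2) ?nnegrE ?cnorm_ge0// -!cnorm_star.
have {h} := gen_mul (gen_star h) h.
have sx : star (star x * x) = star x * x by rewrite starM starK.
have sf : star (star f * f) = star f * f by rewrite starM starK.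
move: (star x * x) (star f * f) sx sf => y g sy sg h.
rewrite leNgt; apply/negP => lt.
have y0 : 0 < cnorm y by apply: le_lt_trans lt; exact: cnorm_ge0.
have key k : cnorm y ^+ (2 ^ k) <= 4 * cnorm g ^+ (2 ^ k).
  by rewrite -!cnorm_pow2_sa//; exact/gen_crude/gen_exp.
set t := cnorm g / cnorm y.
have t01 : 0 <= t < 1 by rewrite divr_ge0 ?cnorm_ge0//= ltr_pdivrMr// mul1r.
have [N hN] := geometric_small 4 t01 (@ltr01 R).
have NN : (N <= 2 ^ N)%N by rewrite ltnW// ltn_expl.
have := hN _ NN; rewrite expr_div_n mulrA ltr_pdivrMr ?exprn_gt0// mul1r.
by rewrite ltNge key.
Qed.

End Estimate.

(** * Density of the generated *-algebra *)

Section Fibres.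
Context {R : realType} (p : Dom R) (G : 'M[Cplx R]_4 -> Prop).
Local Notation C := (Cplx R).
Local Notation M2 := 'M[Cplx R]_2.
Local Notation M4 := 'M[Cplx R]_4.
Hypothesis G1 : G 1%:M.
Hypothesis GD : forall M N, G M -> G N -> G (M + N).
Hypothesis GM : forall M N, G M -> G N -> G (M *m N).
Hypothesis GZ : forall (c : C) M, G M -> G (c *: M).
Hypothesis GS : forall M, G M -> G (M^t* ).
Hypothesis Ga1 : G (kron (amx (dx1 p) (dz1 p)) 1%:M).
Hypothesis Ga2 : G (kron Zmx (amx (dx2 p) (dz2 p))).

Let mxe21 : M2 := mx22 0 0 1 0.
Let mxe12 : M2 := mx22 0 1 0 0.

Let e21_adj : mxe21^t* = mxe12.
Proof. by rewrite mx22_adj !conjC0 conjC1. Qed.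

(** The coefficients are chosen to cancel the upper right entry. What remains vanishes only at
    [x = 1/2], which is where the fibre becomes smaller. *)
Let amx_e21 (x : R) (z : C) : 0 <= x <= 1/2 -> `|z| = 1 ->
  (Num.sqrt (1 - x))%:C *: amx x z + (- ((Num.sqrt x)%:C * z)) *: (amx x z)^t* =
  (1 - 2 * x)%:C *: mxe21.
Proof.
move=> /andP[x0 x1] z1; rewrite amx_adj /amx !mx22Z mx22D !mulr0 !addr0.
have s1 : ((Num.sqrt (1 - x))%:C : C) * (Num.sqrt (1 - x))%:C = (1 - x)%:C.
  by rewrite -rmorphM /= -expr2 sqr_sqrtr//; lra.
have s0 : ((Num.sqrt x)%:C : C) * (Num.sqrt x)%:C = x%:C.
  by rewrite -rmorphM /= -expr2 sqr_sqrtr.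
have zz : (z * z^*)%R = 1 by rewrite -normCK z1 expr1n.
congr mx22; first by rewrite mulNr [X in X - _]mulrC subrr.
have -> : 1 - 2 * x = (1 - x) - x by lra.
by rewrite [LHS]/= s1 mulNr mulrACA s0 zz !mulr1 [RHS]rmorphB.
Qed.

Let half_neq (x : R) : 0 <= x <= 1/2 -> x != 1/2 -> (1 - 2 * x)%:C != 0 :> C.
Proof.
move=> /andP[x0 x1] xh; apply: contra xh => /eqP/(congr1 (@complex.Re R)) /= h.
by apply/eqP; lra.
Qed.

Let full1 : dx1 p != 1/2 -> forall m : M2, G (kron m 1%:M).
Proof.
move=> xh; have G21 : G (kron mxe21 1%:M).
  have := amx_e21 (dx1_itv p) (dz1_norm p) => h.
  have := GZ (1 - 2 * dx1 p)%:C^-1 (GD (GZ (Num.sqrt (1 - dx1 p))%:C Ga1)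
    (GZ (- ((Num.sqrt (dx1 p))%:C * dz1 p)) (GS Ga1))).
  rewrite kron_adj one_adj -!kronZl -kronDl h kronZl scalerA mulVf ?scale1r//.
  exact: half_neq (dx1_itv p) xh.
have G12 : G (kron mxe12 1%:M) by have := GS G21; rewrite kron_adj one_adj e21_adj.
have G11 : G (kron (mx22 1 0 0 0) 1%:M).
  by have := GM G12 G21; rewrite kronM mulmx1 mx22_mul !(mul0r, mulr0, mulr1, addr0, add0r).
have G22 : G (kron (mx22 0 0 0 1) 1%:M).
  by have := GM G21 G12; rewrite kronM mulmx1 mx22_mul !(mul0r, mulr0, mulr1, addr0, add0r).
move=> m; have := GD (GD (GZ (m 0 0) G11) (GZ (m 0 1) G12)) (GD (GZ (m 1 0) G21) (GZ (m 1 1) G22)).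
rewrite -!kronZl -!kronDl !mx22Z !mx22D !(mulr0, mulr1, addr0, add0r).
by rewrite -mx22E.
Qed.

(** The second generator carries [Zmx] in its first factor, so off-diagonal matrices come with
    [Zmx], while products of two of them, which are diagonal, come without it. *)
Let full2 : dx2 p != 1/2 -> (forall a d, G (kron 1%:M (mx22 a 0 0 d))) /\
  (forall b c, G (kron Zmx (mx22 0 b c 0))).
Proof.
move=> xh; have G21 : G (kron Zmx mxe21).
  have := amx_e21 (dx2_itv p) (dz2_norm p) => h.
  have := GZ (1 - 2 * dx2 p)%:C^-1 (GD (GZ (Num.sqrt (1 - dx2 p))%:C Ga2)
    (GZ (- ((Num.sqrt (dx2 p))%:C * dz2 p)) (GS Ga2))).
  rewrite kron_adj Zmx_adj -!kronZr -kronDr h kronZr scalerA mulVf ?scale1r//.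
  exact: half_neq (dx2_itv p) xh.
have G12 : G (kron Zmx mxe12) by have := GS G21; rewrite kron_adj Zmx_adj e21_adj.
have G11 : G (kron 1%:M (mx22 1 0 0 0)).
  by have := GM G12 G21; rewrite kronM Zmx_sqr mx22_mul !(mul0r, mulr0, mulr1, addr0, add0r).
have G22 : G (kron 1%:M (mx22 0 0 0 1)).
  by have := GM G21 G12; rewrite kronM Zmx_sqr mx22_mul !(mul0r, mulr0, mulr1, addr0, add0r).
split=> [a d|b c].
  have := GD (GZ a G11) (GZ d G22).
  by rewrite -!kronZr -kronDr !mx22Z mx22D !(mulr0, mulr1, addr0, add0r).
have := GD (GZ b G12) (GZ c G21).
by rewrite -!kronZr -kronDr !mx22Z mx22D !(mulr0, mulr1, addr0, add0r).
Qed.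

Let Gn1 : dx1 p = 1/2 -> G (kron (nmx (dz1 p)) 1%:M).
Proof.
move=> xh; have := GZ (Num.sqrt (1/2) : R)%:C^-1 Ga1.
rewrite xh amx_half kronZl scalerA mulVf ?scale1r//.
by rewrite fmorph_eq0 sqrtr_eq0 -ltNge divr_gt0.
Qed.

Let Gn2 : dx2 p = 1/2 -> G (kron Zmx (nmx (dz2 p))).
Proof.
move=> xh; have := GZ (Num.sqrt (1/2) : R)%:C^-1 Ga2.
rewrite xh amx_half kronZr scalerA mulVf ?scale1r//.
by rewrite fmorph_eq0 sqrtr_eq0 -ltNge divr_gt0.
Qed.

Let block (M : M4) (i j : 'I_2) : M2 :=
  \matrix_(k, l) M (@mxtens_index 2 2 (i, k)) (@mxtens_index 2 2 (j, l)).

Let o2 (m : 'I_2) : m = 0 \/ m = 1.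
Proof. by case: m => [[|[|//]] ?]; [left|right]; exact/val_inj. Qed.

Let blockE (M : M4) : M =
  (kron (mx22 1 0 0 0) (block M 0 0) + kron mxe12 (block M 0 1)) +
  (kron mxe21 (block M 1 0) + kron (mx22 0 0 0 1) (block M 1 1)).
Proof.
apply: kron_eqP => i j k l; rewrite [RHS]mxE [X in X + _]mxE [X in _ + X]mxE !kronE.
rewrite /block !mxE.
have [->|->] := o2 i; have [->|->] := o2 k;
  by rewrite /= !(mul0r, mul1r, addr0, add0r).
Qed.

Let block_kron A B i j : block (kron A B) i j = A i j *: B.
Proof. by apply/matrixP => k l; rewrite [LHS]mxE kronE mxE. Qed.

Let block_mul (M N : M4) i j : block (M *m N) i j = \sum_k block M i k *m block N k j.
Proof.
apply/matrixP => k l; rewrite mxE mxE summxE.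
rewrite (reindex (fun ab : 'I_2 * 'I_2 => @mxtens_index 2 2 ab)) /=; last first.
  by exists (@mxtens_unindex 2 2) => x _; [exact: mxtens_indexK|exact: mxtens_unindexK].
under [RHS]eq_bigr do rewrite mxE.
by rewrite pair_big; apply: eq_bigr => -[a b] _; rewrite !mxE.
Qed.

Let diagp (n : M2) : M2 := mx22 (n 0 0) 0 0 (n 1 1).
Let offp (n : M2) : M2 := mx22 0 (n 0 1) (n 1 0) 0.

Let diag_off n : n = diagp n + offp n.
Proof. by rewrite /diagp /offp mx22D !(addr0, add0r) -mx22E. Qed.

Let conj_diag_off n : Zmx *m n *m Zmx = diagp n - offp n.
Proof.
rewrite {1}(mx22E n) /Zmx !mx22_mul /diagp /offp mx22N mx22D.
by congr mx22; ring.
Qed.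

(** For [dx2 p = 1/2] each block commutes with [nmx (dz2 p)], so its diagonal part is scalar and its
    off-diagonal part a multiple of [nmx (dz2 p)]; elsewhere [full2] admits any block. *)
Let block_parts (M : M4) : (dx2 p = 1/2 -> comm4 M (kron 1%:M (nmx (dz2 p)))) ->
  forall i j, G (kron 1%:M (diagp (block M i j))) /\ G (kron Zmx (offp (block M i j))).
Proof.
move=> hM i j; have [xh|xh] := eqVneq (dx2 p) (1/2); last first.
  by have [h1 h2] := full2 xh; split; [exact: h1|exact: h2].
set n := block M i j.
have : n *m nmx (dz2 p) = nmx (dz2 p) *m n.
  have := congr1 (fun X => block X i j) (hM xh); rewrite !block_mul.
  have b1 (k l : 'I_2) : block (kron 1%:M (nmx (dz2 p))) k l = (k == l)%:R *: nmx (dz2 p).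
    by rewrite block_kron mxE.
  rewrite (bigD1 j)//= big1 ?addr0; last first.
    by move=> k /negPf kj; rewrite b1 kj scale0r mulmx0.
  rewrite (bigD1 i)//= big1 ?addr0; last first.
    by move=> k /negPf kj; rewrite b1 eq_sym kj scale0r mul0mx.
  by rewrite !b1 !eqxx !scale1r.
rewrite {1 2}(mx22E n) /nmx !mx22_mul => /mx22_inj[].
rewrite !(mulr0, mul0r, mulr1, mul1r, addr0, add0r) => h01 _ h11 _; split.
  have -> : diagp n = n 0 0 *: 1%:M by rewrite mx22_scalar mx22Z !mulr0 mulr1 /diagp h11.
  by rewrite kronZr kron11; exact: GZ.
have -> : offp n = n 1 0 *: nmx (dz2 p).
  by rewrite /offp /nmx mx22Z !mulr0 mulr1 h01 [X in mx22 _ X]mulrC.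
by rewrite kronZr; apply: GZ; exact: Gn2.
Qed.

(** For [dx1 p] different from 1/2 the first factor is free and removes the [Zmx] attached to
    off-diagonal parts. At 1/2 the commutation relation determines the blocks 11 and 01 from 00 and
    10 through conjugation by [Zmx], so only two blocks have to be produced. *)
Lemma fibre_full (M : M4) :
  (dx1 p = 1/2 -> comm4 M (kron (nmx (dz1 p)) Zmx)) ->
  (dx2 p = 1/2 -> comm4 M (kron 1%:M (nmx (dz2 p)))) -> G M.
Proof.
move=> h1 /block_parts hb; have [xh|xh] := eqVneq (dx1 p) (1/2); last first.
  have Ge e i j : G (kron e (block M i j)).
    have [hd ho] := hb i j; rewrite (diag_off (block M i j)) kronDr.
    have := GD (GM (full1 xh e) hd) (GM (full1 xh (e *m Zmx)) ho).
    by rewrite !kronM !mulmx1 !mul1mx -mulmxA Zmx_sqr mulmx1.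
  by rewrite (blockE M); do !apply: GD.
have {h1} := h1 xh => hc.
have sum2 (F : 'I_2 -> M2) : \sum_k F k = F 0 + F 1.
  by rewrite !big_ord_recl big_ord0 addr0; congr (_ + F _); exact/val_inj.
have c00 := congr1 (fun X => block X 0 1) hc; have c10 := congr1 (fun X => block X 0 0) hc.
rewrite /= !block_mul !sum2 !block_kron /nmx !mxE /= in c00 c10.
rewrite !(scale0r, scale1r, mulmx0, mul0mx, addr0, add0r) in c00 c10.
have b11 : block M 1 1 = Zmx *m block M 0 0 *m Zmx.
  have z0 : dz1 p != 0 by rewrite -normr_eq0 dz1_norm oner_eq0.
  have h : Zmx *m block M 1 1 = block M 0 0 *m Zmx.
    by apply: (scalerI z0); rewrite scalemxAl -c00 scalemxAr.
  by rewrite -mulmxA -h mulmxA Zmx_sqr mul1mx.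
have b01 : block M 0 1 = dz1 p *: (Zmx *m block M 1 0 *m Zmx).
  have /(congr1 (fun X => X *m Zmx)) := c10.
  by rewrite /= -!mulmxA Zmx_sqr mulmx1 => ->; rewrite -scalemxAl !mulmxA.
rewrite (blockE M) b11 b01 !conj_diag_off.
have [d0 o0] := hb 0 0; have [d1 o1] := hb 1 0.
have e00 := diag_off (block M 0 0); have e10 := diag_off (block M 1 0).
move: d0 o0 d1 o1 e00 e10; move: (diagp (block M 0 0)) (offp (block M 0 0)).
move: (diagp (block M 1 0)) (offp (block M 1 0)) => D' O' D O d0 o0 d1 o1 -> ->.
(* In tensor notation [M] is [1 (x) D + Z (x) O + (n (x) 1) (1 (x) D' + Z (x) O')], with the parts
   of block 00 in the first two terms and those of block 10 in the last. *)
have := GD (GD d0 o0) (GM (Gn1 xh) (GD d1 o1)).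
rewrite mulmxDr !kronM !mul1mx mulmx1.
have z00 : mx22 0 0 0 0 = 0 :> M2 by rewrite -mx22_scalar -scalemx1 scale0r.
have e1 : 1%:M = mx22 1 0 0 0 + mx22 0 0 0 1 :> M2 by rewrite mx22D !(addr0, add0r) mx22_scalar.
have eZ : Zmx = mx22 1 0 0 0 - mx22 0 0 0 1 :> M2.
  by rewrite mx22N mx22D !(oppr0, addr0, add0r).
have en : nmx (dz1 p) = dz1 p *: mxe12 + mxe21.
  by rewrite mx22Z mx22D !(mulr0, mulr1, addr0, add0r).
have eZn : nmx (dz1 p) *m Zmx = mxe21 - dz1 p *: mxe12.
  by rewrite mx22Z mx22N mx22D mx22_mul; congr mx22; ring.
rewrite eZn en e1 eZ !(kronDl, kronDr, kronNl, kronNr, kronZl, kronZr) !scalerBr.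
suff h (a b c d e f g k : M4) : (a + b + (c - d)) + (e + f + (g - k)) =
    (a + c + (e - k)) + (f + g + (b - d)).
  by rewrite h.
by apply/matrixP => i j; rewrite !mxE; ring.
Qed.

End Fibres.

(** * Peak functions, as in the Brosowski-Deutsch proof of the Stone-Weierstrass theorem *)

Section Bernoulli.
Context {R : realType}.
Implicit Types t : R.

Lemma bernoulli_lower t m : 0 <= t <= 1 -> 1 - m%:R * t <= (1 - t) ^+ m.
Proof.
move=> /andP[t0 t1]; elim: m => [|m IH]; first by rewrite mul0r subr0 expr0.
rewrite exprS; have : (1 - t) * (1 - m%:R * t) <= (1 - t) * (1 - t) ^+ m.
  by apply: ler_wpM2l => //; lra.
apply: le_trans; have m0 := ler0n R m; rewrite -natr1.
have := mulr_ge0 (mulr_ge0 m0 t0) t0; lra.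
Qed.

Lemma bernoulli_upper t m : 0 <= t <= 1 -> (1 - t) ^+ m * (1 + m%:R * t) <= 1.
Proof.
move=> /andP[t0 t1]; elim: m => [|m IH]; first by rewrite mul0r addr0 expr0 mulr1.
apply: le_trans IH; rewrite exprSr -[X in X <= _]mulrA; apply: ler_wpM2l.
  by rewrite exprn_ge0//; lra.
have m0 := ler0n R m; rewrite -natr1.
have := mulr_ge0 (mulr_ge0 m0 t0) t0; have := mulr_ge0 t0 t0; lra.
Qed.

(* Powers turn the gap between [t] small and [t] large into a gap between
   values close to [1] and close to [0]. *)
Definition peak (k n : nat) t : R := (1 - t ^+ n) ^+ (k ^ n).

Lemma peak_itv k n t : 0 <= t <= 1 -> 0 <= peak k n t <= 1.
Proof.
move=> /andP[t0 t1]; have s0 := exprn_ge0 n t0; have s1 := exprn_ile1 n t0 t1.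
by rewrite /peak exprn_ge0 ?exprn_ile1//; lra.
Qed.

Lemma peak_near1 k n t : 0 <= t <= 1 -> k%:R * t <= 1/2 -> 1 - (1/2) ^+ n <= peak k n t.
Proof.
move=> /andP[t0 t1] kt.
have s : 0 <= t ^+ n <= 1 by rewrite exprn_ge0 ?exprn_ile1.
apply: le_trans (bernoulli_lower _ s); rewrite natrX -exprMn lerD2l lerN2.
by apply: lerXn2r => //; rewrite nnegrE ?mulr_ge0// divr_ge0.
Qed.

(** The upper Bernoulli inequality bounds the power by [1 / (1 + (k t)^n)]. *)
Lemma peak_near0 k n t : 0 <= t <= 1 -> 2 <= k%:R * t -> peak k n t <= (1/2) ^+ n.
Proof.
move=> /andP[t0 t1] kt.
have s : 0 <= t ^+ n <= 1 by rewrite exprn_ge0 ?exprn_ile1.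
have := bernoulli_upper (k ^ n) s; rewrite natrX -exprMn => h1.
have h : 2 ^+ n <= (k%:R * t) ^+ n.
  by apply: lerXn2r => //; rewrite nnegrE ?mulr_ge0.
have p2 : 0 < 2 ^+ n :> R by rewrite exprn_gt0.
rewrite div1r exprVn -[leRHS]div1r ler_pdivlMr//; apply: le_trans h1.
apply: ler_wpM2l; last by rewrite (le_trans h)// lerDr.
by case/andP: (peak_itv k n (introT andP (conj t0 t1))).
Qed.

End Bernoulli.

Section Separation.
Context {R : realType}.
Local Notation C := (Cplx R).
Local Notation L1 q := (lam (dx1 q) (dz1 q)).
Local Notation L2 q := (lam (dx2 q) (dz2 q)).

Let cabs_unit (z : C) : `|z| = 1 -> cabs z = 1.
Proof. by rewrite /cabs => ->. Qed.

Lemma cabs_lam x (z : C) : `|z| = 1 -> cabs (lam x z) = Num.sqrt x * Num.sqrt (1 - x).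
Proof.
by move=> z1; rewrite /lam cabsM (cabs_unit z1) mulr1 cabs_real ger0_norm// mulr_ge0 ?sqrtr_ge0.
Qed.

Lemma cabs_lam_le x (z : C) : 0 <= x <= 1/2 -> `|z| = 1 -> cabs (lam x z) <= 1/2.
Proof.
move=> /andP[x0 x1] z1; rewrite cabs_lam//.
have s : Num.sqrt x ^+ 2 = x by rewrite sqr_sqrtr.
have t : Num.sqrt (1 - x) ^+ 2 = 1 - x by rewrite sqr_sqrtr//; lra.
by have := sqr_ge0 (Num.sqrt x - Num.sqrt (1 - x)); nra.
Qed.

Lemma lam_inj x y (z w : C) : 0 <= x <= 1/2 -> 0 <= y <= 1/2 -> `|z| = 1 -> `|w| = 1 ->
  lam x z = lam y w -> x = y /\ (x = 0 \/ z = w).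
Proof.
move=> hx hy z1 w1 h; have [/andP[x0 x1] /andP[y0 y1]] := (hx, hy).
have xy : x = y.
  have := congr1 (fun c => cabs c ^+ 2) h.
  rewrite /= !cabs_lam// !exprMn !sqr_sqrtr//; try lra.
  (* The second factor vanishes only for [x = y = 1/2], since neither variable exceeds 1/2. *)
  move=> e; have /eqP : (x - y) * (1 - x - y) = 0 by lra.
  by rewrite mulf_eq0 => /orP[] /eqP; lra.
split=> //; case: (eqVneq x 0) => [->|xn0]; [by left|right].
move: h; rewrite -xy /lam; apply: mulfI.
rewrite fmorph_eq0 mulf_neq0// sqrtr_eq0 -ltNge; last by lra.
by rewrite lt_def xn0.
Qed.

(** Half the squared distance between the values of the central elements [zel] at [q] and at [p];
    each difference has modulus at most 1. Being a polynomial in [zel] and its adjoint, it lies in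
    the generated algebra, and so do its peak functions. *)
Definition theta (p q : Dom R) : R :=
  (cabs (L1 q - L1 p) ^+ 2 + cabs (L2 q - L2 p) ^+ 2) / 2.

Lemma theta_itv p q : 0 <= theta p q <= 1.
Proof.
have h (x y : R) (z w : C) : 0 <= x <= 1/2 -> 0 <= y <= 1/2 -> `|z| = 1 -> `|w| = 1 ->
    0 <= cabs (lam x z - lam y w) ^+ 2 <= 1.
  move=> hx hy z1 w1; rewrite sqr_ge0 exprn_ile1 ?cabs_ge0//.
  apply: le_trans (cabsB _ _) _.
  by have := cabs_lam_le hx z1; have := cabs_lam_le hy w1; lra.
have := h _ _ _ _ (dx1_itv q) (dx1_itv p) (dz1_norm q) (dz1_norm p).
have := h _ _ _ _ (dx2_itv q) (dx2_itv p) (dz2_norm q) (dz2_norm p).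
rewrite /theta; lra.
Qed.

Lemma theta_eq0 p q : theta p q = 0 -> same_base q p.
Proof.
have c0 (c d : C) : cabs (c - d) ^+ 2 = 0 -> c = d.
  by move=> /eqP; rewrite sqrf_eq0 => /eqP/cabs_eq0/subr0_eq.
rewrite /theta; move=> h; have h1 := sqr_ge0 (cabs (L1 q - L1 p)).
have h2 := sqr_ge0 (cabs (L2 q - L2 p)).
have /c0/(lam_inj (dx1_itv q) (dx1_itv p) (dz1_norm q) (dz1_norm p)) [] :
  cabs (L1 q - L1 p) ^+ 2 = 0 by lra.
have /c0/(lam_inj (dx2_itv q) (dx2_itv p) (dz2_norm q) (dz2_norm p)) [] :
  cabs (L2 q - L2 p) ^+ 2 = 0 by lra.
by move=> *; split.
Qed.

Definition theta_el p : bdry R := (2^-1 : R)%:C *: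
  (star (zel bgen1 bgen2 false - L1 p *: 1) * (zel bgen1 bgen2 false - L1 p *: 1) +
   star (zel bgen1 bgen2 true - L2 p *: 1) * (zel bgen1 bgen2 true - L2 p *: 1)).

Lemma theta_elE p q : theta_el p q = ((theta p q)%:C : C)%:M.
Proof.
have sc (x y : C) : (x%:M - y *: 1%:M)^t* *m (x%:M - y *: 1%:M) =
    ((cabs (x - y) ^+ 2)%:C : C)%:M :> 'M[C]_4.
  have -> : x%:M - y *: 1%:M = (x - y)%:M :> 'M[C]_4 by rewrite scalemx1 raddfB.
  have -> : ((x - y)%:M : 'M[C]_4)^t* = ((x - y)^*)%R%:M.
    by apply/matrixP => i j; rewrite !mxE rmorphMn eq_sym.
  by rewrite sqr_cabs [RHS]scalar_mxM.
rewrite /theta_el bdryZ bdryD !bdryM !bdryS !bdryD !bdryN !bdryZ !bdry1.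
rewrite bgen_zel1 bgen_zel2 (sc (L1 q)) (sc (L2 q)) -raddfD scale_scalar_mx.
by rewrite /theta [in RHS]mulrC [in RHS]rmorphM [in RHS]rmorphD.
Qed.

Lemma theta_continuous p : continuous (theta p).
Proof.
move=> q; have /boundary_algebraP[/(_ q)/continuous_entryP/(_ 0 0) + _ _ _] := bfunP (theta_el p).
move=> /(@continuous_cplxP _ _ (fun q => theta_el p q 0 0)) h.
apply/continuous_Rp => e /h; apply: filterS => q'; rewrite !theta_elE !mxE /=.
by rewrite !mulr1n -rmorphB cabs_real.
Qed.

End Separation.

Section Density.
Context {R : realType} {B : cStarAlgType R} (b1 b2 : B).
Local Notation C := (Cplx R).

Definition pgen (f : bdry R) : Prop := exists x, gpair b1 b2 tt (fun _ _ => tt) tt x f.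

Lemma pgen_cst c : pgen (c *: 1).
Proof. by exists (c *: 1); exact: gpair_cst. Qed.

Lemma pgenD f g : pgen f -> pgen g -> pgen (f + g).
Proof. by move=> [x hx] [y hy]; exists (x + y); exact: gpair_add. Qed.

Lemma pgenM f g : pgen f -> pgen g -> pgen (f * g).
Proof. by move=> [x hx] [y hy]; exists (x * y); exact: gen_mul. Qed.

Lemma pgenZ c f : pgen f -> pgen (c *: f).
Proof. by move=> [x hx]; exists (c *: x); exact: gpair_scale. Qed.

Lemma pgen_star f : pgen f -> pgen (star f).
Proof. by move=> [x hx]; exists (star x); exact: gen_star. Qed.

Lemma pgenX f n : pgen f -> pgen (f ^+ n).
Proof. by move=> [x hx]; exists (x ^+ n); exact: gen_exp. Qed.

Lemma pgen1 : pgen 1.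
Proof. by have := pgen_cst 1; rewrite scale1r. Qed.

Lemma pgenB f g : pgen f -> pgen g -> pgen (f - g).
Proof. by move=> hf hg; rewrite -scaleN1r; exact/pgenD/pgenZ. Qed.

Lemma pgen_letter i s : pgen (letter bgen1 bgen2 i s).
Proof.
exists (letter b1 b2 i s); have := gpair_letter i s (gpair1 b1 b2 tt (fun _ _ => tt)).
by rewrite !mulr1.
Qed.

Lemma pgen_fibre (f : bdry R) p : exists2 g, pgen g & g p = f p.
Proof.
have /boundary_algebraP[_ _ f1 f2] := bfunP f.
apply: (@fibre_full R p (fun M => exists2 g, pgen g & g p = M)).
- by exists 1; [exact: pgen1|].
- by move=> _ _ [g hg <-] [h hh <-]; exists (g + h); [exact: pgenD|].
- by move=> _ _ [g hg <-] [h hh <-]; exists (g * h); [exact: pgenM|].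
- by move=> c _ [g hg <-]; exists (c *: g); [exact: pgenZ|].
- by move=> _ [g hg <-]; exists (star g); [exact: pgen_star|].
- by exists bgen1; [exact: (pgen_letter false false)|].
- by exists bgen2; [exact: (pgen_letter true false)|].
- exact: f1.
- exact: f2.
Qed.

Lemma pgen_theta p : pgen (theta_el p).
Proof.
have h i c : pgen (zel bgen1 bgen2 i - c *: 1).
  by apply: pgenB; [exact/pgenX/pgen_letter|exact: pgen_cst].
by apply: pgenZ; apply: pgenD; apply: pgenM => //; exact: pgen_star.
Qed.


Lemma bdryX_scalar (g : bdry R) q c n : g q = c%:M -> (g ^+ n) q = (c ^+ n)%:M.
Proof.
by move=> gq; elim: n => [|n IH]; rewrite ?bdry1// !exprS bdryM gq IH scalar_mxM.
Qed.

Definition peak_el k n p : bdry R := (1 - theta_el p ^+ n) ^+ (k ^ n).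

Lemma peak_elE k n p q : peak_el k n p q = ((peak k n (theta p q))%:C : C)%:M.
Proof.
rewrite /peak rmorphXn; apply: bdryX_scalar.
rewrite bdryD bdryN bdry1 (bdryX_scalar n (theta_elE p q)) -raddfB.
by rewrite [in RHS]rmorphB [in RHS]rmorphXn.
Qed.

Lemma pgen_peak k n p : pgen (peak_el k n p).
Proof. by apply: pgenX; apply: pgenB; [exact: pgen1|exact/pgenX/pgen_theta]. Qed.

(** A zero of [theta p] has the same base as [p], so [f] and [g] agree there. Compactness turns this
    into a positive lower bound for [theta p] on the set where they differ by [e]. *)
Lemma theta_gap (f g : bdry R) p (e : R) : 0 < e -> g p = f p ->
  exists k, forall q, e <= opnorm (f q - g q) -> 1 <= k%:R * theta p q.
Proof.
move=> e0 gf; have /compact_near_coveringP/(_ nat \oo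
  (fun k q => e <= opnorm (f q - g q) -> 1 <= k%:R * theta p q)) := @compact_Dom R.
case=> [q _|N _ hN]; last by exists N => q; apply: (hN N (leqnn N)).
have le_or_lt (x y : R) : x <= y \/ y < x by case: leP => _; [left|right].
have [ge|lt] := le_or_lt e (opnorm (f q - g q)); last first.
  have d0 : 0 < e - opnorm (f q - g q) by rewrite subr_gt0.
  have /boundary_algebraP[/(_ q)/continuous_opnormP/(_ _ d0) h _ _ _] := bfunP (f - g).
  exists ([set q' | opnorm ((f - g) q' - (f - g) q) < e - opnorm (f q - g q)], setT).
    by split=> //; exact: filterT.
  move=> [q' k] [/= h1 _] h2; exfalso; move: h2; rewrite leNgt; apply/negP/negPn.
  have := opnormD ((f - g) q' - (f - g) q) (f q - g q).
  rewrite !bdryD !bdryN subrK => h3; apply: le_lt_trans h3 _.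
  by rewrite -ltrBrDr; exact: h1.
have t0 : 0 < theta p q.
  rewrite lt_def (andP (theta_itv p q)).1 andbT; apply/eqP => /theta_eq0 sb.
  have /boundary_algebraP[_ /(_ _ _ sb) fe _ _] := bfunP f.
  have /boundary_algebraP[_ /(_ _ _ sb) ge' _ _] := bfunP g.
  by move: ge; rewrite fe ge' gf subrr opnorm0 leNgt e0.
have t2 : 0 < theta p q / 2 by rewrite divr_gt0.
have /continuous_Rp/(_ _ t2) hc := @theta_continuous R p q.
have hn : \forall n \near \oo, 2 / theta p q <= n%:R by exact: nbhs_infty_ger.
exists ([set q' | `|theta p q' - theta p q| < theta p q / 2],
  [set n | 2 / theta p q <= n%:R]) => //.
move=> [q' k] [/= h1 h2] _; move: h1 h2; rewrite ltr_norml ler_pdivrMr//.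
move=> /andP[h1 _] h2; have k0 := ler0n R k.
apply: (@le_trans _ _ (k%:R * (theta p q / 2))); first lra.
by apply: ler_wpM2l => //; lra.
Qed.

(** The estimate behind gluing: [a] is the error of the new local approximant, [b] that of the
    previous one, [W] the weight of the new one. Either the weight is almost 1 where the new error
    is small, or the previous error is small and the weight almost 0 wherever the new error is
    large. *)
Let convex_bound (e eta eps W a b M N : R) : 0 <= W <= 1 -> 0 <= eps ->
  a <= N -> b <= M -> 0 <= a -> 0 <= b -> eps * (M + N) <= eta / 2 -> 0 < eta -> 0 < e ->
  (a < e /\ 1 - eps <= W) \/ (b <= e + eta / 2 /\ (e <= a -> W <= eps)) ->
  W * a + (1 - W) * b <= e + eta.
Proof.
move=> /andP[W0 W1] p0 aN bM a0 b0 pMN eta0 e0.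
have W1' : 0 <= 1 - W by lra.
have pM : 0 <= eps * M by rewrite mulr_ge0//; lra.
have pN : 0 <= eps * N by rewrite mulr_ge0//; lra.
have Wa : W * a <= a by rewrite -[leRHS]mul1r ler_wpM2r.
have Wb : (1 - W) * b <= b by rewrite -[leRHS]mul1r ler_wpM2r//; lra.
case=> [[ae We]|[be We]].
  have : (1 - W) * b <= eps * M by apply: ler_pM => //; lra.
  lra.
have [lt|ge] := ltP a e.
  have : W * a <= W * (e + eta / 2) by apply: ler_wpM2l => //; lra.
  have : (1 - W) * b <= (1 - W) * (e + eta / 2) by apply: ler_wpM2l.
  lra.
have : W * a <= eps * N by apply: ler_pM => //; exact: We.
lra.
Qed.

Lemma pgen_dense (f : bdry R) (e : R) : 0 < e -> exists2 g, pgen g & cnorm (f - g) <= e.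
Proof.
move=> e0; have e2 : 0 < e / 2 by rewrite divr_gt0.
have loc p : exists Qk : bdry R * nat, pgen Qk.1 /\
    forall q, e / 2 <= opnorm (f q - Qk.1 q) -> 1 <= Qk.2%:R * theta p q.
  have [Q hQ Qp] := pgen_fibre f p; have [k hk] := theta_gap e2 Qp.
  by exists (Q, k).
have [Qk hQk] := choice loc.
have le_or_lt (x y : R) : x <= y \/ y < x by case: leP => _; [left|right].
have two1 (x : R) : 1 <= x -> 2 * x < 1/2 -> False by lra.
have two2 (x : R) : 1 <= x -> 2 <= 2 * x by lra.
(* With [k] doubled, a point where the approximant is bad has [2 k theta >= 2], and a point of [V p]
   has [2 k theta < 1/2]: these are the thresholds of [peak_near0] and [peak_near1]. *)
pose V p := [set q | (2 * (Qk p).2)%:R * theta p q < 1/2].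
(* The tolerance [eta] is arbitrary so that each gluing step can hand [eta / 2] to the induction
   hypothesis. *)
have main (s : seq (Dom R)) eta : 0 < eta -> exists2 g, pgen g &
    forall p q, p \in s -> V p q -> opnorm (f q - g q) <= e / 2 + eta.
  elim: s eta => [|p s IH] eta eta0; first by exists 1; [exact: pgen1|].
  have eta2 : 0 < eta / 2 by rewrite divr_gt0.
  have [g' hg' g'P] := IH _ eta2.
  have [hQ kP] := hQk p; set Q := (Qk p).1 in hQ kP; set k := (Qk p).2 in kP.
  have h01 : 0 <= (1/2 : R) < 1 by lra.
  have [n /(_ n (leqnn n)) hn] :=
    geometric_small (cnorm (f - g') + cnorm (f - Q)) h01 eta2.
  pose w := peak_el (2 * k) n p.
  exists (w * Q + (1 - w) * g').
    by apply: pgenD; apply: pgenM => //; [|apply: pgenB; first exact: pgen1]; exact: pgen_peak.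
  move=> p' q p's Vq; set W := peak (2 * k) n (theta p q).
  have -> : f q - (w * Q + (1 - w) * g') q =
      (W%:C : C) *: (f q - Q q) + ((1 - W)%:C : C) *: (f q - g' q).
    rewrite bdryD !bdryM bdryD bdryN bdry1 peak_elE -/W rmorphB mulmxBl mul1mx.
    rewrite !mul_scalar_mx; apply/matrixP => i j; rewrite !mxE; ring.
  have tI := theta_itv p q; have W01 := peak_itv (2 * k) n tI.
  apply: le_trans (opnormD _ _) _; rewrite !opnormZ !cabs_real !ger0_norm; last first.
  - by case/andP: W01.
  - by rewrite subr_ge0; case/andP: W01.
  apply: (@convex_bound _ _ ((1/2) ^+ n) _ _ _ (cnorm (f - g')) (cnorm (f - Q))) => //.
  - exact: (opnorm_supnorm q (bfunP (f - Q))).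
  - exact: (opnorm_supnorm q (bfunP (f - g'))).
  - exact: opnorm_ge0.
  - exact: opnorm_ge0.
  - by rewrite mulrC; exact: ltW.
  have kt : (2 * k)%:R * theta p q = 2 * (k%:R * theta p q) by rewrite natrM mulrA.
  have := p's; rewrite inE => /orP[/eqP p'p|p's']; [left|right].
    move: Vq; rewrite p'p /V /= -/k => Vq; split; last by apply: peak_near1 => //; exact: ltW.
    have [/kP h|h] := le_or_lt (e / 2) (opnorm (f q - Q q)); last exact: h.
    by exfalso; move: Vq; rewrite kt; exact: two1 h.
  split; first exact: g'P p's' Vq.
  by move=> /kP h; apply: peak_near0 => //; rewrite kt; exact: two2 h.
(* Along the filter of sufficiently large finite lists, the near-covering form of compactness yields
   a finite subcover by the sets [V p]. *)
pose F := [set A : set (seq (Dom R)) | exists s0 : seq (Dom R),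
  forall s : seq (Dom R), {subset s0 <= s} -> A s].
have FF : Filter F.
  split; first by exists [::].
  - move=> A A' [s hs] [s' hs']; exists (s ++ s') => t st.
    by split; [apply: hs|apply: hs'] => x xs; apply: st; rewrite mem_cat xs ?orbT.
  - by move=> A A' AA' [s hs]; exists s => t /hs; exact: AA'.
have /compact_near_coveringP/(_ _ F (fun s q => exists2 p, p \in s & V p q) FF) := @compact_Dom R.
case=> [q _|s /(_ s (fun _ => id)) hs].
  exists (V q, [set s : seq (Dom R) | q \in s]); last by move=> [q' s] [/= Vq' qs]; exists q.
  split; last by exists [:: q] => s; apply; rewrite mem_head.
  have c0 : 0 <= (2 * (Qk q).2)%:R :> R by exact: ler0n.
  have t0 : theta q q = 0 by rewrite /theta !subrr cabs0 expr0n addr0 mul0r.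
  have d0 : 0 < 1/2 / ((2 * (Qk q).2)%:R + 1) :> R by rewrite !divr_gt0// ltr_wpDl.
  have /continuous_Rp/(_ _ d0) := @theta_continuous R q q; apply: filterS => q' /=.
  rewrite t0 subr0 ltr_pdivlMr ?ltr_wpDl// /V /=; move: c0; move: (_%:R) => c c0 h.
  have := ler_norm (theta q q'); have := normr_ge0 (theta q q') => h0 h1.
  by have := ler_wpM2l c0 h1; lra.
have [g hg gP] := main s _ e2.
exists g => //; rewrite cnorm_bdry; apply: supnorm_le => q.
have [p ps Vq] := hs q I; have := gP p q ps Vq.
by rewrite -splitr.
Qed.

End Density.

(** * Universality *)

Section Universality.
Context {R : realType} {B : cStarAlgType R} (b1 b2 : B).
Hypothesis hb : relations_m1_0 b1 b2.
Local Notation gen := (gpair b1 b2 tt (fun _ _ => tt) tt).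

Let genB x y f g : gen x f -> gen y g -> gen (x - y) (f - g).
Proof.
by move=> h1 h2; rewrite -(scaleN1r y) -(scaleN1r g); exact/gpair_add/gpair_scale.
Qed.

(** The closure of the graph of evaluation. Algebraic laws pass to limits of pairs before the
    relation is known to be single-valued. *)
Definition extends (f : bdry R) (x : B) := exists u g,
  [/\ forall n, gen (u n) (g n), tends u x & tends g f].

Let extends_ex f : exists x, extends f x.
Proof.
have e0 n : 0 < (1/2) ^+ n :> R by rewrite exprn_gt0// divr_gt0.
have half3 (t : R) : 0 <= t -> 1/2 * t + t <= 2 * t by lra.
have hg n : exists xg : B * bdry R, gen xg.1 xg.2 /\ cnorm (f - xg.2) <= (1/2) ^+ n.
  by have [g [x hx] fg] := pgen_dense b1 b2 f (e0 n); exists (x, g).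
have [xg hxg] := choice hg.
have h01 : 0 <= (1/2 : R) < 1 by lra.
(* Consecutive approximants of [f] differ by at most [(1/2)^n.+1 + (1/2)^n], less than twice
   [(1/2)^n], and [gen_norm_le] transfers this bound to [B]. *)
have [n|x hx] := @geometric_tends R B (fun n => (xg n).1) (1/2) 2 h01.
  have [g0 d0] := hxg n; have [g1 d1] := hxg n.+1.
  apply: le_trans (gen_norm_le hb (genB g1 g0)) _.
  apply: le_trans (cnorm_tri _ f _) _; rewrite cnorm_subC.
  apply: le_trans (lerD d1 d0) _; rewrite exprS; exact/half3/ltW/e0.
exists x, (fun n => (xg n).1), (fun n => (xg n).2); split=> [n||e e1] //.
  by case: (hxg n).
have [N hN] := geometric_small 1 h01 e1; exists N => n Nn.
by rewrite cnorm_subC (le_lt_trans (hxg n).2)// -[X in X < _]mul1r hN.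
Qed.

Let extends_le f x : extends f x -> cnorm x <= cnorm f.
Proof.
have arith (a b c d k m e : R) : a <= b + c -> b < e / 2 -> c <= d -> d <= k + m ->
  k < e / 2 -> a <= m + e by lra.
move=> [u [g [ug ux gf]]]; apply/ler_addgt0Pr => e e0.
have e2 : 0 < e / 2 by rewrite divr_gt0.
have [N hN] := ux _ e2; have [N' hN'] := gf _ e2.
have h1 := hN _ (leq_maxl N N'); have h2 := hN' _ (leq_maxr N N').
have h3 := cnormD (x - u (maxn N N')) (u (maxn N N')).
have h4 := cnormD (g (maxn N N') - f) f; rewrite !subrK in h3 h4.
rewrite cnorm_subC in h3; exact: arith h3 h1 (gen_norm_le hb (ug _)) h4 h2.
Qed.

Let extendsD f g x y : extends f x -> extends g y -> extends (f + g) (x + y).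
Proof.
move=> [u [p [up ux pf]]] [v [q [vq vy qg]]].
exists (fun n => u n + v n), (fun n => p n + q n); split; [|exact: tendsD..].
by move=> n; exact: gpair_add.
Qed.

Let extendsM f g x y : extends f x -> extends g y -> extends (f * g) (x * y).
Proof.
move=> [u [p [up ux pf]]] [v [q [vq vy qg]]].
exists (fun n => u n * v n), (fun n => p n * q n); split; [|exact: tendsM..].
by move=> n; exact: gen_mul.
Qed.

Let extendsZ c f x : extends f x -> extends (c *: f) (c *: x).
Proof.
move=> [u [p [up ux pf]]].
exists (fun n => c *: u n), (fun n => c *: p n); split; [|exact: tendsZ..].
by move=> n; exact: gpair_scale.
Qed.

Let extends_star f x : extends f x -> extends (star f) (star x).
Proof.
move=> [u [p [up ux pf]]].
exists (fun n => star (u n)), (fun n => star (p n)); split; [|exact: tends_star..].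
by move=> n; exact: gen_star.
Qed.

Let extends_gen f x : gen x f -> extends f x.
Proof.
by move=> xf; exists (fun=> x), (fun=> f); split=> //; exact: tends_cst.
Qed.

(** The difference [x - y] is paired with the zero function, so the norm estimate annihilates it. *)
Let extends_fun f x y : extends f x -> extends f y -> x = y.
Proof.
move=> hx hy; have /extends_le := extendsD hx (extendsZ (- 1) hy).
rewrite !scaleN1r subrr cnorm0 => h; apply/eqP; rewrite -subr_eq0; apply/eqP/cnorm_eq0.
by apply: le_anti; rewrite h cnorm_ge0.
Qed.

Let star_hom_gen (h : bdry R -> B) p x f : star_hom h -> h bgen1 = b1 -> h bgen2 = b2 ->
  gpair b1 b2 tt (fun _ _ => tt) p x f -> h f = x.
Proof.
move=> hh h1 h2; have [hD hZ hM h_1 hS] := hh.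
elim=> {p x f} [_|c|p x y f g _ ex _ ey|i s p x f _ ex].
- exact: star_hom0.
- by rewrite hZ h_1.
- by rewrite hD ex ey.
- by rewrite hM ex; congr (_ * _); case: i; case: s; rewrite /letter ?hS ?h1 ?h2.
Qed.

Lemma bdry_universal : exists! h : bdry R -> B, [/\ star_hom h, h bgen1 = b1 & h bgen2 = b2].
Proof.
have [h hP] := choice extends_ex.
have gen_letter i : gen (letter b1 b2 i false) (letter bgen1 bgen2 i false).
  have := gpair_letter i false (gpair1 b1 b2 tt (fun _ _ => tt)).
  by rewrite !mulr1.
have hh : star_hom h.
  split=> [f g|c f|f g||f].
  - exact: extends_fun (hP _) (extendsD (hP f) (hP g)).
  - exact: extends_fun (hP _) (extendsZ c (hP f)).
  - exact: extends_fun (hP _) (extendsM (hP f) (hP g)).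
  - by apply: extends_fun (hP _) (extends_gen _); exact: gpair1.
  - exact: extends_fun (hP _) (extends_star (hP f)).
exists h; split.
  split=> //; apply: extends_fun (hP _) (extends_gen _).
    exact: (gen_letter false).
  exact: (gen_letter true).
(* Uniqueness: a competitor [k] takes the approximants [g n] to [u n], and [star_hom_le] makes it
   continuous, so it has the same limit at [f]. *)
move=> k [hk k1 k2]; apply/funext => f; have [u [g [ug uh gf]]] := hP f.
apply: (tends_unique uh) => e /gf[N hN]; exists N => n /hN; apply: le_lt_trans.
by rewrite -(star_hom_gen hk k1 k2 (ug n)) -star_homB//; exact: star_hom_le.
Qed.

End Universality.

Section Isomorphism.
Context {R : realType}.

Lemma star_hom_id (A : cStarAlgType R) : star_hom (@id A).
Proof. by []. Qed.

Lemma star_hom_comp (A B D : cStarAlgType R) (h : A -> B) (k : B -> D) :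
  star_hom h -> star_hom k -> star_hom (k \o h).
Proof.
move=> [hD hZ hM h1 hS] [kD kZ kM k1 kS]; split=> [x y|c x|x y||x] /=.
- by rewrite hD kD.
- by rewrite hZ kZ.
- by rewrite hM kM.
- by rewrite h1 k1.
- by rewrite hS kS.
Qed.

Lemma universal_endo (E : cStarAlgType R) (a1 a2 : E) (h : E -> E) :
  is_universal_m1_0 a1 a2 -> star_hom h -> h a1 = a1 -> h a2 = a2 -> h = id.
Proof.
move=> [ra /(_ _ _ _ ra)[k [_ uk]]] hh h1 h2.
by rewrite -(uk h)// (uk id)//; split=> //; exact: star_hom_id.
Qed.

Lemma bdry_is_universal : is_universal_m1_0 (@bgen1 R) bgen2.
Proof. by split=> [|B b1 b2 hb]; [exact: bgen_relations|exact: bdry_universal]. Qed.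

End Isomorphism.

(* The first conjunct says that the universal C*-algebra exists; the second
   one that it is isomorphic to the algebra of matrix-valued functions. *)
Theorem theorem3p3 (R : realType) :
  (exists (E : cStarAlgType R) (a1 a2 : E), is_universal_m1_0 a1 a2) /\
  (forall (E : cStarAlgType R) (a1 a2 : E), is_universal_m1_0 a1 a2 ->
     isomorphic_to_functions E (boundary_algebra R)).
Proof.
split; first by exists (bdry R), bgen1, bgen2; exact: bdry_is_universal.
move=> E a1 a2 uE; have uF := @bdry_is_universal R.
have [h [[hh h1 h2] _]] := uE.2 _ _ _ (@bgen_relations R).
have [k [[hk k1 k2] _]] := uF.2 _ _ _ uE.1.
have kh a : k (h a) = a.
  have := universal_endo uE (star_hom_comp hh hk).
  by rewrite /= h1 h2 => /(_ k1 k2)/(congr1 (@^~ a)).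
have hkK f : h (k f) = f.
  have := universal_endo uF (star_hom_comp hk hh).
  by rewrite /= k1 k2 => /(_ h1 h2)/(congr1 (@^~ f)).
have [hD hZ hM h_1 hS] := hh.
exists (fun a p => h a p); split.
- split=> [a b p|c a p|a b p|p|a p].
  + by rewrite hD.
  + by rewrite hZ.
  + by rewrite hM.
  + by rewrite h_1.
  + by rewrite hS.
- by move=> a b ab; rewrite -(kh a) (bdry_eq (fun p => congr1 (@^~ p) ab)) kh.
- apply/seteqP; split=> [_ [a _ <-]|f Ff]; first exact: bfunP.
  by exists (k (Bdry Ff)) => //; rewrite hkK.
(* Both [h] and its inverse [k] are contractive, so [h] is isometric. *)
- move=> a; rewrite -cnorm_bdry; apply: le_anti; rewrite -{1}(kh a).
  by rewrite !star_hom_le.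
Qed.
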